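(* Let $C$ be a tropical curve in $L^3_2$, and let $D$ be the classical line $D=\mathrm{span}\{[1,1,0,0]\}$. Let $k_1,k_2\in\mathbb N_{\ge0}$ be the multiplicities of the rays $(1,1,0,0)$ and $(0,0,1,1)$ in $C$, respectively, and set $k=\min(k_1,k_2)$. If $C\cdot D<-k$, then the tropical curve $C$ is not realizable in $L$.
   Context: Let $K$ be an algebraically closed field, $S=K[x_0^{\pm1},\dots,x_3^{\pm1}]$, $S_0$ its degree-$0$ part, $X=\mathrm{Spec}(S_0)$ the $3$-dimensional torus, $L=(x_0+x_1+x_2+x_3)\subset S$, $L_0=L\cap S_0$, and $E=\mathrm{Spec}(S_0/L_0)$. In $\mathbb R^4/\langle\mathbf 1\rangle$, $\mathbf 1=(1,1,1,1)$, with lattice $\mathbb Z^4/\langle\mathbf 1\rangle$, write $[v]$ for the class of $v$ and $e_0,\dots,e_3$ for the unit vectors. $L^3_2=\mathrm{trop}(E)$ is the $2$-dimensional fan with maximal cones $\mathrm{cone}([e_i],[e_j])$, $i<j$, all of multiplicity $1$. A tropical curve in $L^3_2$ is a $1$-dimensional rational fan with support in $L^3_2$ and non-negative integer multiplicities $m(\sigma)$ on its rays with $\sum_\sigma m(\sigma)u_\sigma=0$, where $u_\sigma$ is the primitive lattice generator of $\sigma$. $P(C)\subset\mathbb Z^4$ is the set of vectors $m(\sigma)v_\sigma$, one for each ray $\sigma$ of $C$ of positive multiplicity, with $v_\sigma\in\mathbb Z^4$ the representative of $u_\sigma$ with minimal coordinate $0$. The degree of $C$ is the number $d$ with $\sum_{v\in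 P(C)}v=d\cdot\mathbf 1$. The line $D$ is the tropical curve with $P(D)=\{(1,1,0,0),(0,0,1,1)\}$, of degree $1$. The multiplicity of a vector in $C$ is the multiplicity of the ray it spans ($0$ if this is not a ray of $C$). The intersection product of two tropical curves $C_1,C_2$ in $L^3_2$ is $$C_1\cdot C_2=\deg(C_1)\deg(C_2)-\sum_{0\le i<j\le3}\ \sum_{\substack{ae_i+be_j\in P(C_1),\ a,b>0}}\ \sum_{\substack{ce_i+de_j\in P(C_2),\ c,d>0}}\min(ad,bc).$$ Tropicalization (trivial valuation, min-convention): for $f=\sum_\nu a_\nu x^\nu\in S_0$ and $\omega\in\mathbb R^4$ let $\mathrm{in}_\omega(f)$ be the sum of the terms $a_\nu x^\nu$, $a_\nu\ne0$, with $\omega\cdot\nu$ minimal; $\mathrm{in}_\omega(I)$ is the ideal generated by all $\mathrm{in}_\omega(f)$, $f\in I$. For an irreducible curve $Y\subset X$ with prime ideal $P\subset S_0$, $\mathrm{trop}(Y)\subset\mathbb R^4/\langle\mathbf 1\rangle$ is the image of $\{\omega:\mathrm{in}_\omega(P)\ne S_0\}$, with multiplicity $\sum_Q\ell((S_0/\mathrm{in}_\omega(P))_Q)$ on a ray $\sigma$, where $\omega$ is in the relative interior of $\sigma$ and $Q$ runs over the minimal primes of $\mathrm{in}_\omega(P)$. Extend this linearly to a map $\mathrm{Trop}$ on $1$-cycles. $C$ is realizable in $L$ if there is an effective $1$-cycle $Y$ in $E$ (a non-negative integer combination of irreducible curves in $E$) with $\mathrm{Trop}(Y)=C$. *)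

(* Defs.v *)
From HB Require Import structures.
From mathcomp Require Import all_boot all_order all_algebra.
From mathcomp Require Import generic_quotient ring_quotient finmap.
From mathcomp Require Import boolp classical_sets functions cardinality fsbigop.
From mathcomp Require Import reals.
From mathcomp Require Import monalg ring.

Set Implicit Arguments.
Unset Strict Implicit.
Unset Printing Implicit Defensive.

Import Order.TTheory GRing.Theory Num.Theory.

Local Open Scope classical_set_scope.
Local Open Scope ring_scope.
Local Open Scope quotient_scope.

(* The library's [idealr] only covers proper boolean ideals; initial ideals
   may be the whole ring, so ideals are classical sets here, and quotients and
   localizations are allowed to be the zero ring. *)
Section Ideals.
Variable A : comPzRingType.
Implicit Types I P : set A.

Definition is_ideal I : Prop :=
  [/\ I 0, forall x y, I x -> I y -> I (x + y) & forall a x, I x -> I (a * x)].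

Definition is_prime P : Prop :=
  [/\ is_ideal P, ~ P 1 & forall x y, P (x * y) -> P x \/ P y].

Record ideal := Ideal { ideal_set :> set A; _ : is_ideal ideal_set }.

Record spec := Spec { spec_set :> set A; _ : is_prime spec_set }.

Lemma idealP (I : ideal) : is_ideal I.
Proof. by case: I. Qed.

Lemma specP (P : spec) : is_prime P.
Proof. by case: P. Qed.

Definition spec_ideal (P : spec) : ideal :=
  Ideal (let: And3 h _ _ := specP P in h).

Lemma smallest_is_ideal (G : set A) : is_ideal (smallest is_ideal G).
Proof.
split.
- by move=> I [[]].
- by move=> x y hx hy I hI; have [_ hD _] := hI.1; apply: hD; [exact: hx|exact: hy].
- by move=> a x hx I hI; have [_ _ hM] := hI.1; apply: hM; exact: hx.
Qed.

Definition ideal_gen (G : set A) : ideal := Ideal (smallest_is_ideal G).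

Definition minimal_prime (I : set A) (Q : spec) : Prop :=
  I `<=` Q /\ forall Q' : spec, I `<=` Q' -> Q' `<=` Q -> Q `<=` Q'.

Definition prime_chain (n : nat) : Prop :=
  exists c : 'I_n.+1 -> set A,
    (forall i, is_prime (c i)) /\ (forall i j : 'I_n.+1, (i < j)%N -> c i `<` c j).

Definition krull_dim_eq (n : nat) : Prop := prime_chain n /\ ~ prime_chain n.+1.

Definition ideal_chain (n : nat) : Prop :=
  exists c : 'I_n.+1 -> set A,
    (forall i, is_ideal (c i)) /\ (forall i j : 'I_n.+1, (i < j)%N -> c i `<` c j).

(* Length of [A] as a module over itself; the junk value 0 is used when the
   length is infinite. *)
Definition ring_length : nat :=
  xget 0%N [set n | ideal_chain n /\ ~ ideal_chain n.+1].

End Ideals.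

HB.instance Definition _ (A : comPzRingType) := gen_eqMixin (spec A).
HB.instance Definition _ (A : comPzRingType) := gen_choiceMixin (spec A).

Section QuotientRing.
Variables (A : comPzRingType) (I : ideal A).

Definition ideal_mem : pred A := fun x => `[< ideal_set I x >].

Lemma ideal_mem_closed : zmod_closed ideal_mem.
Proof.
have [I0 ID IM] := idealP I; split; first exact/asboolP.
move=> x y /asboolP hx /asboolP hy; apply/asboolP; apply: ID => //.
by rewrite -mulN1r; apply: IM.
Qed.

HB.instance Definition _ := GRing.isZmodClosed.Build A ideal_mem ideal_mem_closed.

Definition quotient := Quotient.quot (GRing.ZmodClosed.clone A ideal_mem _).
HB.instance Definition _ := GRing.Zmodule.on quotient.
HB.instance Definition _ := EqQuotient.on quotient.

Definition proj (x : A) : quotient := \pi_(quotient) x.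

Lemma projK (q : quotient) : proj (repr q) = q.
Proof. exact: reprK. Qed.

Lemma projP (x y : A) : proj x = proj y <-> ideal_set I (x - y).
Proof.
split.
  by move/eqP; rewrite /proj -Quotient.idealrBE => /asboolP.
by move=> h; apply/eqP; rewrite /proj -Quotient.idealrBE; apply/asboolP.
Qed.

Lemma projD : {morph proj : x y / x + y}.
Proof. by move=> x y; rewrite /proj !piE. Qed.

Definition quot_one : quotient := proj 1.
Definition quot_mul (p q : quotient) : quotient := proj (repr p * repr q).

Lemma projM : {morph proj : x y / x * y >-> quot_mul x y}.
Proof.
have [_ ID IM] := idealP I.
move=> x y; apply/projP; set x' := repr _; set y' := repr _.
have hx : ideal_set I (x - x') by apply/projP; rewrite projK.
have hy : ideal_set I (y - y') by apply/projP; rewrite projK.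
have -> : x * y - x' * y' = y * (x - x') + x' * (y - y').
  by rewrite !mulrBr [y * x]mulrC [y * x']mulrC addrA subrK.
by apply: ID; apply: IM.
Qed.

Lemma quot_mulA : associative quot_mul.
Proof.
by move=> p q r; rewrite -[p]projK -[q]projK -[r]projK -!projM mulrA.
Qed.

Lemma quot_mulC : commutative quot_mul.
Proof. by move=> p q; rewrite /quot_mul mulrC. Qed.

Lemma quot_mul1 : left_id quot_one quot_mul.
Proof. by move=> p; rewrite -[p]projK -projM mul1r. Qed.

Lemma quot_mulDl : left_distributive quot_mul +%R.
Proof.
move=> p q r; rewrite -[p]projK -[q]projK -[r]projK.
by rewrite -projD -!projM -projD mulrDl.
Qed.

HB.instance Definition _ := GRing.Zmodule_isComPzRing.Build quotient
  quot_mulA quot_mulC quot_mul1 quot_mulDl.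

End QuotientRing.

Section Localization.
Variable B : comPzRingType.

Record submonoid := Submonoid {
  submonoid_set :> set B;
  submonoid1 : submonoid_set 1;
  submonoidM : forall s t,
    submonoid_set s -> submonoid_set t -> submonoid_set (s * t) }.

Variable M : submonoid.

Definition denominator := {s : B | `[< submonoid_set M s >]}.

Lemma denP (s : denominator) : submonoid_set M (val s).
Proof. exact/asboolP/(valP s). Qed.

Definition mkden (s : B) (h : submonoid_set M s) : denominator := exist _ s (asboolT h).

Definition den1 : denominator := mkden (submonoid1 M).
Definition denM (s t : denominator) : denominator :=
  mkden (submonoidM (denP s) (denP t)).

(* The pair (a, s) stands for the fraction a / s. *)
Definition frac_eq (x y : B * denominator) : bool :=
  `[< exists u, submonoid_set M u /\ u * (x.1 * val y.2 - y.1 * val x.2) = 0 >].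

Lemma frac_eq_equiv : equiv_class_of frac_eq.
Proof.
split.
- move=> x; apply/asboolP; exists 1; split; first exact: submonoid1.
  by rewrite subrr mulr0.
- move=> x y; apply/asboolP/asboolP => -[u [hu e]]; exists u; split=> //;
    by rewrite -opprB mulrN e oppr0.
- move=> [b t] [a s] [c r] /asboolP[u [hu /= eu]] /asboolP[v [hv /= ev]].
  apply/asboolP; exists (u * v * val t); split=> /=.
    by apply: submonoidM (denP t); apply: submonoidM.
  have -> : u * v * val t * (a * val r - c * val s) =
      v * val r * (u * (a * val t - b * val s)) +
      u * val s * (v * (b * val r - c * val t)) by ring.
  by rewrite eu ev !mulr0 addr0.
Qed.

Canonical frac_equiv := EquivRelPack frac_eq_equiv.

Definition localization := {eq_quot frac_equiv}.
HB.instance Definition _ := Choice.on localization.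
HB.instance Definition _ := EqQuotient.on localization.

Definition frac (a : B) (s : denominator) : localization :=
  \pi_(localization) (a, s).

Lemma fracP a s b t : frac a s = frac b t <->
  exists u, submonoid_set M u /\ u * (a * val t - b * val s) = 0.
Proof.
split.
  by move/eqP; rewrite /frac eqmodE => /asboolP.
by move=> h; apply/eqP; rewrite /frac eqmodE; apply/asboolP.
Qed.

Lemma frac_repr (x : localization) : frac (repr x).1 (repr x).2 = x.
Proof. by rewrite /frac -surjective_pairing reprK. Qed.

Lemma loc_ind (P : localization -> Prop) :
  (forall a s, P (frac a s)) -> forall x, P x.
Proof. by move=> h x; rewrite -(frac_repr x). Qed.

Definition loc_zero : localization := frac 0 den1.
Definition loc_one : localization := frac 1 den1.
Definition loc_opp (x : localization) : localization :=
  frac (- (repr x).1) (repr x).2.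
Definition loc_add (x y : localization) : localization :=
  frac ((repr x).1 * val (repr y).2 + (repr y).1 * val (repr x).2)
       (denM (repr x).2 (repr y).2).
Definition loc_mul (x y : localization) : localization :=
  frac ((repr x).1 * (repr y).1) (denM (repr x).2 (repr y).2).

Lemma frac_reprP a s : exists u, submonoid_set M u /\
  u * ((repr (frac a s)).1 * val s - a * val (repr (frac a s)).2) = 0.
Proof. by apply/fracP; rewrite frac_repr. Qed.

Lemma loc_oppE a s : loc_opp (frac a s) = frac (- a) s.
Proof.
have [u [hu e]] := frac_reprP a s; apply/fracP; exists u; split=> //.
set x := repr _ in e *; rewrite !mulNr -opprD mulrN.
by rewrite [X in - X]e oppr0.
Qed.

Lemma loc_addE a s b t :
  loc_add (frac a s) (frac b t) = frac (a * val t + b * val s) (denM s t).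
Proof.
have [u [hu]] := frac_reprP a s; have [v [hv]] := frac_reprP b t.
rewrite /loc_add.
set x := repr (frac a s); set y := repr (frac b t) => ev eu.
apply/fracP; exists (u * v); split=> /=; first exact: submonoidM.
have -> : u * v * ((x.1 * val y.2 + y.1 * val x.2) * (val s * val t) -
    (a * val t + b * val s) * (val x.2 * val y.2)) =
  v * val y.2 * val t * (u * (x.1 * val s - a * val x.2)) +
  u * val x.2 * val s * (v * (y.1 * val t - b * val y.2)) by ring.
by rewrite eu ev !mulr0 addr0.
Qed.

Lemma loc_mulE a s b t :
  loc_mul (frac a s) (frac b t) = frac (a * b) (denM s t).
Proof.
have [u [hu]] := frac_reprP a s; have [v [hv]] := frac_reprP b t.
rewrite /loc_mul.
set x := repr (frac a s); set y := repr (frac b t) => ev eu.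
apply/fracP; exists (u * v); split=> /=; first exact: submonoidM.
have -> : u * v * (x.1 * y.1 * (val s * val t) - a * b * (val x.2 * val y.2)) =
  v * y.1 * val t * (u * (x.1 * val s - a * val x.2)) +
  u * a * val x.2 * (v * (y.1 * val t - b * val y.2)) by ring.
by rewrite eu ev !mulr0 addr0.
Qed.

Lemma frac_eqE a s b t : a * val t = b * val s -> frac a s = frac b t.
Proof.
move=> e; apply/fracP; exists 1; split; first exact: submonoid1.
by rewrite e subrr mulr0.
Qed.

Lemma loc_addA : associative loc_add.
Proof.
elim/loc_ind => a s; elim/loc_ind => b t; elim/loc_ind => c r.
by rewrite !loc_addE; apply: frac_eqE => /=; ring.
Qed.

Lemma loc_addC : commutative loc_add.
Proof.
elim/loc_ind => a s; elim/loc_ind => b t.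
by rewrite !loc_addE; apply: frac_eqE => /=; ring.
Qed.

Lemma loc_add0 : left_id loc_zero loc_add.
Proof.
by elim/loc_ind => a s; rewrite loc_addE; apply: frac_eqE => /=; ring.
Qed.

Lemma loc_addN : left_inverse loc_zero loc_opp loc_add.
Proof.
elim/loc_ind => a s.
by rewrite loc_oppE loc_addE; apply: frac_eqE => /=; ring.
Qed.

HB.instance Definition _ := GRing.isZmodule.Build localization
  loc_addA loc_addC loc_add0 loc_addN.

Lemma loc_mulA : associative loc_mul.
Proof.
elim/loc_ind => a s; elim/loc_ind => b t; elim/loc_ind => c r.
by rewrite !loc_mulE; apply: frac_eqE => /=; ring.
Qed.

Lemma loc_mulC : commutative loc_mul.
Proof.
elim/loc_ind => a s; elim/loc_ind => b t.
by rewrite !loc_mulE; apply: frac_eqE => /=; ring.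
Qed.

Lemma loc_mul1 : left_id loc_one loc_mul.
Proof.
by elim/loc_ind => a s; rewrite loc_mulE; apply: frac_eqE => /=; ring.
Qed.

Lemma loc_mulDl : left_distributive loc_mul loc_add.
Proof.
elim/loc_ind => a s; elim/loc_ind => b t; elim/loc_ind => c r.
by rewrite !(loc_mulE, loc_addE); apply: frac_eqE => /=; ring.
Qed.

HB.instance Definition _ := GRing.Zmodule_isComPzRing.Build localization
  loc_mulA loc_mulC loc_mul1 loc_mulDl.

End Localization.

Section LocalizedQuotient.
Variables (A : comPzRingType) (I : ideal A) (Q : spec A).

Definition compl_image : set (quotient I) :=
  [set proj I s | s in ~` (Q : set A)].

Lemma compl_image1 : compl_image 1.
Proof. by exists 1 => //; have [] := specP Q. Qed.

Lemma compl_imageM s t : compl_image s -> compl_image t -> compl_image (s * t).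
Proof.
move=> [x hx <-] [y hy <-]; exists (x * y); last exact: projM.
by have [_ _ hQ] := specP Q; move/hQ=> [].
Qed.

(* (A / I)_Q, the localization of A / I at the image of A \ Q. *)
Definition quotient_at : comPzRingType :=
  localization (Submonoid compl_image1 compl_imageM).

End LocalizedQuotient.

Local Open Scope fset_scope.
Local Open Scope ring_scope.

(* The library's product on [{malg K[M]}] requires a monoid [M] whose only
   invertible element is 1, which excludes lattices; hence the group algebra. *)
Section GroupAlgebra.
Variables (K : comNzRingType) (V : zmodType).

Definition group_algebra := {malg K[V]}.
HB.instance Definition _ := GRing.Lmodule.on group_algebra.

Implicit Types (f g h : group_algebra) (m n : V) (c d : K).

Definition monom c m : group_algebra := mkmalgU m c.

Definition ga_one : group_algebra := monom 1 0.
Definition ga_mul f g : group_algebra :=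
  \sum_(m <- msupp f) \sum_(n <- msupp g)
    monom (mcoeff m f * mcoeff n g) (m + n).

Lemma monom0 m : monom 0 m = 0.
Proof. exact: monalgU0. Qed.

Lemma monomD m c d : monom (c + d) m = monom c m + monom d m.
Proof. exact: monalgUD. Qed.

Lemma group_algebraE f : f = \sum_(m <- msupp f) monom (mcoeff m f) m.
Proof. exact: monalgE. Qed.

Lemma ga_mulw (d1 d2 : {fset V}) f g :
  msupp f `<=` d1 -> msupp g `<=` d2 ->
  ga_mul f g = \sum_(m <- d1) \sum_(n <- d2)
    monom (mcoeff m f * mcoeff n g) (m + n).
Proof.
move=> le_d1 le_d2; rewrite /ga_mul (big_fset_incl _ le_d1) /=.
  apply/eq_bigr=> k1 _; apply/big_fset_incl => // k _ /mcoeff_outdom ->.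
  by rewrite mulr0 monom0.
move=> k _ /mcoeff_outdom g1k.
by rewrite big1 => // k' _; rewrite g1k mul0r monom0.
Qed.

Lemma ga_mulC : commutative ga_mul.
Proof.
move=> f g; rewrite /ga_mul exchange_big /=.
apply: eq_bigr => m _; apply: eq_bigr => n _.
by rewrite mulrC addrC.
Qed.

Lemma ga_mulDl : left_distributive ga_mul +%R.
Proof.
move=> f1 f2 g; set d := msupp f1 `|` msupp f2.
rewrite (@ga_mulw d (msupp g) (f1 + f2)) ?msuppD_le //.
rewrite (@ga_mulw d (msupp g) f1) ?fsubsetUl //.
rewrite (@ga_mulw d (msupp g) f2) ?fsubsetUr //.
rewrite -big_split /=; apply/eq_bigr=> k1 _.
rewrite -big_split /=; apply/eq_bigr=> k2 _.
by rewrite mcoeffD mulrDl monomD.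
Qed.

Lemma ga_mulDr : right_distributive ga_mul +%R.
Proof. by move=> f g h; rewrite ga_mulC ga_mulDl !(ga_mulC f). Qed.

Lemma ga_mul0l : left_zero 0 ga_mul.
Proof. by move=> g; rewrite /ga_mul msupp0 big_seq_fset0. Qed.

Lemma ga_mul0r : right_zero 0 ga_mul.
Proof. by move=> g; rewrite ga_mulC ga_mul0l. Qed.

Lemma ga_mulUU c d m n : ga_mul (monom c m) (monom d n) = monom (c * d) (m + n).
Proof.
rewrite (ga_mulw msuppU_le msuppU_le) !big_seq_fset1.
by rewrite /monom !mcoeffUU.
Qed.

Lemma ga_mul_suml g I (r : seq I) (F : I -> group_algebra) :
  ga_mul (\sum_(i <- r) F i) g = \sum_(i <- r) ga_mul (F i) g.
Proof.
exact: (big_morph (ga_mul^~ g) (fun x y => ga_mulDl x y g) (ga_mul0l g)).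
Qed.

Lemma ga_mul_sumr f I (r : seq I) (F : I -> group_algebra) :
  ga_mul f (\sum_(i <- r) F i) = \sum_(i <- r) ga_mul f (F i).
Proof. exact: (big_morph (ga_mul f) (ga_mulDr f) (ga_mul0r f)). Qed.

Lemma ga_mulA : associative ga_mul.
Proof.
move=> f g h.
rewrite (group_algebraE f) !ga_mul_suml; apply: eq_bigr => m _.
rewrite (group_algebraE g) ga_mul_suml !ga_mul_sumr ga_mul_suml.
apply: eq_bigr => n _.
rewrite (group_algebraE h) !ga_mul_sumr; apply: eq_bigr => p _.
by rewrite !ga_mulUU mulrA addrA.
Qed.

Lemma ga_mul1 : left_id ga_one ga_mul.
Proof.
move=> f; rewrite [in LHS](group_algebraE f) [in RHS](group_algebraE f).
rewrite ga_mul_sumr.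
by apply: eq_bigr => m _; rewrite ga_mulUU mul1r add0r.
Qed.

Lemma ga_one_neq0 : ga_one != 0.
Proof. by rewrite monalgU_eq0 oner_eq0. Qed.

HB.instance Definition _ := GRing.Zmodule_isComNzRing.Build group_algebra
  ga_mulA ga_mulC ga_mul1 ga_mulDl ga_one_neq0.

Lemma msupp_ga_mul f g m : m \in msupp (f * g) ->
  exists m1 m2, [/\ m1 \in msupp f, m2 \in msupp g & m = m1 + m2].
Proof.
move=> hm; apply: contrapT => no.
move: hm; rewrite -mcoeff_neq0 => /eqP; apply.
have -> : f * g = ga_mul f g by [].
rewrite /ga_mul raddf_sum /= big_seq big1 // => m1 h1.
rewrite raddf_sum /= big_seq big1 // => m2 h2.
rewrite mcoeffU; case: eqP => // e; case: no.
by exists m1, m2; split.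
Qed.

End GroupAlgebra.

Local Open Scope classical_set_scope.
Local Open Scope ring_scope.

Section Laurent.
Variable K : fieldType.

Definition laurent := group_algebra K 'rV[int]_4.
HB.instance Definition _ := GRing.ComNzRing.on laurent.

Implicit Types (f g : laurent) (m n : 'rV[int]_4).

Definition lvar (i : 'I_4) : laurent := monom 1 (delta_mx 0 i).

Definition exp_degree m : int := \sum_i m 0 i.

Lemma exp_degreeD m n : exp_degree (m + n) = exp_degree m + exp_degree n.
Proof. by rewrite -big_split; apply: eq_bigr => i _; rewrite mxE. Qed.

Definition degree0 : {pred laurent} :=
  fun f => all (fun m => exp_degree m == 0) (msupp f).

Lemma degree0_closed : subring_closed degree0.
Proof.
split.
- apply/allP => m /(fsubsetP msuppU_le); rewrite inE => /eqP ->.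
  by rewrite /exp_degree big1 // => i _; rewrite mxE.
- move=> f g /allP hf /allP hg; apply/allP => m /(fsubsetP (msuppB_le _ _)).
  by rewrite inE => /orP[/hf|/hg].
- move=> f g /allP hf /allP hg; apply/allP => m.
  move=> /msupp_ga_mul[m1 [m2 [/hf/eqP h1 /hg/eqP h2 ->]]].
  by rewrite exp_degreeD h1 h2 addr0.
Qed.

HB.instance Definition _ :=
  GRing.isSubringClosed.Build laurent degree0 degree0_closed.

Record laurent0 :=
  Laurent0 { laurent0_val :> laurent; _ : laurent0_val \in degree0 }.
HB.instance Definition _ := [isSub for laurent0_val].
HB.instance Definition _ := [Choice of laurent0 by <:].
HB.instance Definition _ := [SubChoice_isSubComNzRing of laurent0 by <:].

(* The ideal L = (x_0 + x_1 + x_2 + x_3) and its degree-0 part. *)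
Definition plane_ideal : ideal laurent := ideal_gen [set \sum_i lvar i].
Definition plane_ideal0 : set laurent0 :=
  [set f : laurent0 | (plane_ideal : set laurent) (val f)].

(* Irreducible curves in Spec S_0, given by their prime ideals. *)
Definition curve :=
  {P : spec laurent0 | `[< krull_dim_eq (quotient (spec_ideal P)) 1 >]}.

Definition curve_ideal (Y : curve) : set laurent0 := spec_set (val Y).

Definition effective_cycle := {fsfun curve -> nat with 0%N}.

Definition cycle_in_plane (Y : effective_cycle) : Prop :=
  forall Z, Z \in finsupp Y -> plane_ideal0 `<=` curve_ideal Z.

End Laurent.

Section Initial.
Variables (K : fieldType) (R : realType).
Implicit Types (w : 'rV[R]_4) (m : 'rV[int]_4).

Definition weight w m : R := \sum_i w 0 i * (m 0 i)%:~R.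

Definition in_form w (f : laurent K) : laurent K :=
  \sum_(m <- msupp f | all (fun n => weight w m <= weight w n) (msupp f))
    monom (mcoeff m f) m.

Lemma in_form_degree0 w f : f \in @degree0 K -> in_form w f \in @degree0 K.
Proof.
move=> /allP hf; rewrite /in_form big_seq_cond.
apply: rpred_sum => m /andP[hm _].
apply/allP => n /(fsubsetP msuppU_le); rewrite inE => /eqP ->; exact: hf.
Qed.

Definition in_form0 w (f : laurent0 K) : laurent0 K :=
  Laurent0 (in_form_degree0 w (valP f)).

Definition in_ideal w (I : set (laurent0 K)) : ideal (laurent0 K) :=
  ideal_gen [set in_form0 w f | f in I].

End Initial.

(* Subsets of V / <1>, for V = Z^4 or R^4, are given by their preimages in V,
   and equality in V / <1> by [eq_mod1]. *)
Definition eq_mod1 (V : zmodType) (u v : 'rV[V]_4) : Prop :=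
  exists c, u = v + const_mx c.

Definition row4 (V : zmodType) (a b c d : V) : 'rV[V]_4 :=
  \row_i nth 0 [:: a; b; c; d] i.

(* The case [n = 0] forces the class of [v] to be nonzero. *)
Definition primitive (v : 'rV[int]_4) : Prop :=
  forall (n : nat) w, eq_mod1 v (w *+ n) -> n = 1%N.

(* A rational ray sigma of R^4 / <1> is encoded by v_sigma, the representative
   with minimal coordinate 0 of its primitive lattice generator. *)
Definition is_ray (v : 'rV[int]_4) : bool :=
  [&& [forall i, 0 <= v 0 i], [exists i, v 0 i == 0] & `[< primitive v >]].

Definition ray := {v : 'rV[int]_4 | is_ray v}.

Section Fan.
Variable R : realType.

Definition real_vec (v : 'rV[int]_4) : 'rV[R]_4 := map_mx intr v.

Definition ray_cone (s : ray) : set 'rV[R]_4 :=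
  [set w | exists t : R, 0 <= t /\ eq_mod1 w (t *: real_vec (val s))].

Definition cone2 (i j : 'I_4) : set 'rV[R]_4 :=
  [set w | exists a b : R, [/\ 0 <= a, 0 <= b &
    eq_mod1 w (a *: delta_mx 0 i + b *: delta_mx 0 j)]].

Definition L32 : set 'rV[R]_4 :=
  [set w | exists i j : 'I_4, (i < j)%N /\ cone2 i j w].

(* Rays of multiplicity 0 are not recorded. *)
Record tropical_curve := TropicalCurve {
  multiplicity :> {fsfun ray -> nat with 0%N};
  multiplicity_L32 : forall s, (0 < multiplicity s)%N -> ray_cone s `<=` L32;
  balanced :
    eq_mod1 (\sum_(s <- finsupp multiplicity) val s *+ multiplicity s) 0 }.

Implicit Types C D : tropical_curve.

Definition fan_support C : set 'rV[R]_4 :=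
  [set w | exists s, (0 < C s)%N /\ ray_cone s w].

Definition tropP C : seq 'rV[int]_4 := [seq val s *+ C s | s <- finsupp C].

Definition degree C : int := (\sum_(v <- tropP C) v) 0 0.

Lemma degreeP C : \sum_(v <- tropP C) v = const_mx (degree C).
Proof.
rewrite /degree /tropP big_map; have [c ->] := balanced C.
by apply/rowP => i; rewrite !mxE add0r.
Qed.

Definition in_open_cone (i j : 'I_4) (v : 'rV[int]_4) : bool :=
  [&& 0 < v 0 i, 0 < v 0 j &
      v == v 0 i *: delta_mx 0 i + v 0 j *: delta_mx 0 j].

Definition intersection C1 C2 : int :=
  degree C1 * degree C2 -
  \sum_(i < 4) \sum_(j < 4 | (i < j)%N)
    \sum_(v <- tropP C1 | in_open_cone i j v)
      \sum_(w <- tropP C2 | in_open_cone i j w)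
        Num.min (v 0 i * w 0 j) (v 0 j * w 0 i).

End Fan.

Arguments ray_cone R s : clear implicits.
Arguments L32 R : clear implicits.

Lemma row4_primitive (v : 'rV[int]_4) (i j : 'I_4) :
  v 0 i - v 0 j = 1 -> primitive v.
Proof.
move=> hij n w [c e]; move: hij; rewrite e !mxE !mulmxnE.
rewrite opprD addrACA subrr addr0 -mulrnBl -mulr_natr.
move/(congr1 absz)/eqP; rewrite abszM natz absz_nat muln_eq1.
by case/andP=> _ /eqP.
Qed.

Lemma is_ray_1100 : is_ray (row4 1 1 0 0).
Proof.
apply/and3P; split.
- by apply/forallP => -[[|[|[|[|//]]]] ?]; rewrite mxE.
- by apply/existsP; exists (@Ordinal 4 2 isT); rewrite mxE.
- apply/asboolP/(@row4_primitive _ (@Ordinal 4 0 isT) (@Ordinal 4 2 isT)).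
  by rewrite !mxE.
Qed.

Lemma is_ray_0011 : is_ray (row4 0 0 1 1).
Proof.
apply/and3P; split.
- by apply/forallP => -[[|[|[|[|//]]]] ?]; rewrite mxE.
- by apply/existsP; exists (@Ordinal 4 0 isT); rewrite mxE.
- apply/asboolP/(@row4_primitive _ (@Ordinal 4 2 isT) (@Ordinal 4 0 isT)).
  by rewrite !mxE.
Qed.

Definition ray1100 : ray := exist (fun v => is_ray v) _ is_ray_1100.
Definition ray0011 : ray := exist (fun v => is_ray v) _ is_ray_0011.

Section LineD.
Variable R : realType.

Definition lineD_mult : {fsfun ray -> nat with 0%N} :=
  [fsfun s in [fset ray1100; ray0011] => 1%N].

Lemma lineD_multE s :
  lineD_mult s = (s \in [fset ray1100; ray0011]).
Proof. by rewrite fsfunE; case: ifP. Qed.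

Lemma finsupp_lineD : finsupp lineD_mult = [fset ray1100; ray0011].
Proof. by apply/fsetP => s; rewrite mem_finsupp lineD_multE; case: (s \in _). Qed.

Lemma ray_neq : ray1100 != ray0011.
Proof.
apply/eqP => /(congr1 val) /= /rowP /(_ (@Ordinal 4 0 isT)).
by rewrite !mxE.
Qed.

Lemma lineD_L32 s : (0 < lineD_mult s)%N -> ray_cone R s `<=` L32 R.
Proof.
rewrite lineD_multE in_fset2; case: eqP => [-> _|_]; last case: eqP => [-> _|//].
- move=> w [t [t0 hw]]; exists (@Ordinal 4 0 isT), (@Ordinal 4 1 isT).
  split=> //; exists t, t; split=> //; move: hw => [c ->]; exists c.
  congr (_ + _); apply/rowP => -[[|[|[|[|//]]]] ?];
    by rewrite !mxE /= ?mulr0 ?mulr1 ?addr0 ?add0r.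
- move=> w [t [t0 hw]]; exists (@Ordinal 4 2 isT), (@Ordinal 4 3 isT).
  split=> //; exists t, t; split=> //; move: hw => [c ->]; exists c.
  congr (_ + _); apply/rowP => -[[|[|[|[|//]]]] ?];
    by rewrite !mxE /= ?mulr0 ?mulr1 ?addr0 ?add0r.
Qed.

Lemma lineD_mult1100 : lineD_mult ray1100 = 1%N.
Proof. by rewrite lineD_multE in_fset2 eqxx. Qed.

Lemma lineD_mult0011 : lineD_mult ray0011 = 1%N.
Proof. by rewrite lineD_multE in_fset2 eqxx orbT. Qed.

Lemma perm_finsupp_lineD :
  perm_eq (finsupp lineD_mult) [:: ray1100; ray0011].
Proof.
rewrite finsupp_lineD; apply: uniq_perm; first exact: fset_uniq.
  by rewrite /= mem_seq1 ray_neq.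
by move=> s; rewrite in_fset2 mem_seq2.
Qed.

Lemma lineD_sum :
  \sum_(s <- finsupp lineD_mult) val s *+ lineD_mult s = const_mx 1.
Proof.
rewrite (perm_big _ perm_finsupp_lineD) big_cons big_seq1.
rewrite lineD_mult1100 lineD_mult0011.
by apply/rowP => -[[|[|[|[|//]]]] ?]; rewrite !mxE.
Qed.

Lemma lineD_balanced :
  eq_mod1 (\sum_(s <- finsupp lineD_mult) val s *+ lineD_mult s) 0.
Proof. by exists 1; rewrite lineD_sum add0r. Qed.

Definition lineD : tropical_curve R := TropicalCurve lineD_L32 lineD_balanced.

Lemma tropP_lineD :
  perm_eq (tropP lineD) [:: row4 1 1 0 0; row4 0 0 1 1].
Proof.
apply: perm_trans (perm_map _ perm_finsupp_lineD) _.
by rewrite /= lineD_mult1100 lineD_mult0011.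
Qed.

End LineD.

Section Realizability.
Variables (K : fieldType) (R : realType).

Definition trop (Y : curve K) : set 'rV[R]_4 :=
  [set w | (in_ideal w (curve_ideal Y) : set (laurent0 K)) <> setT].

(* The vector v_sigma is taken as the point in the relative interior of the
   ray sigma. If sigma is not contained in trop(Y), then the initial ideal is
   the whole ring, there are no primes above it, and the sum is 0. *)
Definition trop_mult (Y : curve K) (s : ray) : nat :=
  let I := in_ideal (real_vec R (val s)) (curve_ideal Y) in
  \sum_(Q \in [set Q : spec (laurent0 K) | minimal_prime I Q])
    ring_length (quotient_at I Q).

Definition Trop_mult (Y : effective_cycle K) (s : ray) : nat :=
  (\sum_(Z <- finsupp Y) Y Z * trop_mult Z s)%N.

Definition Trop_support (Y : effective_cycle K) : set 'rV[R]_4 :=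
  [set w | exists Z, Z \in finsupp Y /\ trop Z w].

Definition Trop_eq (Y : effective_cycle K) (C : tropical_curve R) : Prop :=
  Trop_support Y = fan_support C /\ forall s, Trop_mult Y s = C s.

Definition realizable (C : tropical_curve R) : Prop :=
  exists Y : effective_cycle K, cycle_in_plane Y /\ Trop_eq Y C.

End Realizability.

(* Main.v *)
Require Import Defs.
From HB Require Import structures.
From mathcomp Require Import all_boot all_order all_algebra.
From mathcomp Require Import generic_quotient ring_quotient finmap.
From mathcomp Require Import boolp classical_sets functions cardinality fsbigop.
From mathcomp Require Import reals monalg ring zify.

Set Implicit Arguments.
Unset Strict Implicit.
Unset Printing Implicit Defensive.

Import Order.TTheory GRing.Theory Num.Theory.

Local Open Scope classical_set_scope.
Local Open Scope ring_scope.

(* Since [C . D] is linear in C, it suffices to bound the contribution of each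
   irreducible curve Z of the plane from below by -min(m(1,1,0,0), m(0,0,1,1)),
   m being the multiplicities of trop(Z). In the coordinates X = x_2 / x_3 and
   Y = x_0 / x_3 of the plane, Z has an equation f, and the multiplicity of a ray
   is the number of roots of an edge polynomial of f, hence the lattice length of
   an edge of the Newton polygon; for the ray e_2 the roots at which
   x_1 / x_3 = -1 - X - Y vanishes do not count, and they reappear in the
   chart where x_0 and x_1 are exchanged. The lower left edges cross all rows of
   the Newton polygon, so deg_Y f is at most the sum of m(s) s_2, with s_2 replaced
   by s_2 - min(s_2, s_3) on the cone 23. In the coordinates x_0 / x_3, x_1 / x_3
   the equation is g(X, Y) = f(-1 - X - Y, X), and the sum of
   m(s) min(s_0, s_1) over the cone 01 is at most the least degree of a term of
   g. Restricting g to the line X + Y = 0, this is at most deg_Y f unless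
   f(-1, Y) = 0. In that case Z is the line X = -1, which tropicalizes to D, and
   the difference is at most 1. *)

(** * Bivariate polynomials and charts of the torus *)

(** Multiplicities are defined by initial ideals in the 3-dimensional torus, not by f, so much of
    the work is to identify these ideals. A unimodular change of coordinates gives units T and Z of
    weights 0 and 1; on the plane the third coordinate, times a monomial, is a polynomial in T and
    Z. The initial ideal is generated by the weight-0 part of this relation and by the edge
    polynomial h(T). That it contains nothing else is seen in a function field: the generic point of
    the plane degenerates to that of its initial plane, and the lowest Z-terms of multiples of f are
    multiples of h. At a root c of h the local ring is uniserial with maximal ideal generated by T -
    c, so its length is the multiplicity of c. Roots where the third coordinate vanishes lie outside
    the torus; hence the special role of e_2.

    The Newton polygon is only used through the rows crossed by its edges, so its boundary never has
    to be ordered. The term k enters because a sum of minima is at most the minimum of the sums. *)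

(* An alias of [{poly {poly K}}] with its own packed structure: unifying the
   structures of the nested polynomial ring directly is prohibitively slow. *)
Section Bipoly.
Variable K : fieldType.
Definition bipoly := {poly {poly K}}.
HB.instance Definition _ := GRing.IntegralDomain.on bipoly.

Definition outer (p : {poly K}) : bipoly := p%:P.
Definition inX : bipoly := 'X%:P.
Definition outX : bipoly := 'X.
Lemma outer_zmod : zmod_morphism outer. Proof. exact: polyCB. Qed.
Lemma outer_monoid : monoid_morphism outer.
Proof. by split=> // a b; apply: polyCM. Qed.
HB.instance Definition _ :=
  GRing.isZmodMorphism.Build {poly K} bipoly outer outer_zmod.
HB.instance Definition _ :=
  GRing.isMonoidMorphism.Build {poly K} bipoly outer outer_monoid.

Lemma bipoly_ind (P : bipoly -> Prop) : P 0 ->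
  (forall q p, P q -> P (q * outX + outer p)) -> forall q, P q.
Proof. exact: poly_ind. Qed.
End Bipoly.

Section BivariateEvaluation.
Variables (K : fieldType) (B : comNzRingType) (kap : {rmorphism K -> B}).
Implicit Types (a b : B) (p : {poly K}) (q : bipoly K).

Definition poly_eval a : {poly K} -> B :=
  horner_morph (f := kap) (fun x => mulrC a (kap x)).
HB.instance Definition _ a := GRing.RMorphism.copy (poly_eval a)
  (horner_morph (f := kap) (fun x => mulrC a (kap x))).

Definition bieval a b : bipoly K -> B :=
  horner_morph (f := poly_eval a) (fun x => mulrC b (poly_eval a x)).
Lemma bieval_zmod a b : zmod_morphism (bieval a b).
Proof. exact: (raddfB (horner_morph (f := poly_eval a) (fun x => mulrC b (poly_eval a x)))). Qed.
Lemma bieval_monoid a b : monoid_morphism (bieval a b).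
Proof.
split.
- exact: (rmorph1 (horner_morph (f := poly_eval a) (fun x => mulrC b (poly_eval a x)))).
- exact: (rmorphM (horner_morph (f := poly_eval a) (fun x => mulrC b (poly_eval a x)))).
Qed.
HB.instance Definition _ a b :=
  GRing.isZmodMorphism.Build (bipoly K) B (bieval a b) (bieval_zmod a b).
HB.instance Definition _ a b :=
  GRing.isMonoidMorphism.Build (bipoly K) B (bieval a b) (bieval_monoid a b).

Lemma poly_evalC a c : poly_eval a c%:P = kap c.
Proof. exact: horner_morphC. Qed.

Lemma poly_evalX a : poly_eval a 'X = a.
Proof. exact: horner_morphX. Qed.

Lemma bievalC a b p : bieval a b (outer p) = poly_eval a p.
Proof. exact: horner_morphC. Qed.

Lemma bievalX a b : bieval a b (outX K) = b.
Proof. exact: horner_morphX. Qed.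

End BivariateEvaluation.

Lemma poly_rmorph_ext (K : fieldType) (B : comNzRingType) (f g : {rmorphism {poly K} -> B}) :
  (forall c, f c%:P = g c%:P) -> f 'X = g 'X -> f =1 g.
Proof.
move=> hc hX; elim/poly_ind => [|p c IH]; first by rewrite !rmorph0.
by rewrite !rmorphD !rmorphM hc hX IH.
Qed.

Lemma bipoly_rmorph_ext (K : fieldType) (B : comNzRingType)
    (f g : {rmorphism bipoly K -> B}) :
  (forall c, f (outer c%:P) = g (outer c%:P)) -> f (inX K) = g (inX K) -> f (outX K) = g (outX K) ->
  f =1 g.
Proof.
move=> hc hX hY; elim/bipoly_ind => [|q p IH]; first by rewrite !rmorph0.
rewrite !rmorphD !rmorphM IH hY; congr (_ + _).
exact: (@poly_rmorph_ext _ _ (f \o @outer K) (g \o @outer K)).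
Qed.

Lemma rmorph_bieval (K : fieldType) (B B' : comNzRingType) (kap : {rmorphism K -> B})
    (phi : {rmorphism B -> B'}) (a b : B) (q : bipoly K) :
  phi (bieval kap a b q) = bieval (phi \o kap) (phi a) (phi b) q.
Proof.
apply: (@bipoly_rmorph_ext _ _ (phi \o bieval kap a b)
  (bieval (phi \o kap) (phi a) (phi b))) => [c||] /=;
  by rewrite ?bievalC ?bievalX ?poly_evalC ?poly_evalX.
Qed.

Definition bconst (K : fieldType) (c : K) : bipoly K := outer c%:P.

Lemma bconst_zmod (K : fieldType) : zmod_morphism (@bconst K).
Proof. by move=> a b; rewrite /bconst !raddfB. Qed.

Lemma bconst_monoid (K : fieldType) : monoid_morphism (@bconst K).
Proof. by split=> // a b; rewrite /bconst !rmorphM. Qed.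

HB.instance Definition _ (K : fieldType) :=
  GRing.isZmodMorphism.Build K (bipoly K) (@bconst K) (@bconst_zmod K).
HB.instance Definition _ (K : fieldType) :=
  GRing.isMonoidMorphism.Build K (bipoly K) (@bconst K) (@bconst_monoid K).

Lemma bieval_id (K : fieldType) (q : bipoly K) :
  bieval (@bconst K) (inX K) (outX K) q = q.
Proof.
apply: (@bipoly_rmorph_ext _ _ (bieval (@bconst K) (inX K) (outX K)) idfun)
  => [c||] /=; by rewrite ?bievalC ?bievalX ?poly_evalC ?poly_evalX.
Qed.

Lemma bieval_comp (K : fieldType) (B : comNzRingType) (kap : {rmorphism K -> B}) (a b : B)
    (a' b' q : bipoly K) :
  bieval kap a b (bieval (@bconst K) a' b' q) =
  bieval kap (bieval kap a b a') (bieval kap a b b') q.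
Proof.
apply: (@bipoly_rmorph_ext _ _
    (bieval kap a b \o bieval (@bconst K) a' b')
    (bieval kap (bieval kap a b a') (bieval kap a b b'))) => [c||] /=;
  by rewrite ?bievalC ?bievalX ?poly_evalC ?poly_evalX ?bievalC ?poly_evalC.
Qed.

Lemma bievalE (K : fieldType) (B : comNzRingType) (kap : {rmorphism K -> B}) (a b : B)
    (q : bipoly K) :
  bieval kap a b q =
  \sum_(y < size q) \sum_(x < size q`_y) kap q`_y`_x * a ^+ x * b ^+ y.
Proof.
rewrite /bieval /horner_morph horner_poly; apply: eq_bigr => y _.
rewrite [poly_eval _ _ _]/horner_morph horner_poly mulr_suml.
by apply: eq_bigr => x _.
Qed.

Section LaurentConstants.
Variable K : fieldType.

Lemma exp_degree0 : exp_degree 0 = 0.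
Proof. by rewrite /exp_degree big1 // => i _; rewrite mxE. Qed.

Lemma monom_degree0 (c : K) m : exp_degree m = 0 ->
  (monom c m : laurent K) \in @degree0 K.
Proof.
move=> hm; apply/allP => n /(fsubsetP msuppU_le).
by rewrite inE => /eqP ->; rewrite hm.
Qed.

Definition const0 (c : K) : laurent0 K := Laurent0 (monom_degree0 c exp_degree0).

Lemma const0_zmod : zmod_morphism const0.
Proof. by move=> a b; apply: val_inj; rewrite raddfB /= /monom monalgUB. Qed.

Lemma const0_monoid : monoid_morphism const0.
Proof.
split; first exact: val_inj.
move=> a b; apply: val_inj; rewrite rmorphM /=.
by rewrite -{1}[0]addr0 -ga_mulUU.
Qed.

HB.instance Definition _ :=
  GRing.isZmodMorphism.Build K (laurent0 K) const0 const0_zmod.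
HB.instance Definition _ :=
  GRing.isMonoidMorphism.Build K (laurent0 K) const0 const0_monoid.

End LaurentConstants.

(* The chart (i, j, k, l) has the coordinates x_i / x_k, x_j / x_k, x_l / x_k. *)
Section Chart.
Variables (i j k l : 'I_4).

Definition is_chart := uniq [:: i; j; k; l].

Definition chart_exp (a b c : int) : 'rV[int]_4 :=
  a *: delta_mx 0 i + b *: delta_mx 0 j + c *: delta_mx 0 l -
  (a + b + c) *: delta_mx 0 k.

Lemma chart_exp_degree a b c : exp_degree (chart_exp a b c) = 0.
Proof.
have hd (x : 'I_4) : \sum_y (delta_mx 0 x : 'rV[int]_4) 0 y = 1.
  rewrite (bigD1 x) //= mxE !eqxx big1 ?addr0 // => y /negbTE hy.
  by rewrite mxE hy andbF.
rewrite /exp_degree /chart_exp; under eq_bigr do rewrite !mxE.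
rewrite big_split sumrN !big_split /= -!mulr_sumr.
have hd' (x : 'I_4) : \sum_(y < 4) ((0 == 0 :> 'I_1) && (y == x))%:R = 1 :> int.
  by rewrite -[RHS](hd x); apply: eq_bigr => y _; rewrite mxE.
by rewrite !hd' !mulr1 subrr.
Qed.

Lemma chart_expD a b c a' b' c' :
  chart_exp (a + a') (b + b') (c + c') = chart_exp a b c + chart_exp a' b' c'.
Proof. by apply/rowP => x; rewrite !mxE; ring. Qed.

Lemma chart_exp0 : chart_exp 0 0 0 = 0.
Proof. by apply/rowP => x; rewrite !mxE; ring. Qed.

Hypothesis Hc : is_chart.

Lemma chartP (x : 'I_4) : [|| x == i, x == j, x == k | x == l].
Proof.
have: x \in [:: i; j; k; l]; last by rewrite !inE.
have hcard : #|[:: i; j; k; l]| = #|'I_4|.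
  by rewrite card_ord (card_uniqP Hc).
by have /(subset_cardP hcard) -> : [:: i; j; k; l] \subset 'I_4 by apply/fintype.subsetP.
Qed.

Lemma chart_neq : [/\ i != j, i != k & i != l] /\ [/\ j != k, j != l & k != l].
Proof.
move: Hc; rewrite /is_chart /= !inE !negb_or -!andbA.
by case/and5P => -> -> -> -> /andP[-> /andP[-> _]].
Qed.

Lemma chart_neqE : ((i == j) = false) * ((i == k) = false) * ((i == l) = false) *
  ((j == i) = false) * ((j == k) = false) * ((j == l) = false) *
  ((k == i) = false) * ((k == j) = false) * ((k == l) = false) *
  ((l == i) = false) * ((l == j) = false) * ((l == k) = false).
Proof.
have [[/negbTE h1 /negbTE h2 /negbTE h3] [/negbTE h4 /negbTE h5 /negbTE h6]] := chart_neq.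
by do !split; rewrite // eq_sym.
Qed.

Lemma sum_chart (V : nmodType) (F : 'I_4 -> V) :
  \sum_x F x = F i + F j + F k + F l.
Proof.
rewrite (bigD1 i) //= (bigD1 j) /= ?chart_neqE //.
rewrite (bigD1 k) /= ?chart_neqE //= (bigD1 l) /= ?chart_neqE //=.
rewrite big1 ?addr0 ?addrA // => x /andP[/andP[/andP[hi hj] hk] hl].
by have := chartP x; rewrite (negbTE hi) (negbTE hj) (negbTE hk) (negbTE hl).
Qed.

Lemma chart_expE m : exp_degree m = 0 -> m = chart_exp (m 0 i) (m 0 j) (m 0 l).
Proof.
rewrite /exp_degree sum_chart => hm; apply/rowP => x; rewrite !mxE /=.
by case/or4P: (chartP x) => /eqP ->; rewrite !(chart_neqE, eqxx); lia.
Qed.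

Lemma chart_exp_i a b c : chart_exp a b c 0 i = a.
Proof. by rewrite !mxE /= !(chart_neqE, eqxx) !mulr0 mulr1; lia. Qed.
Lemma chart_exp_j a b c : chart_exp a b c 0 j = b.
Proof. by rewrite !mxE /= !(chart_neqE, eqxx) !mulr0 mulr1; lia. Qed.
Lemma chart_exp_l a b c : chart_exp a b c 0 l = c.
Proof. by rewrite !mxE /= !(chart_neqE, eqxx) !mulr0 mulr1; lia. Qed.

End Chart.

Section ChartMonomials.
Variables (K : fieldType) (i j k l : 'I_4).
Hypothesis Hc : is_chart i j k l.

Definition cmono a b c : laurent0 K :=
  Laurent0 (monom_degree0 1 (chart_exp_degree i j k l a b c)).

Lemma cmonoD a b c a' b' c' :
  cmono (a + a') (b + b') (c + c') = cmono a b c * cmono a' b' c'.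
Proof.
apply: val_inj; rewrite rmorphM /= chart_expD.
by rewrite [RHS]ga_mulUU mulr1.
Qed.

Lemma cmono0 : cmono 0 0 0 = 1.
Proof. by apply: val_inj; rewrite /= chart_exp0. Qed.

Lemma cmonoX a b c n : cmono a b c ^+ n = cmono (a *+ n) (b *+ n) (c *+ n).
Proof. by elim: n => [|n IH]; rewrite ?cmono0 // exprS IH !mulrS cmonoD. Qed.

Lemma val_const_cmono x a b c :
  val (const0 x * cmono a b c) = monom x (chart_exp i j k l a b c).
Proof. by rewrite rmorphM [LHS]ga_mulUU mulr1 add0r. Qed.

Lemma laurent0E (g : laurent0 K) :
  g = \sum_(m <- msupp (val g)) const0 (mcoeff m (val g)) * cmono (m 0 i) (m 0 j) (m 0 l).
Proof.
apply: val_inj; rewrite {1}[val g]group_algebraE raddf_sum.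
apply: eq_big_seq => m hm; apply: etrans (esym (val_const_cmono _ _ _ _)).
rewrite -chart_expE //.
by have /allP/(_ _ hm)/eqP := valP g.
Qed.

Section Evaluation.
Variables (E : fieldType) (kap : {rmorphism K -> E}) (al be ga : E).

(* A zero coordinate is replaced by 1, so that [ceval] is always a morphism. *)
Definition nz (x : E) := if x == 0 then 1 else x.

Lemma nz_neq0 x : nz x != 0.
Proof. by rewrite /nz; case: ifPn => // _; exact: oner_neq0. Qed.

Lemma nzE x : x != 0 -> nz x = x.
Proof. by rewrite /nz => /negbTE ->. Qed.

Definition chart_char (m : 'rV[int]_4) : E :=
  nz al ^ m 0 i * nz be ^ m 0 j * nz ga ^ m 0 l.

Lemma chart_charD m n : chart_char (m + n) = chart_char m * chart_char n.
Proof.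
have nzD x a b : nz x ^ (a + b) = nz x ^ a * nz x ^ b.
  by rewrite expfzDr // nz_neq0.
rewrite /chart_char !mxE !nzD.
move: (nz al ^ m 0 i) (nz al ^ n 0 i) (nz be ^ m 0 j) (nz be ^ n 0 j).
by move: (nz ga ^ m 0 l) (nz ga ^ n 0 l) => a b c d e f; ring.
Qed.

Lemma chart_char0 : chart_char 0 = 1.
Proof. by rewrite /chart_char !mxE !expr0z !mulr1. Qed.

Definition laurent_eval (g : laurent K) : E := mmap kap chart_char g.

Lemma laurent_eval_monom c m : laurent_eval (monom c m) = kap c * chart_char m.
Proof. exact: mmapU. Qed.

Definition ceval (g : laurent0 K) : E := laurent_eval (val g).

Lemma laurent_eval_zmod : zmod_morphism laurent_eval.
Proof. exact: (@mmapB _ _ _ kap chart_char). Qed.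

HB.instance Definition _ :=
  GRing.isZmodMorphism.Build (laurent K) E laurent_eval laurent_eval_zmod.

Lemma laurent_eval_sum I (r : seq I) (F : I -> laurent K) :
  laurent_eval (\sum_(i <- r) F i) = \sum_(i <- r) laurent_eval (F i).
Proof. exact: raddf_sum. Qed.

Lemma laurent_evalM (f g : laurent K) :
  laurent_eval (f * g) = laurent_eval f * laurent_eval g.
Proof.
rewrite {2}/laurent_eval {2}/laurent_eval !mmapE big_distrlr.
apply: etrans (laurent_eval_sum _ _) _; apply: eq_bigr => m _.
apply: etrans (laurent_eval_sum _ _) _; apply: eq_bigr => n _.
apply: etrans (laurent_eval_monom _ _) _.
by rewrite rmorphM chart_charD; exact: mulrACA.
Qed.

Lemma ceval_zmod : zmod_morphism ceval.
Proof. by move=> f g; rewrite -raddfB. Qed.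

Lemma ceval_monoid : monoid_morphism ceval.
Proof.
split; last by move=> f g; rewrite -laurent_evalM.
by rewrite [LHS]laurent_eval_monom rmorph1 mul1r chart_char0.
Qed.

HB.instance Definition _ :=
  GRing.isZmodMorphism.Build (laurent0 K) E ceval ceval_zmod.
HB.instance Definition _ :=
  GRing.isMonoidMorphism.Build (laurent0 K) E ceval ceval_monoid.

Lemma ceval_const c : ceval (const0 c) = kap c.
Proof. by rewrite /ceval /= laurent_eval_monom chart_char0 mulr1. Qed.

Lemma ceval_mono a b c : ceval (cmono a b c) = nz al ^ a * nz be ^ b * nz ga ^ c.
Proof.
rewrite /ceval /= laurent_eval_monom rmorph1 mul1r /chart_char.
by rewrite chart_exp_i ?chart_exp_j ?chart_exp_l.
Qed.

Lemma cevalE g : ceval g = \sum_(m <- msupp (val g))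
  kap (mcoeff m (val g)) * (nz al ^ m 0 i * nz be ^ m 0 j * nz ga ^ m 0 l).
Proof. by []. Qed.

End Evaluation.
End ChartMonomials.

Section Congruence.
Variables (A : comNzRingType) (J : set A).
Hypothesis HJ : is_ideal J.

Definition cong x y := J (x - y).

Lemma ideal_opp x : J x -> J (- x).
Proof. by case: HJ => _ _ hM hx; rewrite -mulN1r; apply: hM. Qed.

Lemma cong_refl x : cong x x.
Proof. by case: HJ => h0 _ _; rewrite /cong subrr. Qed.

Lemma cong_sym x y : cong x y -> cong y x.
Proof. by move/ideal_opp; rewrite opprB. Qed.

Lemma cong_trans x y z : cong x y -> cong y z -> cong x z.
Proof. by case: HJ => _ hD _ h1 /(hD _ _ h1); rewrite /cong addrA subrK. Qed.

Lemma congD x y x' y' : cong x y -> cong x' y' -> cong (x + x') (y + y').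
Proof.
case: HJ => _ hD _ h1 h2; rewrite /cong.
have -> : x + x' - (y + y') = (x - y) + (x' - y') by ring.
exact: hD.
Qed.

Lemma congM x y x' y' : cong x y -> cong x' y' -> cong (x * x') (y * y').
Proof.
case: HJ => _ hD hM h1 h2; rewrite /cong.
have -> : x * x' - y * y' = x' * (x - y) + y * (x' - y') by ring.
by apply: hD; apply: hM.
Qed.

Lemma congX x y n : cong x y -> cong (x ^+ n) (y ^+ n).
Proof.
by move=> h; elim: n => [|n IH]; [exact: cong_refl|rewrite !exprS; exact: congM].
Qed.

Lemma cong_mem x y : cong x y -> J y -> J x.
Proof. by case: HJ => _ hD _ h1 /(hD _ _ h1); rewrite subrK. Qed.

End Congruence.

Lemma is_idealI (A : comNzRingType) (I J : set A) :
  is_ideal I -> is_ideal J -> is_ideal (I `&` J).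
Proof.
move=> [I0 ID IM] [J0 JD JM]; split=> // [x y [hx hx'] [hy hy']|a x [hx hx']].
- by split; [exact: ID|exact: JD].
- by split; [exact: IM|exact: JM].
Qed.

Definition kernel (A B : comNzRingType) (f : {rmorphism A -> B}) : set A :=
  [set x | f x = 0].

Lemma kernel_ideal (A B : comNzRingType) (f : {rmorphism A -> B}) :
  is_ideal (kernel f).
Proof.
split=> [|x y /= hx hy|a x /= hx]; first exact: rmorph0.
- by rewrite /kernel /= rmorphD hx hy addr0.
- by rewrite /kernel /= rmorphM hx mulr0.
Qed.

Lemma kernel_prime (A : comNzRingType) (B : idomainType) (f : {rmorphism A -> B}) :
  is_prime (kernel f).
Proof.
split; [exact: kernel_ideal| by rewrite /kernel /= rmorph1; apply/eqP/oner_neq0|].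
move=> x y; rewrite /kernel /= rmorphM => /eqP.
by rewrite mulf_eq0 => /orP[] /eqP ->; [left|right].
Qed.

Lemma cmono_eq (K : fieldType) (i j k l : 'I_4) (a b c a' b' c' : int) :
  a = a' -> b = b' -> c = c' ->
  cmono K i j k l a b c = cmono K i j k l a' b' c'.
Proof. by move=> -> -> ->. Qed.

(** * Coordinates of the torus adapted to a weight *)

Section WeightedChart.
Variables (K : fieldType) (i j k l : 'I_4).
Hypothesis Hc : is_chart i j k l.
Variables (p r u v om : int).
Hypothesis Hb : p * u + r * v = 1.

(* With X = x_i / x_k, Y = x_j / x_k and y = x_l / x_k of weights p, r and om,
   [tzy a b c] is T^a Z^b (y Z^-om)^c, where T = X^-r Y^p has weight 0 and
   Z = X^u Y^v has weight 1; conversely X = Z^p T^-v and Y = Z^r T^u. *)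
Definition tzy (a b c : int) : laurent0 K :=
  cmono K i j k l (- r * a + u * (b - om * c)) (p * a + v * (b - om * c)) c.

Lemma tzyD a b c a' b' c' :
  tzy (a + a') (b + b') (c + c') = tzy a b c * tzy a' b' c'.
Proof.
apply: etrans (cmonoD _ _ _ _ _ _ _ _ _ _ _).
by apply: cmono_eq; ring.
Qed.

Lemma tzy0 : tzy 0 0 0 = 1.
Proof. by apply: etrans (cmono0 K i j k l); apply: cmono_eq; ring. Qed.

Lemma cmono_tzy a b c : cmono K i j k l a b c =
  tzy (- v * a + u * b) (p * a + r * b + om * c) c.
Proof.
apply: cmono_eq => //.
  by transitivity ((p * u + r * v) * a); [rewrite Hb mul1r|ring].
by transitivity ((p * u + r * v) * b); [rewrite Hb mul1r|ring].
Qed.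

Lemma tzy_eq a b c a' b' c' : a = a' -> b = b' -> c = c' ->
  tzy a b c = tzy a' b' c'.
Proof. by move=> -> -> ->. Qed.

Definition cT := tzy 1 0 0.
Definition cZ := tzy 0 1 0.
Definition cY := tzy 0 0 1.

Lemma tzyX a b c n : tzy a b c ^+ n = tzy (a *+ n) (b *+ n) (c *+ n).
Proof. by elim: n => [|n IH]; rewrite ?tzy0 // exprS IH !mulrS tzyD. Qed.

Lemma tzy_nat (a b c : nat) : tzy a b c = cT ^+ a * cZ ^+ b * cY ^+ c.
Proof.
rewrite !tzyX -!tzyD !mul0rn !(add0r, addr0); apply: tzy_eq; lia.
Qed.

Lemma tzy_nat2 (a b : nat) : tzy a b 0 = cT ^+ a * cZ ^+ b.
Proof. by rewrite (tzy_nat a b 0) expr0 mulr1. Qed.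

Lemma tzy_inv a b c : tzy a b c * tzy (- a) (- b) (- c) = 1.
Proof. by rewrite -tzyD !subrr tzy0. Qed.

Lemma ideal_tzy (J : set (laurent0 K)) a b c g : is_ideal J ->
  J (tzy a b c * g) -> J g.
Proof.
case=> _ _ hM h; have := hM (tzy (- a) (- b) (- c)) _ h.
by rewrite mulrA [tzy _ _ _ * _]mulrC tzy_inv mul1r.
Qed.

Lemma prime_tzy (J : set (laurent0 K)) a b c : is_prime J -> ~ J (tzy a b c).
Proof.
move=> [hJ h1 _] h; apply: h1; apply: (ideal_tzy (a := a) (b := b) (c := c) hJ).
by rewrite mulr1.
Qed.

Definition tz_poly : bipoly K -> laurent0 K := bieval (@const0 K) cT cZ.
HB.instance Definition _ := GRing.RMorphism.copy tz_poly (bieval (@const0 K) cT cZ).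

Lemma tz_polyC c : tz_poly (outer c%:P) = const0 c.
Proof. by rewrite /tz_poly bievalC poly_evalC. Qed.

Lemma tz_polyT : tz_poly (inX K) = cT.
Proof. by rewrite /tz_poly bievalC poly_evalX. Qed.

Lemma tz_polyZ : tz_poly (outX K) = cZ.
Proof. by rewrite /tz_poly bievalX. Qed.

Lemma tz_polyM q1 q2 : tz_poly (q1 * q2) = tz_poly q1 * tz_poly q2.
Proof. exact: rmorphM. Qed.

Lemma tz_polyD q1 q2 : tz_poly (q1 + q2) = tz_poly q1 + tz_poly q2.
Proof. exact: rmorphD. Qed.

Lemma tz_polyXn q n : tz_poly (q ^+ n) = tz_poly q ^+ n.
Proof. exact: rmorphXn. Qed.

Lemma tz_poly_mono (a b : nat) : tz_poly (inX K ^+ a * outX K ^+ b) = tzy a b 0.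
Proof. by rewrite tz_polyM !tz_polyXn tz_polyT tz_polyZ tzy_nat2. Qed.

(** Modulo [J] a factor [cY] can be traded for [lam] at the price of [cT ^+ e], and [cT], [cZ] are
    units; so up to a monomial every element is a polynomial in T and Z. [J] is arbitrary so that it
    may be an intersection of two ideals: the same q then represents g modulo both. *)
Lemma laurent0_reduce (J : set (laurent0 K)) (lam : bipoly K) (e : nat) g :
  is_ideal J -> J (cY * cT ^+ e - tz_poly lam) ->
  exists (a b c : nat) q, J (tzy a b c * g - tz_poly q).
Proof.
move=> hJ hlam.
have hlamX n : cong J (tzy (n * e)%N 0 n) (tz_poly (lam ^+ n)).
  rewrite tz_polyXn; have -> : tzy (n * e)%N 0 n = (cY * cT ^+ e) ^+ n.
    rewrite tzyX -tzyD tzyX !mul0rn; apply: tzy_eq; lia.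
  exact: congX.
pose red g := exists (a b c : nat) q, cong J (tzy a b c * g) (tz_poly q).
have redD g1 g2 : red g1 -> red g2 -> red (g1 + g2).
  move=> [a1 [b1 [c1 [q1 h1]]]] [a2 [b2 [c2 [q2 h2]]]].
  (* The common multiplier carries an extra factor T^((c1 + c2) e), so that the monomial multiplying
     either summand has enough powers of T to turn its factors [cY] into [lam]; [N] is the resulting
     polynomial. *)
  exists (a1 + a2 + (c1 + c2) * e)%N, (b1 + b2)%N, (c1 + c2)%N.
  pose N (x1 y1 z1 x2 z2 : nat) : bipoly K :=
    inX K ^+ (x1 + z2 * e) * outX K ^+ y1 * lam ^+ z1.
  have hN (x1 y1 z1 x2 z2 : nat) :
      cong J (tzy (x1 + (z1 + z2) * e)%N y1 z1) (tz_poly (N x1 y1 z1 x2 z2)).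
    have -> : tzy (x1 + (z1 + z2) * e)%N y1 z1 =
        tzy (x1 + z2 * e)%N y1 0 * tzy (z1 * e)%N 0 z1.
      by rewrite -tzyD; apply: tzy_eq; lia.
    rewrite /N tz_polyM tz_poly_mono; apply: congM => //; exact: cong_refl.
  exists (N a2 b2 c2 a1 c1 * q1 + N a1 b1 c1 a2 c2 * q2).
  rewrite mulrDr tz_polyD; apply: congD => //; rewrite tz_polyM.
    have -> : tzy (a1 + a2 + (c1 + c2) * e)%N (b1 + b2)%N (c1 + c2)%N =
      tzy (a2 + (c2 + c1) * e)%N b2 c2 * tzy a1 b1 c1 by rewrite -tzyD; apply: tzy_eq; lia.
    by rewrite -mulrA; apply: (congM hJ (hN _ _ _ _ _) h1).
  have -> : tzy (a1 + a2 + (c1 + c2) * e)%N (b1 + b2)%N (c1 + c2)%N =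
      tzy (a1 + (c1 + c2) * e)%N b1 c1 * tzy a2 b2 c2 by rewrite -tzyD; apply: tzy_eq; lia.
  by rewrite -mulrA; apply: (congM hJ (hN _ _ _ _ _) h2).
suff: red g by [].
have red0 : red 0.
  by exists 0%N, 0%N, 0%N, 0; rewrite mulr0 rmorph0; exact: cong_refl.
rewrite (laurent0E Hc g); apply: (big_ind red) => // m _.
set x := mcoeff m _; rewrite cmono_tzy; set a := - v * _ + _; set b := p * _ + _ + _.
set c := m 0 l.
(* Multiplying by powers with exponents |a|, |b|, |c| makes all exponents nonnegative; the further
   power T^([pos c] e) pays for replacing [cY ^+ pos c] by [lam ^+ pos c]. *)
pose pos (y : int) := absz (y + (absz y)%:Z).
have posE y : (pos y)%:Z = y + (absz y)%:Z by rewrite /pos; lia.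
exists (absz a + pos c * e)%N, (absz b), (absz c).
exists (outer x%:P * (inX K ^+ pos a * outX K ^+ pos b * lam ^+ pos c)).
rewrite mulrCA tz_polyM tz_polyC; apply: congM => //; first exact: cong_refl.
have -> : tzy (absz a + pos c * e)%N (absz b) (absz c) * tzy a b c =
    tzy (pos a) (pos b) 0 * tzy (pos c * e)%N 0 (pos c).
  by rewrite -!tzyD; apply: tzy_eq; rewrite ?PoszD ?posE; lia.
rewrite tz_polyM tz_poly_mono; apply: congM => //; exact: cong_refl.
Qed.

End WeightedChart.

Section ChartPolynomials.
Variables (K : fieldType) (i j k l : 'I_4).
Hypothesis Hc : is_chart i j k l.

Definition xy_poly : bipoly K -> laurent0 K :=
  bieval (@const0 K) (cmono K i j k l 1 0 0) (cmono K i j k l 0 1 0).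
HB.instance Definition _ := GRing.RMorphism.copy xy_poly
  (bieval (@const0 K) (cmono K i j k l 1 0 0) (cmono K i j k l 0 1 0)).

(* The plane is 1 + x_i / x_k + x_j / x_k + x_l / x_k = 0. *)
Definition plane_form : laurent0 K :=
  1 + cmono K i j k l 1 0 0 + cmono K i j k l 0 1 0 + cmono K i j k l 0 0 1.

Lemma is_chart_swap : is_chart j i k l.
Proof. by rewrite /is_chart /= !inE !(chart_neqE Hc). Qed.

Lemma cmono_swap a b c : cmono K j i k l a b c = cmono K i j k l b a c.
Proof.
apply: val_inj; congr (monom 1 _); apply/rowP => x; rewrite !mxE.
by rewrite [a * _ + _]addrC [a + b]addrC.
Qed.

Lemma xy_reduce (J : set (laurent0 K)) g : is_ideal J -> J plane_form ->
  exists (a b c : nat) q, J (cmono K i j k l a b c * g - xy_poly q).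
Proof.
move=> hJ hplane.
(* For the weight (1, 0, 0), T is the second chart coordinate and Z the first. The chart is swapped
   so that T becomes the inner and Z the outer variable of [xy_poly]. *)
have Hb : (1 : int) * 1 + 0 * 0 = 1 by [].
have eT : cT K j i k l 1 0 1 0 0 = cmono K i j k l 1 0 0.
  by rewrite -cmono_swap; apply: cmono_eq; ring.
have eZ : cZ K j i k l 1 0 1 0 0 = cmono K i j k l 0 1 0.
  by rewrite -cmono_swap; apply: cmono_eq; ring.
have eY : cY K j i k l 1 0 1 0 0 = cmono K i j k l 0 0 1.
  by rewrite -cmono_swap; apply: cmono_eq; ring.
have exy q : tz_poly j i k l 1 0 1 0 0 q = xy_poly q.
  by rewrite /tz_poly /xy_poly eT eZ.
have [|a [b [c [q h]]]] := @laurent0_reduce K j i k l is_chart_swap 1 0 1 0 0 Hb J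
    (- (1 + inX K + outX K)) 0 g hJ.
  rewrite exy expr0 mulr1 eY [xy_poly _]rmorphN !rmorphD rmorph1 /= opprK.
  by rewrite /xy_poly bievalC poly_evalX bievalX addrC.
exists a, b, c, q; rewrite -exy.
have -> : cmono K i j k l a b c = tzy K j i k l 1 0 1 0 0 a b c; last exact: h.
by rewrite -cmono_swap; apply: cmono_eq; ring.
Qed.

End ChartPolynomials.

(** * Lengths of local rings *)

Lemma ideal_chain_le (A : comPzRingType) (m n : nat) :
  (m <= n)%N -> ideal_chain A n -> ideal_chain A m.
Proof.
move=> hmn [c [hc hlt]]; exists (fun x => c (widen_ord (hmn : m < n.+1)%N x)).
by split=> // x y hxy; apply: hlt.
Qed.

Lemma ring_lengthE (A : comPzRingType) (n : nat) :
  ideal_chain A n -> ~ ideal_chain A n.+1 -> ring_length A = n.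
Proof.
move=> h1 h2; apply: xget_unique => // m [h3 h4].
by case: (ltngtP m n) => // hmn; [case: h4|case: h2];
  exact: ideal_chain_le h1 || exact: ideal_chain_le h3.
Qed.

(* A local ring whose maximal ideal is generated by an element [x] with
   [x ^+ m = 0] and [x ^+ m.-1 != 0]: its ideals are exactly the m + 1 powers
   of the maximal ideal. *)
Lemma ring_length_uniserial (B : comPzRingType) (x : B) (m : nat) :
  (forall b : B, (exists b', b * b' = 1) \/ exists b', b = x * b') ->
  x ^+ m.+1 = 0 -> x ^+ m <> 0 -> ring_length B = m.+1.
Proof.
move=> hx xm0 xm1.
have pw n (b : B) : (exists b', b = x ^+ n * b') \/
    exists n' b' b'', [/\ (n' < n)%N, b = x ^+ n' * b' & b' * b'' = 1].
  elim: n => [|n [[b' ->]|[n' [b' [b'' [h1 h2 h3]]]]]].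
  - by left; exists b; rewrite mul1r.
  - case: (hx b') => [[b'' h]|[b'' ->]].
      by right; exists n, b', b''.
    by left; exists b''; rewrite exprSr mulrA.
  - by right; exists n', b', b''; split=> //; apply: ltnW.
have pw' (J : set B) (b : B) n : is_ideal J -> J b -> (forall n', (n' < n)%N -> ~ J (x ^+ n')) ->
    exists b', b = x ^+ n * b'.
  move=> [_ _ hM] hb hn; case: (pw n b) => // -[n' [b' [b'' [h1 h2 h3]]]].
  case: (hn n') => //; have := hM b'' _ hb.
  by rewrite h2 mulrC -mulrA h3 mulr1.
apply: ring_lengthE.
  (* The chain runs from (x^(m+1)) = 0 up to (x^0) = (1). *)
  exists (fun n : 'I_m.+2 => [set b | exists b', b = x ^+ (m.+1 - n) * b']); split.
    move=> n; split=> [|b1 b2 [b1' ->] [b2' ->]|a b1 [b' ->]] /=.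
    - by exists 0; rewrite mulr0.
    - by exists (b1' + b2'); rewrite mulrDr.
    - by exists (a * b'); rewrite mulrCA.
  move=> n n' hn; split=> [b /= [b' ->]|/(_ (x ^+ (m.+1 - n'))) /=].
    exists (x ^+ (n' - n) * b'); rewrite mulrA -exprD; congr (_ ^+ _ * _).
    by have := ltn_ord n'; lia.
  case; first by exists 1; rewrite mulr1.
  move=> b' hb; apply: xm1; have -> : m = (n'.-1 + (m.+1 - n'))%N.
    by have := ltn_ord n'; lia.
  rewrite exprD hb mulrA -exprD.
  have -> : (n'.-1 + (m.+1 - n))%N = (m.+1 + (n'.-1 - n))%N.
    by have := ltn_ord n'; lia.
  by rewrite exprD xm0 !mul0r.
move=> [c [hc hlt]].
(* To each ideal of a chain belongs the least d such that it contains x^d, and by [pw'] x^d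
   generates it. These exponents decrease strictly and lie between 0 and m + 1, so m + 3 ideals are
   too many. *)
have hex (n : 'I_m.+3) : exists d, (d <= m.+1)%N && `[< c n (x ^+ d) >].
  by exists m.+1; rewrite leqnn /= xm0; apply/asboolP; have [] := hc n.
pose d n := ex_minn (hex n).
have dP n : [/\ (d n <= m.+1)%N, c n (x ^+ d n) &
    forall e, (e < d n)%N -> ~ c n (x ^+ e)].
  rewrite /d; case: ex_minnP => e /andP[h1 /asboolP h2] h3; split=> // e' he' he.
  have := h3 e'; rewrite (leq_trans (ltnW he') h1) => /(_ (asboolT he)).
  by rewrite leqNgt he'.
have dlt (n n' : 'I_m.+3) : (n < n')%N -> (d n' < d n)%N.
  move=> /hlt [hsub hn]; rewrite ltnNge; apply/negP => hle; apply: hn => b hb.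
  have [_ h1 _] := dP n; have [_ _ h2] := dP n'.
  have [b' ->] := pw' _ b _ (hc n') hb h2.
  have [_ _ hM] := hc n; have := hM (x ^+ (d n' - d n) * b') _ h1.
  by rewrite mulrAC -exprD subnK.
have dbound (e : nat) (he : (e < m.+3)%N) : (e + d (Ordinal he) <= m.+1)%N.
  elim: e he => [|e IH] he; first by have [] := dP (Ordinal he).
  have := IH (ltnW he); have := @dlt (Ordinal (ltnW he)) (Ordinal he) (ltnSn _).
  by lia.
by have := dbound m.+2 (ltnSn _); lia.
Qed.

Section LocalLength.
Variables (A : comPzRingType) (I : ideal A) (Q : spec A).

Let B := quotient_at I Q.

Lemma proj_mul x y : proj I (x * y) = proj I x * proj I y.
Proof. exact: projM. Qed.

Lemma proj_eq0 x : proj I x = 0 <-> ideal_set I x.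
Proof.
have -> : (0 : quotient I) = proj I 0 by apply: (addrI (proj I 0)); rewrite -projD !addr0.
by rewrite projP subr0.
Qed.

Lemma compl_image_proj s : ~ spec_set Q s -> @compl_image A I Q (proj I s).
Proof. by move=> h; exists s. Qed.

Definition den_proj s (hs : ~ spec_set Q s) : denominator _ :=
  mkden (M := Submonoid (@compl_image1 A I Q) (@compl_imageM A I Q))
    (compl_image_proj hs).

Definition to_local (a : A) : B := Defs.frac (proj I a) (den1 _).

Lemma to_localE (a : A) : to_local a = 0 <-> exists s, ~ spec_set Q s /\ ideal_set I (s * a).
Proof.
split.
  move=> /Defs.fracP[_ [[s hs <-]]] /=; rewrite mul0r subr0 mulr1 -proj_mul.
  by move/proj_eq0 => h; exists s.
move=> [s [hs h]]; apply/Defs.fracP; exists (proj I s); split.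
  exact: compl_image_proj.
by rewrite /= mul0r subr0 mulr1 -proj_mul; apply/proj_eq0.
Qed.

Lemma to_localM a b : to_local (a * b) = to_local a * to_local b.
Proof.
rewrite /to_local proj_mul; apply: esym; apply: etrans (loc_mulE _ _ _ _) _.
by apply: frac_eqE => /=; rewrite !mulr1.
Qed.

Lemma to_localX a n : to_local (a ^+ n) = to_local a ^+ n.
Proof. by elim: n => // n IH; rewrite !exprS to_localM IH. Qed.

Lemma local_ind (P : B -> Prop) :
  (forall a s (hs : ~ spec_set Q s), P (Defs.frac (proj I a)
     (den_proj hs))) ->
  forall b, P b.
Proof.
move=> h; elim/loc_ind => q s; have [t ht et] := denP s.
suff -> : Defs.frac q s = Defs.frac (proj I (repr q)) (den_proj ht).
  exact: h.
by apply: frac_eqE; rewrite /= projK et.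
Qed.

(** Denominator-free form of [ring_length_uniserial]: elements outside Q become units, so the
    hypotheses are tested in A up to a factor s outside Q. It is meant for x = T - c at a root c of
    the edge polynomial. *)
Lemma local_lengthE (x : A) (m : nat) :
  (forall a, spec_set Q a -> exists s y, ~ spec_set Q s /\ ideal_set I (s * a - x * y)) ->
  (exists s, ~ spec_set Q s /\ ideal_set I (s * x ^+ m.+1)) ->
  (forall s, ~ spec_set Q s -> ~ ideal_set I (s * x ^+ m)) ->
  ring_length B = m.+1.
Proof.
have [_ hQ1 hQM] := specP Q.
have hM s t : ~ spec_set Q s -> ~ spec_set Q t -> ~ spec_set Q (s * t) by move=> hs ht /hQM[].
move=> ha hb hc; apply: (@ring_length_uniserial B (to_local x)).
- elim/local_ind => a s hs; have [haQ|haQ] := pselect (spec_set Q a); last first.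
    left; exists (Defs.frac (proj I s) (den_proj haQ)).
    apply: etrans (loc_mulE _ _ _ _) _; apply: frac_eqE => /=.
    by rewrite !(mulr1, mul1r) mulrC.
  right; have [t [y [ht hty]]] := ha a haQ.
  exists (Defs.frac (proj I y) (den_proj (hM _ _ hs ht))).
  apply: esym; apply: etrans (loc_mulE _ _ _ _) _; apply: frac_eqE.
  change (proj I x * proj I y * proj I s = proj I a * (1 * proj I (s * t))).
  rewrite mul1r -!proj_mul; apply/projP.
  have -> : x * y * s - a * (s * t) = - s * (t * a - x * y) by ring.
  by have [_ _ hIM] := idealP I; apply: hIM.
- by rewrite -to_localX; apply/to_localE.
- by rewrite -to_localX => /to_localE[s [hs /hc]]; apply.
Qed.

End LocalLength.

Lemma spec_eq (A : comPzRingType) (P Q : spec A) : spec_set P = spec_set Q -> P = Q.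
Proof. by case: P Q => [P hP] [Q hQ] /= e; subst Q; congr Spec; apply: Prop_irrelevance. Qed.

Lemma sum_minimal_primes (A : comPzRingType) (I : ideal A) (T : choiceType)
    (s : seq T) (Q : T -> spec A) (F : spec A -> nat) :
  uniq s -> {in s &, injective Q} ->
  (forall Q', minimal_prime I Q' <-> exists2 c, c \in s & Q' = Q c) ->
  \sum_(Q' \in [set Q' : spec A | minimal_prime I Q']) F Q' = \sum_(c <- s) F (Q c).
Proof.
move=> us injQ hQ.
transitivity (\sum_(Q' <- map Q s) F Q'); last by rewrite big_map.
have -> : [set Q' : spec A | minimal_prime I Q'] = [set` map Q s].
  apply/seteqP; split=> Q' /=.
    by move/hQ => [c hc ->]; apply: map_f.
  by move/mapP => [c hc ->]; apply/hQ; exists c.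
by apply/esym/fsbig_seq; rewrite map_inj_in_uniq.
Qed.

(** * Initial ideals of plane curves *)

Section WeightedEvaluation.
Variables (K : fieldType) (i j k l : 'I_4).
Hypothesis Hc : is_chart i j k l.
Variables (p r u v om : int).
Hypothesis Hb : p * u + r * v = 1.
Variables (E : fieldType) (kap : {rmorphism K -> E}) (ta ze la : E).
Hypotheses (ta0 : ta != 0) (ze0 : ze != 0) (la0 : la != 0).

(** The point of the torus at which T, Z and y Z^-om take the values [ta], [ze] and [la]. It serves
    for the generic points of the plane, of its degeneration, and of the components of the
    degenerate curve, where T is constant. *)
Definition wev : laurent0 K -> E :=
  ceval i j l kap (ze ^ p * ta ^ (- v)) (ze ^ r * ta ^ u) (la * ze ^ om).
HB.instance Definition _ := GRing.RMorphism.copy wev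
  (ceval i j l kap (ze ^ p * ta ^ (- v)) (ze ^ r * ta ^ u) (la * ze ^ om)).

Lemma wev_const c : wev (const0 c) = kap c.
Proof. exact: ceval_const. Qed.

Lemma wev_char (a b c : int) :
  (ze ^ p * ta ^ (- v)) ^ a * (ze ^ r * ta ^ u) ^ b * (la * ze ^ om) ^ c =
  ta ^ (- v * a + u * b) * ze ^ (p * a + r * b + om * c) * la ^ c.
Proof.
have D (x : E) : x != 0 -> forall a b, x ^ (a + b) = x ^ a * x ^ b.
  by move=> hx m n; rewrite expfzDr.
rewrite !exprzMl ?unitfE ?expfz_neq0 // !(D _ ta0) !(D _ ze0) -!exprz_exp.
move: ((ze ^ p) ^ a) ((ta ^ (- v)) ^ a) ((ze ^ r) ^ b) ((ta ^ u) ^ b) (la ^ c).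
by move: ((ze ^ om) ^ c) => x1 x2 x3 x4 x5 x6; ring.
Qed.

Lemma wev_neq0 : [/\ ze ^ p * ta ^ (- v) != 0, ze ^ r * ta ^ u != 0 & la * ze ^ om != 0].
Proof. by rewrite !mulf_neq0 ?expfz_neq0. Qed.

Lemma wev_cmono a b c : wev (cmono K i j k l a b c) =
  ta ^ (- v * a + u * b) * ze ^ (p * a + r * b + om * c) * la ^ c.
Proof.
have [h1 h2 h3] := wev_neq0.
by rewrite -wev_char [LHS](ceval_mono Hc) !nzE.
Qed.

Lemma wev_tzy a b c : wev (tzy K i j k l p r u v om a b c) = ta ^ a * ze ^ b * la ^ c.
Proof.
rewrite wev_cmono; congr (ta ^ _ * ze ^ _ * _).
  by transitivity ((p * u + r * v) * a); [ring|rewrite Hb mul1r].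
transitivity ((p * u + r * v) * (b - om * c) + om * c); first by ring.
by rewrite Hb mul1r subrK.
Qed.

Lemma wev_tz_poly q : wev (tz_poly i j k l p r u v om q) = bieval kap ta ze q.
Proof.
apply: (@bipoly_rmorph_ext _ _ (wev \o tz_poly i j k l p r u v om) (bieval kap ta ze)) => [c||] /=.
- by rewrite tz_polyC wev_const bievalC poly_evalC.
- by rewrite tz_polyT wev_tzy expr1z !expr0z !mulr1 bievalC poly_evalX.
- by rewrite tz_polyZ wev_tzy expr1z !expr0z mulr1 mul1r bievalX.
Qed.

Definition wt (m : 'rV[int]_4) := p * m 0 i + r * m 0 j + om * m 0 l.
Definition wtau (m : 'rV[int]_4) := - v * m 0 i + u * m 0 j.

Lemma wevE g : wev g = \sum_(m <- msupp (val g))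
  kap (mcoeff m (val g)) * (ta ^ wtau m * ze ^ wt m * la ^ m 0 l).
Proof.
have [h1 h2 h3] := wev_neq0.
rewrite [LHS]cevalE; apply: eq_bigr => m _; congr (_ * _).
by rewrite !nzE // wev_char.
Qed.

End WeightedEvaluation.

Lemma mcoeff_monom (K : fieldType) (c : K) (n m : 'rV[int]_4) :
  mcoeff m (monom c n) = c *+ (n == m).
Proof. exact: mcoeffU. Qed.

(** * Initial forms in an adapted chart *)

Section InitialForms.
Variables (K : fieldType) (R : realType) (i j k l : 'I_4).
Hypothesis Hc : is_chart i j k l.
Variables (p r u v om : int).
Hypothesis Hb : p * u + r * v = 1.
Variable s : 'rV[int]_4.
Hypotheses (Hp : s 0 i - s 0 k = p) (Hr : s 0 j - s 0 k = r) (Hom : s 0 l - s 0 k = om).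

Local Notation w := (real_vec R s).
Local Notation wt := (wt i j l p r om).
Local Notation tzy := (tzy K i j k l p r u v om).
Local Notation tz_poly := (@tz_poly K i j k l p r u v om).

Lemma weight_wt m : exp_degree m = 0 -> weight w m = (wt m)%:~R.
Proof.
rewrite /exp_degree /weight !(sum_chart Hc) /wt -Hp -Hr -Hom => hm.
rewrite !mxE -!intrM -!intrD; congr (_%:~R).
have -> : m 0 k = - (m 0 i + m 0 j + m 0 l) by rewrite -[RHS]addr0 -hm; ring.
ring.
Qed.

Lemma mcoeff_in_form (f : laurent K) m :
  mcoeff m (in_form w f) =
  if all (fun n => weight w m <= weight w n) (msupp f) then mcoeff m f else 0.
Proof.
have -> : mcoeff m (in_form w f) =
    \sum_(n <- msupp f | all (fun n' => weight w n <= weight w n') (msupp f))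
       mcoeff n f *+ (n == m).
  by rewrite /in_form raddf_sum; apply: eq_bigr => n _; exact: mcoeff_monom.
have [hm|hm] := boolP (m \in msupp f); last first.
  rewrite (mcoeff_outdom hm) if_same big1_seq // => n /andP[_ hn].
  by case: eqP => // e; rewrite -e hn in hm.
rewrite -big_filter; case: ifP => h.
  rewrite (bigD1_seq m) ?filter_uniq ?fset_uniq ?mem_filter ?h //=.
  by rewrite eqxx mulr1n big1 ?addr0 // => n /negbTE ->.
rewrite big1_seq // => n /andP[_]; rewrite mem_filter => /andP[hn _].
by case: eqP => // e; rewrite e h in hn.
Qed.

Definition wsub (D : int -> Prop) (g : laurent0 K) : Prop :=
  forall m, m \in msupp (val g) -> D (wt m).

Lemma wsubD D g1 g2 : wsub D g1 -> wsub D g2 -> wsub D (g1 + g2).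
Proof.
move=> h1 h2 m /(fsubsetP (msuppD_le _ _)).
by rewrite inE => /orP[/h1|/h2].
Qed.

Lemma wsub0 D : wsub D 0.
Proof. by move=> m; rewrite msupp0 inE. Qed.

Lemma wsub_tzy (D : int -> Prop) c a b d : D b -> wsub D (const0 c * tzy a b d).
Proof.
move=> hD m; rewrite [val _](val_const_cmono i j k l c) => /(fsubsetP msuppU_le).
rewrite inE => /eqP ->; rewrite /wt chart_exp_i // chart_exp_j // chart_exp_l //.
set x := (X in D X); suff -> : x = b by [].
transitivity ((p * u + r * v) * (b - om * d) + om * d); first by rewrite /x; ring.
by rewrite Hb mul1r subrK.
Qed.

Lemma wsub_tz_poly (D : int -> Prop) (q : bipoly K) :
  (forall y : nat, q`_y != 0 -> D y) -> wsub D (tz_poly q).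
Proof.
move=> hD; rewrite [tz_poly q]bievalE.
apply: (big_ind (wsub D)); [exact: wsub0|exact: wsubD|] => y _.
apply: (big_ind (wsub D)); [exact: wsub0|exact: wsubD|] => x _.
have hq : q`_y != 0 by rewrite -size_poly_gt0 (leq_ltn_trans (leq0n x)) ?ltn_ord.
rewrite -mulrA; have -> : cT K i j k l p r u v om ^+ x * cZ K i j k l p r u v om ^+ y = tzy x y 0.
  by rewrite tzy_nat2.
by apply: wsub_tzy; apply: hD.
Qed.

Lemma in_form_homog g g0 g1 W : g = g0 + g1 -> g0 != 0 ->
  wsub (fun b => b = W) g0 -> wsub (fun b => W < b) g1 -> in_form0 w g = g0.
Proof.
move=> -> g00 h0 h1; apply: val_inj; apply/malgP => m; rewrite [LHS]mcoeff_in_form.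
have hdeg (g' : laurent0 K) n : n \in msupp (val g') -> weight w n = (wt n)%:~R.
  by move=> hn; apply: weight_wt; have /allP/(_ _ hn)/eqP := valP g'.
have [m0 hm0] : exists m0, m0 \in msupp (val g0).
  apply: contrapT => hn; move/eqP: g00; apply; apply: val_inj; apply/malgP => n.
  by rewrite [LHS]mcoeff_outdom ?mcoeff0 //; apply/negP => hn'; apply: hn; exists n.
have cD n : mcoeff n (val (g0 + g1)) = mcoeff n (val g0) + mcoeff n (val g1).
  exact: (mcoeffD n (val g0) (val g1)).
have hm0' : m0 \in msupp (val (g0 + g1)).
  rewrite -mcoeff_neq0 cD [X in _ + X]mcoeff_outdom ?addr0 ?mcoeff_neq0 //.
  by apply/negP => /h1; rewrite (h0 _ hm0) ltxx.
have hmin n : n \in msupp (val (g0 + g1)) -> W <= wt n.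
  move=> /(fsubsetP (msuppD_le _ _)); rewrite inE => /orP[/h0 -> //|/h1].
  exact: ltW.
case: ifP => [/allP h|/negP h].
  rewrite cD [X in _ + X]mcoeff_outdom ?addr0 //; apply/negP => hm1.
  have := h _ hm0'; rewrite (hdeg _ _ hm0) (hdeg _ _ hm1) ler_int (h0 _ hm0).
  by have /= := h1 _ hm1; rewrite ltNge => /negbTE ->.
apply/esym/mcoeff_outdom/negP => hm; apply: h; apply/allP => n hn.
by rewrite (hdeg _ _ hm) (hdeg _ _ hn) ler_int (h0 _ hm) hmin.
Qed.

End InitialForms.

Section BipolyTools.
Variable K : fieldType.
Implicit Types (p : {poly K}) (q : bipoly K).

(** The value at Z = 0, the outer variable being Z. As T has weight 0 and Z weight 1, this is the
    part of weight 0. *)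
Definition low q : {poly K} := (q : {poly {poly K}}).[0].

Lemma low_zmod : zmod_morphism low.
Proof. by move=> a b; rewrite /low hornerD hornerN. Qed.

Lemma low_monoid : monoid_morphism low.
Proof. by split=> [|a b]; rewrite /low; [exact: hornerC|exact: hornerM]. Qed.

HB.instance Definition _ :=
  GRing.isZmodMorphism.Build (bipoly K) {poly K} low low_zmod.
HB.instance Definition _ :=
  GRing.isMonoidMorphism.Build (bipoly K) {poly K} low low_monoid.

Lemma lowE q : low q = q`_0.
Proof. exact: horner_coef0. Qed.

Lemma low_outer p : low (outer p) = p.
Proof. exact: hornerC. Qed.

Lemma low_outX : low (outX K) = 0.
Proof. exact: hornerX. Qed.

Lemma low_inX : low (inX K) = 'X.
Proof. exact: hornerC. Qed.

Lemma outX_neq0 : outX K != 0.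
Proof. by apply/negbT; exact: polyX_eq0. Qed.

Lemma inX_neq0 : inX K != 0.
Proof. by apply/eqP => /(congr1 low); rewrite low_inX rmorph0 => /eqP; rewrite polyX_eq0. Qed.

Lemma outer_inj : injective (@outer K).
Proof. by move=> a b /(congr1 low); rewrite !low_outer. Qed.

Lemma outer_eq0 p : (outer p == 0) = (p == 0).
Proof. by rewrite -(inj_eq outer_inj) rmorph0. Qed.

Lemma bipoly_low q : exists q', q = outer (low q) + outX K * q'.
Proof.
elim/bipoly_ind: q => [|q p _]; first by exists 0; rewrite !rmorph0 mulr0 addr0.
by exists q; rewrite [low _]rmorphD rmorphM /= low_outX mulr0 add0r low_outer addrC mulrC.
Qed.

Lemma bipoly_low_factor q : q != 0 ->
  exists n q', q = outX K ^+ n * q' /\ low q' != 0.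
Proof.
move: {2}(size (q : {poly {poly K}})) (leqnn (size (q : {poly {poly K}}))) => n.
elim: n q => [|n IH] q.
  by rewrite leqn0 size_poly_eq0 => /eqP -> /eqP.
move=> hs q0; have [h|h] := eqVneq (low q) 0; last by exists 0%N, q; rewrite mul1r.
have [q' hq'] := bipoly_low q; move: hq'; rewrite h rmorph0 add0r => hq'.
have q'0 : q' != 0 by apply: contraNneq q0 => e; rewrite hq' e mulr0.
have [||m [q'' [e h'']]] := IH q' => //.
  by move: hs; rewrite hq' [size _](size_mul outX_neq0 q'0) size_polyX.
by exists m.+1, q''; rewrite hq' e exprS mulrA.
Qed.

Lemma low_unique a b q1 q2 : outX K ^+ a * q1 = outX K ^+ b * q2 ->
  low q1 != 0 -> low q2 != 0 -> low q1 = low q2.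
Proof.
have X0 n : outX K ^+ n != 0 by rewrite expf_neq0 ?outX_neq0.
wlog hab : a b q1 q2 / (a <= b)%N.
  move=> hw e h1 h2; case: (leqP a b) => [|/ltnW] hab; first exact: hw hab e h1 h2.
  by apply/esym; apply: hw hab (esym e) h2 h1.
rewrite -(subnKC hab) exprD -mulrA => /(mulfI (X0 _)) -> h1 h2.
move: h1; case: (b - a)%N => [|n]; first by rewrite mul1r.
by rewrite exprS -mulrA rmorphM /= low_outX mul0r eqxx.
Qed.

Definition specialize (c : K) : bipoly K -> {poly K} :=
  bieval (@polyC K) c%:P 'X.
HB.instance Definition _ c := GRing.RMorphism.copy (specialize c)
  (bieval (@polyC K) c%:P 'X).

Lemma specialize_outX c : specialize c (outX K) = 'X.
Proof. exact: bievalX. Qed.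

Lemma specialize_outer c p : specialize c (outer p) = p.[c]%:P.
Proof.
rewrite [LHS]bievalC.
apply: (@poly_rmorph_ext _ _ (poly_eval (@polyC K) c%:P) (polyC \o horner_eval c)) => [a|] /=.
  by rewrite poly_evalC /horner_eval hornerC.
by rewrite poly_evalX /horner_eval hornerX.
Qed.

Lemma specialize_inX c : specialize c (inX K) = c%:P.
Proof. by rewrite -[inX K]/(outer 'X) specialize_outer hornerX. Qed.

Lemma specialize_eq0 c q : specialize c q = 0 ->
  exists q', q = outer ('X - c%:P) * q'.
Proof.
elim/bipoly_ind: q => [|q p IH]; first by exists 0; rewrite mulr0.
rewrite rmorphD rmorphM /= specialize_outX specialize_outer => h.
have p0 : p.[c] = 0.
  by have := congr1 (horner^~ 0) h; rewrite hornerD hornerM hornerX hornerC horner0 mulr0 add0r.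
have /IH[q' ->] : specialize c q = 0.
  by apply/eqP; move/eqP: h; rewrite p0 polyC0 addr0 mulf_eq0 polyX_eq0 orbF.
have /factor_theorem[p' ->] : root p c by apply/rootP.
by exists (q' * outX K + outer p'); rewrite rmorphM /= mulrDr mulrA [outer p' * _]mulrC.
Qed.

End BipolyTools.

(* The field of fractions of [bipoly K] is kept abstract: computing in the
   concrete quotient type is prohibitively slow. *)
Section Cleared.
Variables (K : fieldType) (E : fieldType) (tofr : {rmorphism bipoly K -> E}).
Hypothesis tofr_inj : injective tofr.
Implicit Types (lam q : bipoly K).

Lemma tofr_eq0 q : (tofr q == 0) = (q == 0).
Proof. by rewrite -(rmorph0 tofr) (inj_eq tofr_inj). Qed.

Lemma tofrM q1 q2 : tofr (q1 * q2) = tofr q1 * tofr q2.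
Proof. exact: rmorphM. Qed.

Lemma tofrD q1 q2 : tofr (q1 + q2) = tofr q1 + tofr q2.
Proof. exact: rmorphD. Qed.

Lemma tofrXn q n : tofr (q ^+ n) = tofr q ^+ n.
Proof. exact: rmorphXn. Qed.

Lemma tofr1 : tofr 1 = 1.
Proof. exact: rmorph1. Qed.

Definition fconst (c : K) : E := tofr (bconst c).
HB.instance Definition _ := GRing.RMorphism.copy fconst (tofr \o @bconst K).
Definition frac_t := tofr (inX K).
Definition frac_z := tofr (outX K).
Local Notation tE := frac_t.
Local Notation zE := frac_z.

Lemma tE_neq0 : tE != 0. Proof. by rewrite tofr_eq0 inX_neq0. Qed.
Lemma zE_neq0 : zE != 0. Proof. by rewrite tofr_eq0 outX_neq0. Qed.

Lemma bieval_tofr q : bieval fconst tE zE q = tofr q.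
Proof. by rewrite -[RHS](congr1 tofr (bieval_id q)) [RHS]rmorph_bieval. Qed.

Definition tzl lam (a b c : nat) := inX K ^+ a * outX K ^+ b * lam ^+ c.

Lemma tzlD lam a b c a' b' c' :
  tzl lam (a + a') (b + b') (c + c') = tzl lam a b c * tzl lam a' b' c'.
Proof.
rewrite /tzl !exprD.
move: (inX K ^+ a) (inX K ^+ a') (outX K ^+ b) (outX K ^+ b') (lam ^+ c) (lam ^+ c').
by move=> x1 x2 x3 x4 x5 x6; ring.
Qed.

Lemma tzl_neq0 lam a b c : lam != 0 -> tzl lam a b c != 0.
Proof. by move=> h; rewrite !mulf_neq0 ?expf_neq0 ?inX_neq0 ?outX_neq0. Qed.

(* Laurent polynomials in t and z with powers of [lam] as denominators. *)
Definition cleared lam (x : E) : Prop :=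
  exists (a b c : nat) q, tofr (tzl lam a b c) * x = tofr q.

Lemma cleared_tofr lam q : cleared lam (tofr q).
Proof. by exists 0%N, 0%N, 0%N, q; rewrite /tzl !expr0 !mul1r tofr1 mul1r. Qed.

Lemma clearedM lam x y : cleared lam x -> cleared lam y -> cleared lam (x * y).
Proof.
move=> [a [b [c [q h]]]] [a' [b' [c' [q' h']]]].
exists (a + a')%N, (b + b')%N, (c + c')%N, (q * q').
by rewrite tzlD (tofrM (tzl _ _ _ _)) (tofrM q) -h -h'; exact: mulrACA.
Qed.

Lemma clearedD lam x y : cleared lam x -> cleared lam y -> cleared lam (x + y).
Proof.
move=> [a [b [c [q h]]]] [a' [b' [c' [q' h']]]].
exists (a + a')%N, (b + b')%N, (c + c')%N, (tzl lam a' b' c' * q + tzl lam a b c * q').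
rewrite tzlD tofrD (tofrM (tzl _ a b c)) (tofrM _ q) (tofrM _ q') -h -h' mulrDr; congr (_ + _); last by rewrite mulrA.
by rewrite mulrA [tofr _ * tofr _]mulrC.
Qed.

Lemma cleared_expz lam (x : E) (n : int) :
  cleared lam x -> cleared lam (x^-1) -> cleared lam (x ^ n).
Proof.
have pw (y : E) m : cleared lam y -> cleared lam (y ^+ m).
  move=> hy; elim: m => [|m IH]; last by rewrite exprS; exact: clearedM.
  by rewrite expr0 -[1](rmorph1 tofr); exact: cleared_tofr.
move=> h1 h2; case: n => n; first exact: pw.
by rewrite NegzE -exprnN -exprVn; exact: pw.
Qed.

Lemma cleared_tzlV lam a b c : lam != 0 -> cleared lam (tofr (tzl lam a b c))^-1.
Proof.
move=> l0; by exists a, b, c, 1; rewrite mulfV ?tofr1 ?tofr_eq0 ?tzl_neq0.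
Qed.

Lemma cleared_t lam (n : int) : cleared lam (tE ^ n).
Proof.
apply: cleared_expz; first exact: cleared_tofr.
exists 1%N, 0%N, 0%N, 1; rewrite /tzl !expr0 !mulr1 expr1 rmorph1.
by rewrite mulfV ?tE_neq0.
Qed.

Lemma cleared_z lam (n : int) : cleared lam (zE ^ n).
Proof.
apply: cleared_expz; first exact: cleared_tofr.
exists 0%N, 1%N, 0%N, 1; rewrite /tzl !expr0 mulr1 mul1r expr1 rmorph1.
by rewrite mulfV ?zE_neq0.
Qed.

Lemma cleared_quot lam e (n : int) : lam != 0 ->
  cleared lam ((tofr lam / tE ^+ e) ^ n).
Proof.
move=> l0; apply: cleared_expz.
  by apply: clearedM; [exact: cleared_tofr|rewrite exprnN; exact: cleared_t].
rewrite invf_div; apply: clearedM.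
  by rewrite exprnP; exact: cleared_t.
exists 0%N, 0%N, 1%N, 1; rewrite /tzl !expr0 !mul1r expr1 rmorph1.
by rewrite mulfV ?tofr_eq0.
Qed.

Lemma cleared_sum lam I (s : seq I) (F : I -> E) :
  (forall x, cleared lam (F x)) -> cleared lam (\sum_(x <- s) F x).
Proof.
move=> h; apply: (big_ind (cleared lam)) => //; last exact: clearedD.
by rewrite -[0](rmorph0 tofr); exact: cleared_tofr.
Qed.

(* Pairs (x, y) where y is the lowest term of x at z = 0. *)
Definition low_pair lam (x y : E) : Prop :=
  exists (a c : nat) q, tofr (tzl lam a 0 c) * x = tofr q /\
    tofr (tzl (outer (low lam)) a 0 c) * y = tofr (outer (low q)).

Lemma outer_low_tzl lam a c :
  outer (low (tzl lam a 0 c)) = tzl (outer (low lam)) a 0 c.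
Proof.
rewrite /tzl !expr0 !mulr1 rmorphM !rmorphXn /= low_inX.
by rewrite rmorphM !rmorphXn.
Qed.

Lemma outer_lowM q q' : outer (low (q * q')) = outer (low q) * outer (low q').
Proof. by rewrite !rmorphM. Qed.

Lemma outer_lowD q q' : outer (low (q + q')) = outer (low q) + outer (low q').
Proof. by rewrite !rmorphD. Qed.

Lemma low_pair_tofr lam q : low_pair lam (tofr q) (tofr (outer (low q))).
Proof. by exists 0%N, 0%N, q; rewrite /tzl !expr0 !mul1r tofr1 !mul1r. Qed.

Lemma low_pair0 lam : low_pair lam 0 0.
Proof. by have := low_pair_tofr lam 0; rewrite !rmorph0. Qed.

Lemma low_pairM lam x y x' y' : low_pair lam x y -> low_pair lam x' y' ->
  low_pair lam (x * x') (y * y').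
Proof.
move=> [a [c [q [h1 h2]]]] [a' [c' [q' [h1' h2']]]].
exists (a + a')%N, (c + c')%N, (q * q'); split.
  by rewrite (tzlD lam a 0 c a' 0 c') (tofrM (tzl _ _ _ _)) (tofrM q) -h1 -h1'; exact: mulrACA.
rewrite (tzlD _ a 0 c a' 0 c') (tofrM (tzl _ _ _ _)) (outer_lowM q).
by rewrite (tofrM (outer (low q))) -h2 -h2'; exact: mulrACA.
Qed.

Lemma low_pairD lam x y x' y' : low_pair lam x y -> low_pair lam x' y' ->
  low_pair lam (x + x') (y + y').
Proof.
move=> [a [c [q [h1 h2]]]] [a' [c' [q' [h1' h2']]]].
exists (a + a')%N, (c + c')%N, (tzl lam a' 0 c' * q + tzl lam a 0 c * q'); split.
  rewrite (tzlD lam a 0 c a' 0 c') tofrD (tofrM (tzl _ a 0 c)) (tofrM _ q) (tofrM _ q') -h1 -h1'.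
  rewrite mulrDr; congr (_ + _); last by rewrite mulrA.
  by rewrite mulrA [tofr _ * tofr _]mulrC.
rewrite (tzlD _ a 0 c a' 0 c') outer_lowD (outer_lowM _ q) (outer_lowM _ q') !outer_low_tzl.
rewrite tofrD (tofrM (tzl _ a 0 c)) (tofrM _ (outer (low q))) (tofrM _ (outer (low q'))) -h2 -h2'.
rewrite mulrDr; congr (_ + _); last by rewrite mulrA.
by rewrite mulrA [tofr _ * tofr _]mulrC.
Qed.

Lemma low_pair_expz lam x y (n : int) : low_pair lam x y ->
  low_pair lam (x^-1) (y^-1) -> low_pair lam (x ^ n) (y ^ n).
Proof.
have pw (x' y' : E) m : low_pair lam x' y' -> low_pair lam (x' ^+ m) (y' ^+ m).
  move=> hy; elim: m => [|m IH]; last by rewrite !exprS; exact: low_pairM.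
  by rewrite !expr0; have := low_pair_tofr lam 1; rewrite !rmorph1.
move=> h1 h2; case: n => n; first exact: pw.
by rewrite NegzE -!exprnN -!exprVn; exact: pw.
Qed.

Lemma low_pair_t lam (n : int) : low_pair lam (tE ^ n) (tE ^ n).
Proof.
apply: low_pair_expz.
  by have := low_pair_tofr lam (inX K); rewrite low_inX.
exists 1%N, 0%N, 1; rewrite /tzl !expr0 !mulr1 expr1 !rmorph1.
by rewrite mulfV ?tE_neq0.
Qed.

Lemma low_pair_quot lam e (n : int) : low lam != 0 ->
  low_pair lam ((tofr lam / tE ^+ e) ^ n) ((tofr (outer (low lam)) / tE ^+ e) ^ n).
Proof.
move=> l0; have l0' : lam != 0 by apply: contraNneq l0 => ->; rewrite rmorph0.
apply: low_pair_expz.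
  apply: low_pairM; first exact: low_pair_tofr.
  by rewrite exprnN; exact: low_pair_t.
rewrite !invf_div; apply: low_pairM.
  by rewrite exprnP; exact: low_pair_t.
exists 0%N, 1%N, 1; rewrite /tzl !expr0 !mul1r !expr1 !rmorph1.
by rewrite !mulfV ?tofr_eq0 ?outer_eq0.
Qed.

Lemma low_pair_z lam (n : nat) : (0 < n)%N -> low_pair lam (zE ^+ n) 0.
Proof.
case: n => // n _; have := low_pair_tofr lam (outX K ^+ n.+1).
by rewrite tofrXn rmorphXn /= low_outX expr0n !rmorph0.
Qed.

End Cleared.

Lemma seq_min (T : eqType) (d : Order.disp_t) (O : orderType d) (F : T -> O)
    (s : seq T) :
  s != [::] -> exists2 x, x \in s & forall y, y \in s -> (F x <= F y)%O.
Proof.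
elim: s => // x s IH _; have [->|/IH [y ys hy]] := eqVneq s [::].
  by exists x; rewrite ?mem_head // => y; rewrite mem_seq1 => /eqP ->.
have [h|h] := leP (F x) (F y).
  exists x; first exact: mem_head.
  by move=> z; rewrite inE => /orP[/eqP -> //|/hy]; exact: le_trans.
exists y; first by rewrite inE ys orbT.
by move=> z; rewrite inE => /orP[/eqP ->|/hy //]; exact: ltW.
Qed.

(** * Generators of the initial ideal of a plane curve *)

Section TropicalMultiplicity.
Variables (K : closedFieldType) (R : realType) (i j k l : 'I_4).
Hypothesis Hc : is_chart i j k l.
Variables (p r u v om : int).
Hypothesis Hb : p * u + r * v = 1.
Variable s : 'rV[int]_4.
Hypotheses (Hp : s 0 i - s 0 k = p) (Hr : s 0 j - s 0 k = r) (Hom : s 0 l - s 0 k = om).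

Local Notation w := (real_vec R s).
Local Notation tzy := (tzy K i j k l p r u v om).
Local Notation cT := (cT K i j k l p r u v om).
Local Notation cZ := (cZ K i j k l p r u v om).
Local Notation cY := (cY K i j k l p r u v om).
Local Notation tz_poly := (@tz_poly K i j k l p r u v om).
Local Notation cmono := (cmono K i j k l).
Local Notation xy_poly := (@xy_poly K i j k l).

Variables (E : fieldType) (tofr : {rmorphism bipoly K -> E}).
Hypothesis tofr_inj : injective tofr.
Local Notation tE := (frac_t tofr).
Local Notation zE := (frac_z tofr).
Let t0 : tE != 0 := tE_neq0 tofr_inj.
Let z0 : zE != 0 := zE_neq0 tofr_inj.

Variable P : set (laurent0 K).
Hypotheses (HP : is_prime P) (Hplane : P (plane_form K i j k l)).
Variable f : bipoly K.
Hypotheses (Hf : P (xy_poly f))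
  (Hdvd : forall q, P (xy_poly q) -> exists q', q = f * q').
Variables (lam : bipoly K) (e : nat).
Hypotheses
  (Hlam : tz_poly lam = - (tzy e (- om) 0 * (1 + cmono 1 0 0 + cmono 0 1 0)))
  (Hl1 : low lam != 0).
Variables (f1 : bipoly K) (a0 b0 : int).
Hypotheses (Hf1 : tz_poly f1 = tzy a0 b0 0 * xy_poly f) (Hh : low f1 != 0).

Local Notation l1 := (low lam).
Local Notation h := (low f1).
Local Notation I := (in_ideal w P).

(** On the plane y Z^-om T^e equals lam(T, Z), so this is the value of y Z^-om at the generic point.
    Keeping only the weight-0 part of lam gives [l1E], the corresponding value on the degenerate
    plane. *)
Definition lamE : E := tofr lam / tE ^+ e.
Definition l1E : E := tofr (outer l1) / tE ^+ e.
Local Notation ev := (wev i j l p r u v om (fconst tofr) tE zE lamE).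
Local Notation ev1 := (wev i j l p r u v om (fconst tofr) tE zE l1E).

Let PI : is_ideal P. Proof. by case: HP. Qed.
Let II : is_ideal (ideal_set I). Proof. exact: idealP. Qed.

Lemma lam_neq0 : lam != 0.
Proof. by apply: contraNneq Hl1 => ->; rewrite rmorph0. Qed.

Lemma lamE_neq0 : lamE != 0.
Proof. by rewrite mulf_neq0 ?invr_eq0 ?expf_neq0 ?t0 ?(tofr_eq0 tofr_inj) ?lam_neq0. Qed.

Lemma l1E_neq0 : l1E != 0.
Proof. by rewrite mulf_neq0 ?invr_eq0 ?expf_neq0 ?t0 ?(tofr_eq0 tofr_inj) ?outer_eq0. Qed.

Lemma ev_tzy a b c : ev (tzy a b c) = tE ^ a * zE ^ b * lamE ^ c.
Proof. exact: (wev_tzy Hc om Hb _ t0 z0 lamE_neq0). Qed.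

Lemma ev1_tzy a b c : ev1 (tzy a b c) = tE ^ a * zE ^ b * l1E ^ c.
Proof. exact: (wev_tzy Hc om Hb _ t0 z0 l1E_neq0). Qed.

Lemma ev_poly q : ev (tz_poly q) = tofr q.
Proof.
rewrite (wev_tz_poly Hc om Hb _ t0 z0 lamE_neq0).
exact: bieval_tofr.
Qed.

Lemma ev1_poly q : ev1 (tz_poly q) = tofr q.
Proof.
rewrite (wev_tz_poly Hc om Hb _ t0 z0 l1E_neq0).
exact: bieval_tofr.
Qed.

Lemma in_form_mem g : P g -> ideal_set I (in_form0 w g).
Proof. by move=> hg J [_ hJ]; apply: hJ; exists g. Qed.

Lemma cYcT : cY * cT ^+ e = tzy e 0 1.
Proof. by rewrite tzyX -tzyD; apply: tzy_eq; lia. Qed.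

Lemma relation_plane :
  cY * cT ^+ e - tz_poly lam = tzy e (- om) 0 * plane_form K i j k l.
Proof.
rewrite Hlam opprK cYcT /plane_form [RHS]mulrDr addrC; congr (_ + _).
have -> : cmono 0 0 1 = tzy 0 om 1.
  by rewrite (cmono_tzy _ _ _ _ _ om Hb); apply: tzy_eq; ring.
by rewrite -tzyD; apply: tzy_eq; ring.
Qed.

Lemma relation_mem : P (cY * cT ^+ e - tz_poly lam).
Proof. by rewrite relation_plane; case: PI => _ _; apply. Qed.

Lemma outer_coef (q : {poly K}) (y : nat) : (outer q)`_y != 0 -> y%:Z = 0.
Proof. by rewrite coefC; case: y => // y; rewrite eqxx. Qed.

Lemma outX_coef (q : bipoly K) (y : nat) : (outX K * q)`_y != 0 -> 0 < y%:Z.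
Proof. by case: y => // /eqP[]; rewrite -lowE rmorphM /= low_outX mul0r. Qed.

(** The monomial [cY * cT ^+ e] has weight 0 and [lam] contains no negative power of Z, so passing
    to the initial form of the plane relation cuts [lam] down to its part at Z = 0. *)
Lemma relation1_mem : ideal_set I (cY * cT ^+ e - tz_poly (outer l1)).
Proof.
have [q hq] := bipoly_low lam.
suff <- : in_form0 w (cY * cT ^+ e - tz_poly lam) = cY * cT ^+ e - tz_poly (outer l1).
  by apply: in_form_mem; exact: relation_mem.
apply: (in_form_homog _ Hc Hp Hr Hom
  (g1 := tz_poly (outX K * - q)) (W := 0)).
- by rewrite [in LHS]hq tz_polyD mulrN [tz_poly (- _)]rmorphN opprD addrA.
(* The initial form is nonzero: at the point with y Z^-om = Z its vanishing would read t^e z =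
   l1(t), and z = 0 contradicts [Hl1]. *)
- apply/eqP => /(congr1 (wev i j l p r u v om (fconst tofr) tE zE zE)).
  rewrite rmorphB rmorph0 cYcT /=.
  rewrite (wev_tzy Hc om Hb _ t0 z0 z0).
  rewrite (wev_tz_poly Hc om Hb _ t0 z0 z0) bieval_tofr expr0z mulr1 expr1z.
  rewrite -exprnP -tofrXn -tofrM => /eqP; rewrite subr_eq0 => /eqP/tofr_inj/(congr1 (@low K)).
  rewrite rmorphM /= low_outX low_outer mulr0 => /esym/eqP.
  by rewrite (negbTE Hl1).
- apply: wsubD; first by rewrite cYcT -[tzy _ _ _]mul1r -(rmorph1 (@const0 K)); apply: wsub_tzy.
  rewrite -[- _](rmorphN tz_poly) -(rmorphN (@outer K)); apply: wsub_tz_poly => //.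
  exact: outer_coef.
- by apply: wsub_tz_poly => //; exact: outX_coef.
Qed.

Lemma low_f1_mem : ideal_set I (tz_poly (outer h)).
Proof.
have [q hq] := bipoly_low f1.
suff <- : in_form0 w (tz_poly f1) = tz_poly (outer h).
  by apply: in_form_mem; rewrite Hf1; case: PI => _ _; apply.
apply: (in_form_homog _ Hc Hp Hr Hom
  (g1 := tz_poly (outX K * q)) (W := 0)).
- by rewrite [in LHS]hq tz_polyD.
- apply/eqP => /(congr1 ev1); rewrite rmorph0 ev1_poly.
  by move/eqP; rewrite (tofr_eq0 tofr_inj) outer_eq0 (negbTE Hh).
- by apply: wsub_tz_poly => //; exact: outer_coef.
- by apply: wsub_tz_poly => //; exact: outX_coef.
Qed.

Lemma ev1_relation : ev1 (cY * cT ^+ e - tz_poly (outer l1)) = 0.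
Proof.
rewrite rmorphB /= cYcT ev1_tzy ev1_poly.
rewrite expr0z mulr1 expr1z -exprnP /l1E [_ / _]mulrC mulrA mulfV ?expf_neq0 ?t0 //.
by rewrite mul1r subrr.
Qed.

Lemma ev_relation : ev (cY * cT ^+ e - tz_poly lam) = 0.
Proof.
rewrite rmorphB /= cYcT ev_tzy ev_poly.
rewrite expr0z mulr1 expr1z -exprnP /lamE [_ / _]mulrC mulrA mulfV ?expf_neq0 ?t0 //.
by rewrite mul1r subrr.
Qed.

(** Reduce g modulo I and the kernel of [ev1] at once: the common polynomial q vanishes at a point
    where T and Z are independent, so q = 0 and a unit times g lies in I. *)
Lemma ev1_kernel g : ev1 g = 0 -> ideal_set I g.
Proof.
move=> hg; have hJ := is_idealI II (kernel_ideal ev1).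
have [|a [b [c [q [h1 h2]]]]] := @laurent0_reduce K i j k l Hc p r u v om Hb _ (outer l1) e g hJ.
  by split; [exact: relation1_mem|exact: ev1_relation].
move: h2; rewrite /kernel /= rmorphB rmorphM /= hg mulr0 sub0r => /eqP.
rewrite oppr_eq0 ev1_poly (tofr_eq0 tofr_inj) => /eqP q0.
by move: h1; rewrite q0 rmorph0 subr0; apply: ideal_tzy.
Qed.

Lemma ev_sum g : ev g = \sum_(m <- msupp (val g))
  fconst tofr (mcoeff m (val g)) *
  (tE ^ wtau i j u v m * zE ^ wt i j l p r om m * lamE ^ m 0 l).
Proof. exact: (wevE i j l p r u v om (fconst tofr) t0 z0 lamE_neq0). Qed.

Lemma ev1_sum g : ev1 g = \sum_(m <- msupp (val g))
  fconst tofr (mcoeff m (val g)) *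
  (tE ^ wtau i j u v m * zE ^ wt i j l p r om m * l1E ^ m 0 l).
Proof. exact: (wevE i j l p r u v om (fconst tofr) t0 z0 l1E_neq0). Qed.

Lemma ev_cleared g : cleared tofr lam (ev g).
Proof.
rewrite ev_sum; apply: cleared_sum => m; apply: clearedM; first exact: cleared_tofr.
apply: clearedM; last exact/cleared_quot/lam_neq0.
by apply: clearedM; [exact: (cleared_t tofr_inj)|exact: (cleared_z tofr_inj)].
Qed.

Lemma ev1_cleared g : cleared tofr (outer l1) (ev1 g).
Proof.
rewrite ev1_sum; apply: cleared_sum => m; apply: clearedM; first exact: cleared_tofr.
apply: clearedM; last by apply: (cleared_quot tofr_inj); rewrite outer_eq0.
by apply: clearedM; [exact: (cleared_t tofr_inj)|exact: (cleared_z tofr_inj)].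
Qed.

(** Reduction modulo P and the kernel of [ev] at once replaces g by a polynomial in X and Y that
    lies in P and is thus divisible by f; at the generic point f is f1 up to a monomial. *)
Lemma ev_mem g : P g -> exists2 x, cleared tofr lam x & ev g = tofr f1 * x.
Proof.
move=> Pg; have hJ := is_idealI PI (kernel_ideal ev).
have [|a [b [c [q [h1 h2]]]]] := @xy_reduce K i j k l Hc _ g hJ.
  split=> //; rewrite /kernel /=; have := ev_relation; rewrite relation_plane rmorphM /= ev_tzy.
  move/eqP; rewrite mulf_eq0 => /orP[|/eqP //].
  by rewrite !mulf_eq0 !expfz_eq0 (negbTE t0) (negbTE z0) (negbTE lamE_neq0) !andbF.
have [q' e'] : exists q', q = f * q'.
  apply: Hdvd; apply: (cong_mem PI (cong_sym PI h1)).
  by case: PI => _ _; apply.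
have hf : ev (xy_poly f) = ev (tzy (- a0) (- b0) 0) * tofr f1.
  have /(congr1 ev) := Hf1; rewrite ev_poly rmorphM /= => ->.
  by rewrite mulrA -rmorphM -tzyD !addNr addr0 tzy0 rmorph1 mul1r.
move: h2; rewrite /kernel /= rmorphB => /eqP; rewrite subr_eq0 => /eqP.
rewrite e' [xy_poly _]rmorphM !rmorphM /= hf (cmono_tzy _ _ _ _ _ om Hb).
set a1 := (X in tzy X _ _); set b1 := (X in tzy _ X _) => h2.
exists (ev (tzy (- a1) (- b1) (- c%:Z)) * (ev (tzy (- a0) (- b0) 0) * ev (xy_poly q'))).
  by do 2 (apply: clearedM; first exact: ev_cleared); exact: ev_cleared.
transitivity (ev (tzy (- a1) (- b1) (- c%:Z)) * (ev (tzy a1 b1 c) * ev g)).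
  by rewrite mulrA -rmorphM [tzy _ _ _ * _]mulrC tzy_inv rmorph1 mul1r.
have comm4 (x1 x2 x3 x4 : E) : x1 * (x2 * x3 * x4) = x3 * (x1 * (x2 * x4)) by ring.
by apply: etrans (congr1 ( *%R _) h2) _; exact: comm4.
Qed.

Lemma val_in_form0_sum g : ev1 (in_form0 w g) =
  \sum_(m <- msupp (val g) | all (fun n => weight w m <= weight w n) (msupp (val g)))
    fconst tofr (mcoeff m (val g)) *
    (tE ^ wtau i j u v m * zE ^ wt i j l p r om m * l1E ^ m 0 l).
Proof.
have [n1 n2 n3] := wev_neq0 p r u v om t0 z0 l1E_neq0.
transitivity (laurent_eval i j l (fconst tofr) (zE ^ p * tE ^ (- v))
  (zE ^ r * tE ^ u) (l1E * zE ^ om) (in_form w (val g))) => //.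
rewrite /in_form -big_filter -[RHS]big_filter.
apply: etrans (laurent_eval_sum _ _ _ _ _ _ _ _ _) _.
apply: eq_bigr => m _; apply: etrans (laurent_eval_monom _ _ _ _ _ _ _ _ _) _.
by congr (_ * _); rewrite /chart_char !nzE // (wev_char _ _ _ _ _ t0 z0 l1E_neq0).
Qed.

(** After division by z to the minimal weight, the terms of that weight survive at z = 0 with lam
    replaced by its lowest part, while the others keep a positive power of z and disappear. The
    second entry may be 0, as an initial form can vanish on the degenerate plane. *)
Lemma low_pair_in_form g m0 : m0 \in msupp (val g) ->
  (forall m, m \in msupp (val g) -> wt i j l p r om m0 <= wt i j l p r om m) ->
  low_pair tofr lam (zE ^ (- wt i j l p r om m0) * ev g)
    (zE ^ (- wt i j l p r om m0) * ev1 (in_form0 w g)).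
Proof.
move=> hm0 hmin; set W := wt i j l p r om m0.
have hw m : m \in msupp (val g) -> weight w m = (wt i j l p r om m)%:~R.
  by move=> hm; apply: (weight_wt _ Hc Hp Hr Hom); have /allP/(_ _ hm)/eqP := valP g.
rewrite ev_sum val_in_form0_sum !mulr_sumr big_mkcond [X in low_pair _ _ _ X]big_mkcond.
rewrite big_seq [X in low_pair _ _ _ X]big_seq.
apply: (big_ind2 (low_pair tofr lam)) => [||m hm]; first exact: low_pair0.
  by move=> x y x' y'; exact: low_pairD.
have -> : all (fun n => weight w m <= weight w n) (msupp (val g)) = (wt i j l p r om m == W).
  apply/allP/eqP => [h|h n hn].
    apply/eqP; rewrite eq_le hmin // andbT; have := h _ hm0.
    by rewrite !hw // ler_int.
  by rewrite (hw _ hm) (hw _ hn) ler_int h hmin.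
have sh (z1 z2 x a y : E) : z1 * (x * (a * z2 * y)) = x * (a * (z2 * z1 * y)) by ring.
set c := mcoeff m _; set ta := tE ^ _; set wm := wt i j l p r om m.
have hc : low_pair tofr lam (fconst tofr c) (fconst tofr c).
  by have := low_pair_tofr tofr lam (bconst c); rewrite low_outer.
have hta : low_pair tofr lam ta ta by exact: low_pair_t.
have hla := low_pair_quot tofr_inj e (m 0 l) Hl1.
have shuffle (x y : E) : zE ^ (- W) * (x * (ta * zE ^ wm * y)) = x * (ta * (zE ^ (wm - W) * y)).
  by rewrite (expfzDr wm (- W) z0); exact: sh.
rewrite /= !shuffle; case: eqP => [->|/eqP hW].
  by rewrite subrr expr0z !mul1r; do 2 (apply: low_pairM => //).
have [n [n0 ->]] : exists n : nat, (0 < n)%N /\ wm - W = n.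
  have := hmin _ hm; rewrite -/wm -/W => hle; exists `|wm - W|%N.
  by split; [rewrite absz_gt0 subr_eq0|rewrite gez0_abs ?subr_ge0].
rewrite -exprnP.
have := low_pairM hc (low_pairM hta (low_pairM (low_pair_z tofr lam n0) hla)).
by rewrite mul0r !mulr0.
Qed.

(** Lowest terms are multiplicative: [ev g] is f1 times some x, so its lowest term is h times that
    of x. If the initial form vanishes under [ev1], the multiple is 0. *)
Lemma in_form_multiple g : P g ->
  exists2 x, cleared tofr (outer l1) x & ev1 (in_form0 w g) = tofr (outer h) * x.
Proof.
move=> Pg; have [g0|g0] := eqVneq (msupp (val g) : seq _) [::].
  exists 0; first by rewrite -(rmorph0 tofr); exact: cleared_tofr.
  by rewrite mulr0 val_in_form0_sum g0 big_nil.
have [m0 hm0 hmin] := seq_min (wt i j l p r om) g0.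
have [a [c [q [h1 h2]]]] := low_pair_in_form hm0 hmin.
set W := wt i j l p r om m0 in h1 h2.
have [x [a1 [b1 [c1 [q2 hx]]]] hf] := ev_mem Pg.
have tz0 la' a' b' c' : la' != 0 -> tofr (tzl la' a' b' c') != 0.
  by move=> la0; rewrite (tofr_eq0 tofr_inj) tzl_neq0.
have l10 : outer l1 != 0 by rewrite outer_eq0.
have z0' n : zE ^ n != 0 by rewrite expfz_neq0.
have [q0|q0] := eqVneq (low q) 0.
  exists 0; first by rewrite -(rmorph0 tofr); exact: cleared_tofr.
  move/eqP: h2; rewrite q0 !rmorph0 mulr0 !mulf_eq0 (negbTE (tz0 _ _ _ _ l10)).
  by rewrite (negbTE (z0' _)) => /eqP.
have key : zE ^ W * tofr (tzl lam a1 b1 c1 * q) = tofr (tzl lam a 0 c * (f1 * q2)).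
  rewrite (tofrM tofr _ q) -h1 (tofrM tofr _ (f1 * q2)) (tofrM tofr f1) -hx hf.
  have zz : zE ^ W * zE ^ (- W) = 1 by rewrite -(expfzDr W (- W) z0) subrr expr0z.
  move: (tofr (tzl lam a1 b1 c1)) (tofr (tzl lam a 0 c)) (tofr f1) zz => A1 A2 F.
  move: (zE ^ W) (zE ^ (- W)) => z1 z2 zz.
  transitivity ((z1 * z2) * (A1 * A2 * F * x)); first ring.
  by rewrite zz mul1r; ring.
(* W may have either sign; the power of z goes to the side where its exponent is nonnegative, which
   makes [key] an identity of polynomials. *)
have [n1 [n2 key2]] : exists n1 n2 : nat,
    outX K ^+ n1 * (tzl lam a1 b1 c1 * q) = outX K ^+ n2 * (tzl lam a 0 c * (f1 * q2)).
  move: key; case: (W) => n.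
    move=> hn; exists n, 0%N; apply: tofr_inj; rewrite mul1r -hn -exprnP.
    by rewrite [LHS]tofrM tofrXn.
  rewrite NegzE -exprnN => hn; exists 0%N, n.+1; apply: tofr_inj.
  by rewrite mul1r [RHS]tofrM tofrXn -hn mulrA mulfV ?mul1r // expf_neq0.
have q20 : q2 != 0.
  apply: contraNneq q0 => q20; move: key2; rewrite q20 !mulr0 => /eqP.
  rewrite mulf_eq0 expf_eq0 (negbTE (outX_neq0 K)) andbF /=.
  rewrite mulf_eq0 (negbTE (tzl_neq0 _ _ _ lam_neq0)) /=.
  by move/eqP => ->; rewrite rmorph0.
have [n3 [q3 [hq3 q30]]] := bipoly_low_factor q20.
have low3 : low (tzl lam a1 0 c1 * q) = low (tzl lam a 0 c * (f1 * q3)).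
  have e1 : outX K ^+ (n1 + b1) * (tzl lam a1 0 c1 * q) =
      outX K ^+ (n2 + n3) * (tzl lam a 0 c * (f1 * q3)).
    move: key2; rewrite hq3 /tzl !exprD expr0 => key2; apply: etrans (etrans key2 _).
      move: (inX K ^+ a1) (outX K ^+ n1) (outX K ^+ b1) (lam ^+ c1) => x1 x2 x3 x4; ring.
    move: (inX K ^+ a) (outX K ^+ n2) (outX K ^+ n3) (lam ^+ c) => x1 x2 x3 x4; ring.
  have lt0 a' c' : low (tzl lam a' 0 c') != 0.
    by rewrite -outer_eq0 outer_low_tzl tzl_neq0.
  apply: (low_unique e1).
    by rewrite rmorphM /= mulf_neq0.
  by rewrite rmorphM /= mulf_neq0 // rmorphM /= mulf_neq0.
have {}low3 : tofr (tzl (outer l1) a1 0 c1) * tofr (outer (low q)) =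
    tofr (tzl (outer l1) a 0 c) * (tofr (outer h) * tofr (outer (low q3))).
  rewrite -!tofrM -!outer_low_tzl -!outer_lowM; congr (tofr (outer _)).
  exact: low3.
exists (zE ^ W * tofr (outer (low q3)) * (tofr (tzl (outer l1) a1 0 c1))^-1).
  apply: clearedM; last exact: cleared_tzlV.
  by apply: clearedM; [exact: cleared_z|exact: cleared_tofr].
move: h2 low3 => <-; move: (tz0 _ a1 0%N c1 l10) (tz0 _ a 0%N c l10).
have zz : zE ^ W * zE ^ (- W) = 1 by rewrite -(expfzDr W (- W) z0) subrr expr0z.
move: (tofr (tzl _ a1 0 c1)) (tofr (tzl _ a 0 c)) (ev1 _) (tofr (outer h)) zz.
move: (tofr (outer (low q3))) (zE ^ W) (zE ^ (- W)) => Q3 z1 z2 A1 A Y H zz A10 A0 e1.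
have {}e1 : A1 * (z2 * Y) = H * Q3.
  apply: (mulfI A0); rewrite -e1; ring.
apply: (mulfI A10).
transitivity (z1 * z2 * (A1 * Y)); first by rewrite zz mul1r.
transitivity (z1 * (A1 * (z2 * Y))); first ring.
rewrite e1; transitivity (A1 * A1^-1 * (z1 * (H * Q3))); last ring.
by rewrite mulfV // mul1r.
Qed.

(* The converse of [low_f1_mem] and [ev1_kernel]: together they say that the
   initial ideal is generated by the kernel of [ev1] and the lowest form of f. *)
Lemma in_ideal_multiple g : ideal_set I g ->
  exists2 x, cleared tofr (outer l1) x & ev1 g = tofr (outer h) * x.
Proof.
move=> hg; apply: (hg [set g' | exists2 x, cleared tofr (outer l1) x &
  ev1 g' = tofr (outer h) * x]).
split; last by move=> _ [g' hg' <-]; exact: in_form_multiple.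
split=> [|g1 g2 [x1 h1 e1] [x2 h2 e2]|a g1 [x h1 e1]].
- exists 0; first by rewrite -(rmorph0 tofr); exact: cleared_tofr.
  by rewrite mulr0 rmorph0.
- exists (x1 + x2); first exact: clearedD.
  by rewrite rmorphD /= e1 e2 mulrDr.
- exists (ev1 a * x); first by apply: clearedM => //; exact: ev1_cleared.
  by rewrite rmorphM /= e1 mulrCA.
Qed.

End TropicalMultiplicity.

Lemma prod_XsubC_count (K : fieldType) (c : K) (rs : seq K) :
  \prod_(z <- rs) ('X - z%:P) =
  ('X - c%:P) ^+ count_mem c rs * \prod_(z <- rs | z != c) ('X - z%:P).
Proof.
elim: rs => [|z rs IH]; first by rewrite !big_nil mulr1.
rewrite !big_cons IH /=; case: eqP => [->|_] /=; first by rewrite exprS mulrA.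
by rewrite add0n mulrCA.
Qed.

(** * Minimal primes and local lengths of the initial ideal *)

Section InitialIdealLength.
Variables (K : fieldType) (i j k l : 'I_4).
Hypothesis Hc : is_chart i j k l.
Variables (p r u v om : int).
Hypothesis Hb : p * u + r * v = 1.

Local Notation tzy := (tzy K i j k l p r u v om).
Local Notation cT := (cT K i j k l p r u v om).
Local Notation cY := (cY K i j k l p r u v om).
Local Notation tz_poly := (@tz_poly K i j k l p r u v om).

Variables (E : fieldType) (tofr : {rmorphism bipoly K -> E}).
Hypothesis tofr_inj : injective tofr.
Variables (F : fieldType) (tofr1 : {rmorphism {poly K} -> F}).
Hypothesis tofr1_inj : injective tofr1.
Local Notation tE := (frac_t tofr).
Local Notation zE := (frac_z tofr).
Let t0 : tE != 0 := tE_neq0 tofr_inj.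
Let z0 : zE != 0 := zE_neq0 tofr_inj.

Variables (l1 : {poly K}) (e : nat).
Hypothesis Hl1 : l1 != 0.
Let l1E : E := tofr (outer l1) / tE ^+ e.
Local Notation ev1 := (wev i j l p r u v om (fconst tofr) tE zE l1E).

Variables (I : ideal (laurent0 K)) (h : {poly K}) (rs : seq K).
Hypothesis Hker : forall g, ev1 g = 0 -> ideal_set I g.
Hypothesis Hlow : ideal_set I (tz_poly (outer h)).
Hypothesis Hmult : forall g, ideal_set I g ->
  exists2 x, cleared tofr (outer l1) x & ev1 g = tofr (outer h) * x.
Hypotheses (Hh0 : h != 0) (Hrs : h = lead_coef h *: \prod_(z <- rs) ('X - z%:P)).

(** Over T = c the degenerate plane has y Z^-om = l1(c) / c^e; these are the c over which it has
    points in the torus. *)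
Definition good (c : K) := (c != 0) && (l1.[c] != 0).

Lemma tofr1_eq0 q : (tofr1 q == 0) = (q == 0).
Proof. by rewrite -(rmorph0 tofr1) (inj_eq tofr1_inj). Qed.

Let l10 : l1E != 0.
Proof. by rewrite mulf_neq0 ?invr_eq0 ?expf_neq0 ?t0 // (tofr_eq0 tofr_inj) outer_eq0. Qed.

Lemma ev1_tzy' a b c : ev1 (tzy a b c) = tE ^ a * zE ^ b * l1E ^ c.
Proof. exact: (wev_tzy Hc om Hb _ t0 z0 l10). Qed.

Lemma ev1_poly' q : ev1 (tz_poly q) = tofr q.
Proof. by rewrite (wev_tz_poly Hc om Hb _ t0 z0 l10); exact: bieval_tofr. Qed.

Lemma cYcT' : cY * cT ^+ e = tzy e 0 1.
Proof. by rewrite tzyX -tzyD; apply: tzy_eq; lia. Qed.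

Lemma ev1_relation' : ev1 (cY * cT ^+ e - tz_poly (outer l1)) = 0.
Proof.
rewrite rmorphB /= cYcT' ev1_tzy' ev1_poly'.
by rewrite expr0z mulr1 expr1z -exprnP /l1E mulrC divfK ?subrr // expf_neq0.
Qed.

Section Root.
Variable c : K.
Hypothesis Hgood : good c.

Let c0 : c != 0. Proof. by case/andP: Hgood. Qed.
Let lc0 : l1.[c] != 0. Proof. by case/andP: Hgood. Qed.

Definition tc : F := tofr1 c%:P.
Definition zc : F := tofr1 'X.
Definition lc : F := tofr1 (l1.[c] / c ^+ e)%:P.
(** The generic point of the component over T = c: T and y Z^-om are constants, and only Z is
    free. *)
Definition evc : laurent0 K -> F :=
  wev i j l p r u v om (tofr1 \o polyC) tc zc lc.
HB.instance Definition _ := GRing.RMorphism.copy evc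
  (wev i j l p r u v om (tofr1 \o polyC) tc zc lc).

Lemma tc_neq0 : [/\ tc != 0, zc != 0 & lc != 0].
Proof.
by rewrite !tofr1_eq0 !polyC_eq0 polyX_eq0 c0 mulf_neq0 // invr_eq0 expf_neq0.
Qed.

Lemma evc_tzy a b d : evc (tzy a b d) = tc ^ a * zc ^ b * lc ^ d.
Proof. by have [h1 h2 h3] := tc_neq0; exact: (wev_tzy Hc om Hb _ h1 h2 h3). Qed.

Lemma evc_tzy_neq0 a b d : evc (tzy a b d) != 0.
Proof. by have [h1 h2 h3] := tc_neq0; rewrite evc_tzy !mulf_neq0 // expfz_neq0. Qed.

Lemma evc_poly q : evc (tz_poly q) = tofr1 (specialize c q).
Proof.
have [h1 h2 h3] := tc_neq0.
by rewrite [LHS](wev_tz_poly Hc om Hb _ h1 h2 h3) [RHS]rmorph_bieval.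
Qed.

Lemma evc_reduce g : exists (a b d : nat) q,
  [/\ ev1 (tzy a b d * g - tz_poly q) = 0 & evc (tzy a b d * g - tz_poly q) = 0].
Proof.
have hJ := is_idealI (kernel_ideal ev1) (kernel_ideal evc).
have [|a [b [d [q [h1 h2]]]]] := @laurent0_reduce K i j k l Hc p r u v om Hb _ (outer l1) e g hJ.
  split; first exact: ev1_relation'.
  rewrite /kernel /= rmorphB /= cYcT' evc_tzy evc_poly specialize_outer.
  rewrite expr0z mulr1 expr1z -exprnP -rmorphXn -rmorphM -polyC_exp -polyCM /=.
  by rewrite mulrC divfK ?subrr // expf_neq0.
by exists a, b, d, q.
Qed.

(** Substituting T = c in the factorization of [ev1 g] is legitimate: the denominators of a cleared
    element are powers of T, Z and l1, and none of them vanishes at a good c. *)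
Lemma evc_vanish g h' x : h'.[c] = 0 -> cleared tofr (outer l1) x ->
  ev1 g = tofr (outer h') * x -> evc g = 0.
Proof.
move=> hc [a [b [d [q' hx]]]] hg.
have [a' [b' [d' [q [h1 h2]]]]] := evc_reduce g.
move/eqP: h1; rewrite rmorphB rmorphM /= ev1_tzy' ev1_poly' subr_eq0 => /eqP h1.
have e1 : tofr (tzl (outer l1) a b d * (inX K ^+ (e * d') * q)) =
    tofr (tzl (outer l1) a' b' d' * (outer h' * q')).
  rewrite !(tofrM tofr (tzl _ _ _ _)) !(tofrM tofr _ q) !(tofrM tofr _ q') -hx -h1 hg.
  have -> : tofr (tzl (outer l1) a' b' d') =
      tofr (inX K ^+ (e * d')) * (tE ^ a' * zE ^ b' * l1E ^ d').
    rewrite -!exprnP /l1E /tzl !tofrM !tofrXn exprMn exprVn -exprM /frac_t /frac_z.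
    have hX : tofr (inX K) ^+ (e * d') != 0 by rewrite expf_neq0.
    move: hX; move: (_ ^+ (e * d')) => y y0.
    move: (_ ^+ a') (_ ^+ b') (_ ^+ d') => x1 x2 x3.
    by field.
  move: (tofr (tzl _ _ _ _)) (tofr (inX K ^+ _)) (tE ^ _ * _ * _) (tofr (outer h')) => x1 x2 x3 x4.
  ring.
have sp0 a1 b1 d1 : specialize c (tzl (outer l1) a1 b1 d1) != 0.
  rewrite /tzl !rmorphM !rmorphXn /= specialize_outX !specialize_outer hornerX.
  by rewrite !mulf_neq0 // expf_neq0 // ?polyC_eq0 // polyX_eq0.
have /(congr1 (specialize c)) := tofr_inj e1.
have specM q1 q2 : specialize c (q1 * q2) = specialize c q1 * specialize c q2.
  exact: rmorphM.
rewrite (specM (tzl _ a b d)) (specM (tzl _ a' b' d')) (specM (outer h')) (specM _ q).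
rewrite [specialize c (outer h')]specialize_outer hc polyC0 mul0r mulr0 => /eqP.
rewrite mulf_eq0 (negbTE (sp0 _ _ _)) /= mulf_eq0 rmorphXn expf_eq0 /= specialize_outer hornerX.
rewrite polyC_eq0 (negbTE c0) andbF /= => /eqP sq.
move/eqP: h2; rewrite rmorphB rmorphM /= evc_poly sq rmorph0 subr0 mulf_eq0.
by rewrite (negbTE (evc_tzy_neq0 _ _ _)) => /eqP.
Qed.

End Root.

Definition root_prime (c : K) : spec (laurent0 K) := Spec (kernel_prime (evc c)).

Lemma ideal_evc c g : good c -> h.[c] = 0 -> ideal_set I g -> evc c g = 0.
Proof. by move=> hc h0 /Hmult[x hx e1]; apply: (evc_vanish hc h0 hx e1). Qed.

(* The ideal of [evc c] is generated, up to units, by T - c and I. *)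
Lemma evc_principal c g : good c -> evc c g = 0 ->
  exists (a b d : nat) y,
    ideal_set I (tzy a b d * g - tz_poly (outer ('X - c%:P)) * y).
Proof.
move=> hc hg; have [a [b [d [q [h1 h2]]]]] := evc_reduce hc g.
have : specialize c q = 0.
  move/eqP: h2; rewrite rmorphB rmorphM /= hg mulr0 sub0r oppr_eq0.
  by rewrite (evc_poly hc) tofr1_eq0 => /eqP.
move=> /specialize_eq0[q' eq]; exists a, b, d, (tz_poly q').
by apply: Hker; rewrite -h1 eq tz_polyM.
Qed.

(** A prime containing h(T) contains a linear factor T - c of it. If c were 0 or a root of l1, the
    prime would contain T or, by the plane relation, [cY * cT ^+ e]; both are units. *)
Lemma prime_root (Q : spec (laurent0 K)) : I `<=` Q ->
  exists c, [/\ c \in rs, good c & kernel (evc c) `<=` Q].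
Proof.
move=> hIQ; have [[Q0 QD QM] Q1 Qp] := specP Q.
have unitQ a b d : ~ spec_set Q (tzy a b d) by exact: (prime_tzy (specP Q)).
have : spec_set Q (tz_poly (outer (\prod_(z <- rs) ('X - z%:P)))).
  have : spec_set Q (tz_poly (outer h)) by exact: hIQ.
  rewrite {1}Hrs -mul_polyC rmorphM tz_polyM /= tz_polyC => /Qp[hl|//].
  case: Q1; have := QM (const0 (lead_coef h)^-1) _ hl.
  by rewrite -rmorphM mulVf ?lead_coef_eq0 // rmorph1.
have prodQ (cs : seq K) : spec_set Q (tz_poly (outer (\prod_(z <- cs) ('X - z%:P)))) ->
    exists2 c, c \in cs & spec_set Q (tz_poly (outer ('X - c%:P))).
  elim: cs => [|c cs IH]; first by rewrite big_nil !rmorph1.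
  rewrite big_cons rmorphM tz_polyM => /Qp[hc|/IH[c' hc' hQ]].
    by exists c; rewrite ?mem_head.
  by exists c'; rewrite // inE hc' orbT.
move=> /prodQ [c hc hQc]; exists c.
have hgood : good c.
  apply/andP; split.
    apply/eqP => c0; apply: (unitQ 1 0 0); move: hQc.
    by rewrite c0 subr0 -[outer 'X]/(inX K) tz_polyT.
  apply/negP => /eqP/eqP/factor_theorem[l' hl'].
  apply: (unitQ e 0 1); rewrite -cYcT'.
  apply: (cong_mem (J := spec_set Q)); first by split.
    exact: (hIQ _ (Hker ev1_relation')).
  by rewrite hl' rmorphM tz_polyM; apply: QM.
split=> // g hg; have [a [b [d [y hy]]]] := evc_principal hgood hg.
apply: (ideal_tzy (a := a) (b := b) (c := d)); first by split.
apply: (cong_mem (J := spec_set Q)) (hIQ _ hy) _; first by split.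
by rewrite mulrC; apply: QM.
Qed.

Lemma root_prime_inj c c' : good c -> kernel (evc c') `<=` kernel (evc c) ->
  good c' -> c' = c.
Proof.
move=> hc hsub hc'.
have /hsub : kernel (evc c') (tz_poly (outer ('X - c'%:P))).
  by rewrite /kernel /= (evc_poly hc') specialize_outer !hornerE subrr rmorph0.
rewrite /kernel /= (evc_poly hc) specialize_outer !hornerE => /eqP.
by rewrite tofr1_eq0 polyC_eq0 subr_eq0 => /eqP.
Qed.

Lemma root_h c : c \in rs -> h.[c] = 0.
Proof.
move=> hc; rewrite Hrs hornerZ.
have /rootP -> : root (\prod_(z <- rs) ('X - z%:P)) c by rewrite root_prod_XsubC.
by rewrite mulr0.
Qed.

Lemma minimal_prime_root Q : minimal_prime I Q <->
  exists2 c, c \in undup (filter good rs) & Q = root_prime c.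
Proof.
split.
  move=> [hI hmin]; have [c [hc hgood hsub]] := prime_root hI.
  exists c; first by rewrite mem_undup mem_filter hgood.
  apply/spec_eq/seteqP; split=> //; apply: hmin => //.
  by move=> g hg; exact: (ideal_evc hgood (root_h hc)).
move=> [c]; rewrite mem_undup mem_filter => /andP[hgood hc] ->; split.
  by move=> g hg; exact: (ideal_evc hgood (root_h hc)).
move=> Q' /prime_root[c' [hc' hgood' hsub']] hsub.
have <- : c' = c by apply: root_prime_inj => //; exact: subset_trans hsub' hsub.
exact: hsub'.
Qed.

(** Write h = (T - c)^(m+1) h2 with h2(c) nonzero. In the local ring h2 is a unit and T - c
    generates the maximal ideal. *)
Lemma root_prime_length c : c \in filter good rs ->
  ring_length (quotient_at I (root_prime c)) = count_mem c rs.
Proof.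
rewrite mem_filter => /andP[hgood hc].
have : (0 < count_mem c rs)%N by rewrite -has_count has_pred1.
case em: (count_mem c rs) => [//|m] _.
pose h2 := lead_coef h *: \prod_(z <- rs | z != c) ('X - z%:P).
have hh : h = ('X - c%:P) ^+ m.+1 * h2.
  by rewrite {1}Hrs (prod_XsubC_count c) em /h2 -scalerAr.
have h2c : h2.[c] != 0.
  rewrite hornerZ mulf_neq0 ?lead_coef_eq0 // horner_prod prodf_seq_neq0.
  by apply/allP => z _; rewrite !hornerE subr_eq0 eq_sym; apply/implyP.
apply: (local_lengthE (x := tz_poly (outer ('X - c%:P)))).
- move=> g /(evc_principal hgood)[a [b [d [y hy]]]].
  by exists (tzy a b d), y; split=> //; exact/eqP/evc_tzy_neq0.
- exists (tz_poly (outer h2)); split.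
    rewrite /= /kernel /= (evc_poly hgood) specialize_outer; apply/eqP.
    by rewrite tofr1_eq0 polyC_eq0.
  by move: Hlow; rewrite {1}hh rmorphM rmorphXn tz_polyM tz_polyXn mulrC.
(* If (T - c)^m g were in I, cancelling (T - c)^m would leave [ev1 g] divisible by (T - c) h2, which
   vanishes at c, and g would lie in the prime. *)
- move=> g hg /Hmult[x hx].
  have -> : ev1 (g * tz_poly (outer ('X - c%:P)) ^+ m) =
      ev1 g * tofr (outer ('X - c%:P)) ^+ m.
    by rewrite [LHS]rmorphM -tz_polyXn [X in _ * X](ev1_poly' _) tofrXn.
  rewrite hh => e1; apply: hg.
  apply: (evc_vanish hgood (h' := ('X - c%:P) * h2) (x := x)) => //.
    by rewrite hornerM hornerXsubC subrr mul0r.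
  have h0 : tofr (outer ('X - c%:P)) ^+ m != 0.
    by rewrite expf_neq0 // (tofr_eq0 tofr_inj) outer_eq0 polyXsubC_eq0.
  apply: (mulfI h0); rewrite mulrC e1 exprSr -mulrA [outer _]rmorphM tofrM rmorphXn tofrXn.
  by rewrite mulrA.
Qed.

Lemma initial_length :
  \sum_(Q \in [set Q : spec (laurent0 K) | minimal_prime I Q])
    ring_length (quotient_at I Q) = count good rs.
Proof.
rewrite (sum_minimal_primes (s := undup (filter good rs)) (Q := root_prime)).
- rewrite -size_filter -sum1_size -(big_undup_iterop_count _ (filter good rs) xpredT).
  rewrite !big_seq; apply: eq_bigr => c; rewrite mem_undup => hc.
  have hg : good c by move: hc; rewrite mem_filter => /andP[].
  rewrite root_prime_length // count_filter.
  have -> : count (predI (pred1 c) good) rs = count_mem c rs.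
    by apply: eq_count => x /=; case: eqP => // ->.
  by case: (count_mem c rs) => // n; rewrite iteropS; elim: n => //= n <-.
- exact: undup_uniq.
- move=> c c'; rewrite !mem_undup !mem_filter => /andP[hc _] /andP[hc' _] ec.
  apply: root_prime_inj => //; have /(congr1 (@spec_set _)) /= := ec => ->.
  exact: subset_refl.
- exact: minimal_prime_root.
Qed.

End InitialIdealLength.

(** * Edge polynomials *)

Section EdgePolynomials.
Variables (K : fieldType) (i j k l : 'I_4).
Hypothesis Hc : is_chart i j k l.
Variables (p r u v om : int).
Hypothesis Hb : p * u + r * v = 1.
Hypotheses (Hom0 : om <= 0) (Homp : om <= p) (Homr : om <= r).

Local Notation tzy := (tzy K i j k l p r u v om).
Local Notation tz_poly := (@tz_poly K i j k l p r u v om).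
Local Notation cmono := (cmono K i j k l).

Definition tz_mono (a b : int) : bipoly K := inX K ^+ absz a * outX K ^+ absz b.

Lemma tz_poly_tz_mono a b : 0 <= a -> 0 <= b -> tz_poly (tz_mono a b) = tzy a b 0.
Proof.
move=> ha hb; have := tz_poly_mono K Hc om Hb (absz a) (absz b).
by rewrite !gez0_abs.
Qed.

Lemma low_tz_mono a b : low (tz_mono a b) = if b == 0 then 'X^(absz a) else 0.
Proof.
rewrite /tz_mono rmorphM !rmorphXn /= low_inX low_outX expr0n absz_eq0.
by case: eqP => _; rewrite ?mulr1 ?mulr0.
Qed.

(** A value of e for which e, e - v and e + u, the exponents of T in T^e, T^e X and T^e Y, are
    nonnegative. *)
Definition lam_exp : nat := (absz u + absz v)%N.

(** This is -T^e Z^-om (1 + X + Y) with X = Z^p T^-v and Y = Z^r T^u. The exponents of Z are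
    nonnegative because [om] is the least of the four weights. *)
Definition lam_poly : bipoly K :=
  - (tz_mono lam_exp (- om) + tz_mono (lam_exp%:Z - v) (p - om) +
     tz_mono (lam_exp%:Z + u) (r - om)).

Lemma lam_polyE :
  tz_poly lam_poly = - (tzy lam_exp (- om) 0 * (1 + cmono 1 0 0 + cmono 0 1 0)).
Proof.
rewrite /lam_poly [LHS]rmorphN !rmorphD /= !tz_poly_tz_mono; rewrite ?/lam_exp; try lia.
rewrite !mulrDr mulr1 !(cmono_tzy _ _ _ _ _ om Hb) -!tzyD.
have add3 (a b c a' b' c' : laurent0 K) : a = a' -> b = b' -> c = c' ->
  - (a + b + c) = - (a' + b' + c') by move=> -> -> ->.
by apply: add3; apply: tzy_eq; ring.
Qed.

Variable f : bipoly K.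

Definition coef2 (x y : nat) : K := (f`_y)`_x.
Definition shift_exp : nat := ((absz u + absz v) * (\max_(y < size f) size (f`_y)%R + size f))%N.

Lemma coef2_bound x y : coef2 x y != 0 ->
  (y < size (f : {poly {poly K}}))%N /\ (x < size (f`_y)%R)%N.
Proof.
move=> h; have hx : (x < size (f`_y)%R)%N.
  by rewrite ltnNge; apply: contra h => hs; rewrite /coef2 nth_default.
split=> //; rewrite ltnNge; apply: contraL hx => hs.
by rewrite [f`_y]nth_default // size_poly0.
Qed.

Lemma shift_exp_ge x y : coef2 x y != 0 ->
  0 <= shift_exp%:Z + (- v * x + u * y).
Proof.
move=> /coef2_bound[hy hx].
have hx' : (x <= \max_(y < size f) size (f`_y)%R)%N.
  by apply: leq_trans (ltnW hx) (leq_bigmax (Ordinal hy)).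
rewrite /shift_exp; move: hx' (ltnW hy); set a := \max_(_ < _) _; set b := size _.
move=> h1 h2; clearbody a b.
have h3 : (absz v * x <= absz v * a)%N by rewrite leq_mul2l h1 orbT.
have h4 : (absz u * y <= absz u * b)%N by rewrite leq_mul2l h2 orbT.
by nia.
Qed.

Variable W : int.
Hypothesis HW : forall x y, coef2 x y != 0 -> W <= p * x + r * y.

(** The monomial T^[shift_exp] Z^-W times f, rewritten in T and Z. For W the minimal weight, its
    part at Z = 0 carries the coefficients of f on the face with inner normal (p, r). *)
Definition edge_bipoly : bipoly K := \sum_(y < size f) \sum_(x < size f`_y)
  bconst (coef2 x y) *
    tz_mono (shift_exp%:Z + (- v * x + u * y)) (p * x + r * y - W).

Lemma edge_bipolyE :
  tz_poly edge_bipoly = tzy shift_exp (- W) 0 * xy_poly i j k l f.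
Proof.
rewrite /xy_poly bievalE mulr_sumr [LHS]rmorph_sum; apply: eq_bigr => y _.
rewrite mulr_sumr [LHS]rmorph_sum; apply: eq_bigr => x _.
rewrite [LHS]rmorphM /= tz_polyC -[(f`_y)`_x]/(coef2 x y).
have [->|h] := eqVneq (coef2 x y) 0; first by rewrite rmorph0 !mul0r mulr0.
rewrite tz_poly_tz_mono ?shift_exp_ge ?subr_ge0 ?HW // -mulrA mulrCA; congr (_ * _).
rewrite !cmonoX !(cmono_tzy _ _ _ _ _ om Hb) -!tzyD; apply: tzy_eq.
- by rewrite !mul0rn; lia.
- by rewrite !mul0rn; lia.
- by rewrite !mul0rn; lia.
Qed.

Lemma low_edge_coef n : (low edge_bipoly)`_n =
  \sum_(y < size f) \sum_(x < size f`_y)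
    (if (p * x + r * y == W) && (shift_exp%:Z + (- v * x + u * y) == n) then coef2 x y else 0).
Proof.
rewrite /edge_bipoly rmorph_sum coef_sum; apply: eq_bigr => y _.
rewrite rmorph_sum coef_sum; apply: eq_bigr => x _.
rewrite rmorphM /= low_outer low_tz_mono subr_eq0.
have [->|h] := eqVneq (coef2 x y) 0; first by rewrite mul0r coef0 if_same.
case: eqP => _ /=; last by rewrite mulr0 coef0.
rewrite coefCM coefXn; have := shift_exp_ge h; set a := _ + _ => a0.
have -> : (n == `|a|%N) = (a == n) by lia.
by case: eqP; rewrite ?mulr1 ?mulr0.
Qed.

Lemma low_edge_coefP n : (low edge_bipoly)`_n != 0 -> exists x y,
  [/\ coef2 x y != 0, p * x + r * y = W & shift_exp%:Z + (- v * x + u * y) = n].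
Proof.
rewrite low_edge_coef => h; apply: contrapT => hn; move/eqP: h; apply.
apply: big1 => y _; apply: big1 => x _; case: ifP => // /andP[/eqP h1 /eqP h2].
by apply/eqP; apply: contrapT => h; apply: hn; exists x, y; split=> //; apply/negP.
Qed.

(** By unimodularity a monomial of f is determined by its weight and its exponent of T; so no two of
    them meet in one coefficient and nothing cancels. *)
Lemma low_edge_coef_neq0 x y n : coef2 x y != 0 -> p * x + r * y = W ->
  shift_exp%:Z + (- v * x + u * y) = n%:Z -> (low edge_bipoly)`_n = coef2 x y.
Proof.
move=> h hW hn; have [hy hx] := coef2_bound h; rewrite low_edge_coef.
have uniq2 (x' y' : nat) : p * x' + r * y' = W -> shift_exp%:Z + (- v * x' + u * y') = n ->
    x' = x /\ y' = y.
  move=> h1 h2.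
  have e1 : p * (x'%:Z - x%:Z) + r * (y'%:Z - y%:Z) = 0.
    by rewrite !mulrBr addrACA h1 -opprD hW subrr.
  have e2 : - v * (x'%:Z - x%:Z) + u * (y'%:Z - y%:Z) = 0 by lia.
  have e3 : (p * u + r * v) * (x'%:Z - x%:Z) = 0.
    transitivity (u * (p * (x'%:Z - x%:Z) + r * (y'%:Z - y%:Z)) -
      r * (- v * (x'%:Z - x%:Z) + u * (y'%:Z - y%:Z))); first ring.
    by rewrite e1 e2 !mulr0 subr0.
  have e4 : (p * u + r * v) * (y'%:Z - y%:Z) = 0.
    transitivity (v * (p * (x'%:Z - x%:Z) + r * (y'%:Z - y%:Z)) +
      p * (- v * (x'%:Z - x%:Z) + u * (y'%:Z - y%:Z))); first ring.
    by rewrite e1 e2 !mulr0 addr0.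
  by move: e3 e4; rewrite Hb !mul1r; lia.
rewrite (bigD1 (Ordinal hy)) //= (bigD1 (Ordinal hx)) //= hW hn !eqxx /=.
rewrite big1 ?addr0; last first.
  move=> x' hx'; case: ifP => // /andP[/eqP h1 /eqP h2].
  have [e1 _] := uniq2 _ _ h1 h2.
  by move: hx'; rewrite -val_eqE /= e1 eqxx.
rewrite big1 ?addr0 // => y' hy'; rewrite big1 // => x' _.
case: ifP => // /andP[/eqP h1 /eqP h2]; have [_ e1] := uniq2 _ _ h1 h2.
by case/eqP: hy'; apply: val_inj.
Qed.

End EdgePolynomials.

(** Here n0 is the multiplicity of the root 0 and n1 the degree. This turns a number of roots into
    the length of an exponent range, and so into a lattice length. *)
Lemma nonzero_roots_count (K : fieldType) (h : {poly K}) (rs : seq K) :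
  h != 0 -> h = lead_coef h *: \prod_(z <- rs) ('X - z%:P) ->
  exists n0 n1 : nat, [/\ (n0 <= n1)%N, h`_n0 != 0, h`_n1 != 0,
    forall n, h`_n != 0 -> (n0 <= n <= n1)%N & count (predC1 0) rs = (n1 - n0)%N].
Proof.
move=> h0 hrs.
have hl : lead_coef h != 0 by rewrite lead_coef_eq0.
set n0 := count_mem 0 rs; set q := lead_coef h *: \prod_(z <- rs | z != 0) ('X - z%:P).
have hq : h = 'X^n0 * q.
  by rewrite {1}hrs (prod_XsubC_count 0) subr0 /q -scalerAr.
have q0 : q`_0 != 0.
  rewrite -horner_coef0 hornerZ mulf_neq0 // horner_prod prodf_seq_neq0.
  by apply/allP => z _; rewrite !hornerE oppr_eq0; apply/implyP.
have szh : size h = (size rs).+1.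
  by rewrite hrs size_scale // size_prod_XsubC.
have hn : (n0 + count (predC1 0%R) rs = size rs)%N.
  by rewrite -(count_predC (pred1 (0%R : K)) rs); congr addn; apply: eq_count.
exists n0, (size rs); split.
- exact: count_size.
- by rewrite hq coefXnM ltnn subnn.
- by move: hl; rewrite lead_coefE szh.
- move=> n hn0; apply/andP; split.
    by rewrite leqNgt; apply: contra hn0 => hlt; rewrite hq coefXnM hlt.
  by rewrite -ltnS -szh ltnNge; apply: contra hn0 => hs; rewrite nth_default.
- by rewrite -hn addKn.
Qed.

Section MinimalWeight.
Variables (K : fieldType) (f : bipoly K) (p r : int).

Lemma coef2_finite : exists pts : seq (nat * nat), forall x y, (coef2 f x y != 0) = ((x, y) \in pts).
Proof.
pose N := (\max_(y < size f) size (f`_y)%R + size f)%N.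
have bound x y : coef2 f x y != 0 -> (x < N)%N /\ (y < N)%N.
  move=> /coef2_bound[hy hx]; split.
    apply: leq_trans hx _; rewrite /N; apply: leq_trans (leq_addr _ _).
    exact: (leq_bigmax (Ordinal hy)).
  by apply: leq_trans hy _; rewrite /N leq_addl.
exists [seq a <- [seq (x, y) | x <- iota 0 N, y <- iota 0 N] | coef2 f a.1 a.2 != 0] => x y.
rewrite mem_filter /=; case h : (coef2 f x y != 0) => //=.
have [hx hy] := bound _ _ h; apply/esym/allpairsP; exists (x, y).
by rewrite !mem_iota.
Qed.

Lemma coef2_lead : f != 0 -> exists x, coef2 f x (size f).-1 != 0.
Proof.
move=> f0; exists (size (f`_(size f).-1)%R).-1.
rewrite /coef2 -[_`_(_.-1)]/(lead_coef f`_(size f).-1) lead_coef_eq0.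
by rewrite -[_`_ _]/(lead_coef (f : {poly {poly K}})) lead_coef_eq0.
Qed.

Lemma min_weight : f != 0 -> exists W x0 y0,
  [/\ coef2 f x0 y0 != 0, p * x0%:Z + r * y0%:Z = W &
    forall x y : nat, coef2 f x y != 0 -> W <= p * x + r * y].
Proof.
move=> f0; have [pts ptsP] := coef2_finite; have [xn hn] := coef2_lead f0.
have s0 : pts != [::] by apply/eqP => e; move: hn; rewrite ptsP e.
have [[x0 y0] hs hmin] := seq_min (fun a : nat * nat => p * a.1%:Z + r * a.2%:Z) s0.
exists (p * x0%:Z + r * y0%:Z), x0, y0; split=> //; first by rewrite ptsP.
by move=> x y; rewrite ptsP => /hmin.
Qed.

End MinimalWeight.

(* [P] is the ideal of the curve with equation [f] in the chart. *)
Definition chart_equation (K : fieldType) (i j k l : 'I_4) (P : set (laurent0 K))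
    (f : bipoly K) : Prop :=
  [/\ f != 0, P (xy_poly i j k l f) &
    forall q, P (xy_poly i j k l q) -> exists q', q = f * q'].

Section TropMult.
Variables (K : closedFieldType) (R : realType) (i j k l : 'I_4).
Hypothesis Hc : is_chart i j k l.
Variables (p r u v om : int).
Hypothesis Hb : p * u + r * v = 1.
Hypotheses (Hom0 : om <= 0) (Homp : om <= p) (Homr : om <= r).
Variables (Z : curve K) (s : ray).
Hypotheses (Hp : val s 0 i - val s 0 k = p) (Hr : val s 0 j - val s 0 k = r)
  (Hom : val s 0 l - val s 0 k = om).
Hypothesis Hplane : curve_ideal Z (plane_form K i j k l).
Variable f : bipoly K.
Hypothesis Hf : chart_equation i j k l (curve_ideal Z) f.
Hypothesis Hl1 : low (lam_poly K p r u v om) != 0.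

(** Roots of the edge polynomial at which l1 vanishes are left out, the third coordinate being zero
    there. Nonzero roots of this kind can occur only if at least two of 0, p, r are equal to [om];
    otherwise l1 is a monomial. *)
Lemma trop_multE : exists W h rs,
  [/\ (forall x y : nat, coef2 f x y != 0 -> W <= p * x + r * y),
    h = low (edge_bipoly p r u v f W), h != 0,
    h = lead_coef h *: \prod_(z <- rs) ('X - z%:P) &
    trop_mult R Z s = count (good (low (lam_poly K p r u v om))) rs].
Proof.
have [f0 Pf fdvd] := Hf.
have [W [x0 [y0 [h00 hW hmin]]]] := min_weight p r f0.
have hh : low (edge_bipoly p r u v f W) != 0.
  have hx := shift_exp_ge Hc Hb Hom0 Homp Homr h00.
  apply/eqP => h0; have := low_edge_coef_neq0 Hc Hb Hom0 Homp Homr h00 hW (esym (gez0_abs hx)).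
  by rewrite h0 coef0 => e; move: h00; rewrite -e eqxx.
have [rs hrs] := closed_field_poly_normal (low (edge_bipoly p r u v f W)).
exists W, (low (edge_bipoly p r u v f W)), rs; split=> //.
have HP : is_prime (curve_ideal Z) by exact: specP.
have injF : injective (@FracField.tofrac (bipoly K)).
  by move=> a b /eqP; rewrite tofrac_eq => /eqP.
have injF1 : injective (@FracField.tofrac {poly K}).
  by move=> a b /eqP; rewrite tofrac_eq => /eqP.
have Hlam := lam_polyE K Hc Hb Hom0 Homp Homr.
have Hf1 := edge_bipolyE Hc Hb Hom0 Homp Homr hmin.
apply: (@initial_length K i j k l Hc p r u v om Hb _ _ injF _ _ injF1 _ _ Hl1 _ _ rs) => //.
- exact: (ev1_kernel Hc Hb Hp Hr Hom injF HP Hplane Hlam Hl1 hh).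
- exact: (low_f1_mem Hc Hb Hp Hr Hom injF HP Pf (lam_exp u v) Hl1 Hf1 hh).
- exact: (in_ideal_multiple Hc Hb Hp Hr Hom injF HP Hplane fdvd Hlam Hl1 Hf1 hh).
- exact: hh.
- exact: hrs.
Qed.

End TropMult.

(** * Equations of plane curves *)

Section PlanePrime.
Variables (K : closedFieldType) (pp : set (bipoly K)).
Hypothesis Hpp : is_prime pp.
Hypothesis pp_neq0 : exists2 q, pp q & q != 0.
Hypothesis pp_nonmax : forall al be : K,
  ~ (pp (outer ('X - al%:P)) /\ pp (outX K - bconst be)).

Let p0 : pp 0. Proof. by case: Hpp => -[]. Qed.
Let pD x y : pp x -> pp y -> pp (x + y). Proof. by case: Hpp => -[_ h _ _ _]; apply: h. Qed.
Let pM a x : pp x -> pp (a * x). Proof. by case: Hpp => -[_ _ h _ _]; apply: h. Qed.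
Let p1 : ~ pp 1. Proof. by case: Hpp. Qed.
Let pP x y : pp (x * y) -> pp x \/ pp y. Proof. by case: Hpp => _ _; apply. Qed.

Lemma pp_const c : c != 0 -> ~ pp (bconst c).
Proof.
move=> c0 h; apply: p1; have := pM (bconst c^-1) h.
by rewrite -rmorphM mulVf // rmorph1.
Qed.

Lemma pp_outer a : a != 0 -> pp (outer a) -> exists al, pp (outer ('X - al%:P)).
Proof.
move=> a0; have [rs ->] := closed_field_poly_normal a.
rewrite -mul_polyC rmorphM => /pP[/(pp_const)|]; first by rewrite lead_coef_eq0.
elim: rs => [|c rs IH]; first by rewrite big_nil rmorph1.
by rewrite big_cons rmorphM => /pP[h|/IH //]; exists c.
Qed.

Definition vpoly : {poly K} -> bipoly K := poly_eval (@bconst K) (outX K).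
HB.instance Definition _ := GRing.RMorphism.copy vpoly (poly_eval (@bconst K) (outX K)).

Lemma pp_vpoly b : b != 0 -> pp (vpoly b) -> exists be, pp (outX K - bconst be).
Proof.
move=> b0; have [rs ->] := closed_field_poly_normal b.
rewrite -mul_polyC rmorphM /= {1}/vpoly poly_evalC => /pP[/(pp_const)|].
  by rewrite lead_coef_eq0.
elim: rs => [|c rs IH]; first by rewrite big_nil rmorph1.
rewrite big_cons rmorphM rmorphB /= /vpoly poly_evalC poly_evalX => /pP[h|/IH //].
by exists c.
Qed.

Lemma specialize_vpoly c b : specialize c (vpoly b) = b.
Proof.
apply: (@poly_rmorph_ext _ _ (specialize c \o vpoly) idfun) => [a|] /=; rewrite /vpoly.
  by rewrite poly_evalC specialize_outer hornerC.
by rewrite poly_evalX specialize_outX.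
Qed.

(** A prime containing a polynomial in X alone contains some X - al, which then generates it as it
    is not the ideal of a point. Otherwise f has least degree in Y and, among such elements, a
    leading coefficient of least degree. The second choice makes f primitive, so the factor
    introduced by pseudo-division can be cancelled. *)
Lemma plane_prime_principal : exists f, [/\ f != 0, pp f & forall q, pp q -> exists q', q = f * q'].
Proof.
have [[a [a0 ha]]|hno] := pselect (exists a : {poly K}, a != 0 /\ pp (outer a)).
  have [al hal] := pp_outer a0 ha; exists (outer ('X - al%:P)); split=> //.
    by rewrite outer_eq0 polyXsubC_eq0.
  move=> q hq; apply: specialize_eq0; apply: contrapT => /eqP hs.
  have [q' hq'] : exists q', q - vpoly (specialize al q) = outer ('X - al%:P) * q'.
    by apply: specialize_eq0; rewrite rmorphB /= specialize_vpoly subrr.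
  have [|be hbe] := pp_vpoly hs; last exact: (@pp_nonmax al be).
  have -> : vpoly (specialize al q) = q - outer ('X - al%:P) * q'.
    by rewrite -hq' opprB addrC subrK.
  by apply: pD => //; rewrite -mulN1r; apply: pM; rewrite mulrC; apply: pM.
have hno' al : ~ pp (outer ('X - al%:P)).
  by move=> h; apply: hno; exists ('X - al%:P); rewrite polyXsubC_eq0.
pose sz (q : bipoly K) := size (q : {poly {poly K}}).
pose lc (q : bipoly K) := lead_coef (q : {poly {poly K}}).
have ex1 : exists n, `[< exists q, [/\ pp q, q != 0 & sz q = n] >].
  by have [q hq q0] := pp_neq0; exists (sz q); apply/asboolP; exists q.
have [n /asboolP hn nmin] := ex_minnP ex1.
have ex2 : exists d, `[< exists q, [/\ pp q, q != 0, sz q = n & size (lc q) = d] >].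
  by have [q [h1 h2 h3]] := hn; exists (size (lc q)); apply/asboolP; exists q.
have [d /asboolP[f [pf f0 sf df]] dmin] := ex_minnP ex2.
exists f; split=> // q hq.
(* The cofactor of X - al in f would also lie in the prime, with the same degree in Y and a leading
   coefficient of smaller degree. *)
have prim al : specialize al f <> 0.
  move=> /specialize_eq0[f' ef]; have := pf; rewrite ef => /pP[/hno' //|pf'].
  have f'0 : f' != 0 by apply: contraNneq f0 => e; rewrite ef e mulr0.
  have szf : sz f = sz f'.
    by rewrite ef /sz [size _]size_Cmul // polyXsubC_eq0.
  have lcf : lc f = ('X - al%:P) * lc f'.
    by rewrite ef /lc [lead_coef _]lead_coefM lead_coefC.
  have : (d <= size (lc f'))%N.
    by apply: dmin; apply/asboolP; exists f'; split=> //; rewrite -szf.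
  rewrite -df lcf size_mul ?polyXsubC_eq0 ?lead_coef_eq0 // size_XsubC /=.
  by rewrite ltnn.
(* As in Gauss's lemma: setting X = al shows that X - al divides g, since it does not divide f. *)
have cancel_roots (rs : seq K) g q' : outer (\prod_(z <- rs) ('X - z%:P)) * q' = f * g ->
    exists g', q' = f * g'.
  elim: rs g q' => [|al rs IH] g q'.
    by rewrite big_nil rmorph1 mul1r => ->; exists g.
  rewrite big_cons rmorphM -mulrA => e1.
  have : specialize al (f * g) = 0.
    by rewrite -e1 rmorphM /= specialize_outer hornerXsubC subrr polyC0 mul0r.
  rewrite rmorphM => /eqP; rewrite mulf_eq0 => /orP[/eqP/prim //|/eqP/specialize_eq0[g' eg]].
  apply: (IH g'); apply: (mulfI (_ : outer ('X - al%:P) != 0)).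
    by rewrite outer_eq0 polyXsubC_eq0.
  by rewrite [LHS]e1 eg mulrCA.
have cancel (a : {poly K}) g q' : a != 0 -> outer a * q' = f * g -> exists g', q' = f * g'.
  move=> a0; have [rs ->] := closed_field_poly_normal a.
  rewrite -mul_polyC rmorphM -mulrA => e1.
  apply: (cancel_roots rs (bconst (lead_coef a)^-1 * g)).
  have hl : bconst (lead_coef a)^-1 * outer (lead_coef a)%:P = 1.
    rewrite -[outer _]/(bconst (lead_coef a)) -(rmorphM (@bconst K)) /=.
    by rewrite mulVf ?lead_coef_eq0 // rmorph1.
  by rewrite mulrCA -e1 [RHS]mulrA hl mul1r.
pose g : bipoly K := divp (q : {poly {poly K}}) f.
pose rr : bipoly K := modp (q : {poly {poly K}}) f.
pose kq := scalp (q : {poly {poly K}}) f.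
have hlt : (sz rr < sz f)%N by exact: Pdiv.Idomain.ltn_modpN0.
have e2 : outer (lc f ^+ kq) * q = g * f + rr.
  apply: etrans (Pdiv.Idomain.divp_eq (q : {poly {poly K}}) f).
  exact: mul_polyC.
have prr : pp rr.
  have -> : rr = outer (lc f ^+ kq) * q - g * f.
    by rewrite e2 addrC addKr.
  by apply: pD; [exact: pM|rewrite -mulNr; exact: pM].
have rr0 : rr = 0.
  apply: contrapT => /eqP hrr.
  have : (n <= sz rr)%N by apply: nmin; apply/asboolP; exists rr.
  by rewrite leqNgt -sf hlt.
apply: (cancel (lc f ^+ kq) g).
  by rewrite expf_neq0 // lead_coef_eq0.
by rewrite e2 rr0 addr0 mulrC.
Qed.

End PlanePrime.

Section QuotientPrimes.
Variables (A : comPzRingType) (P : spec A).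

(** The image of Q in A / P, tested on a representative; for an ideal Q containing P the choice does
    not matter. *)
Definition image_ideal (Q : set A) : set (quotient (spec_ideal P)) :=
  [set x | Q (repr x)].

Lemma image_idealP (Q : set A) a : is_ideal Q -> (P : set A) `<=` Q ->
  image_ideal Q (proj (spec_ideal P) a) <-> Q a.
Proof.
move=> [_ QD QM] hPQ; rewrite /image_ideal /=; set b := repr _.
have h : spec_set P (b - a) by apply/(projP (spec_ideal P)); rewrite projK.
split=> hb; last by rewrite -[b](subrK a); apply: QD => //; exact: hPQ.
by rewrite -[a](subKr b); apply: QD => //; rewrite -mulN1r; apply: QM; exact: hPQ.
Qed.

Lemma image_ideal_prime (Q : set A) : is_prime Q -> (P : set A) `<=` Q ->
  is_prime (image_ideal Q).
Proof.
move=> [hQ Q1 Qp] hPQ; have imP a := image_idealP a hQ hPQ.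
have [Q0 QD QM] := hQ; split; first split.
- have <- : proj (spec_ideal P) 0 = 0.
    by apply/proj_eq0; case: (idealP (spec_ideal P)).
  exact/imP.
- by move=> x y hx hy; rewrite -[x]projK -[y]projK -projD; apply/imP; exact: QD.
- by move=> a x hx; rewrite -[a]projK -[x]projK -proj_mul; apply/imP; exact: QM.
- by move/imP.
- by move=> x y; rewrite -[x]projK -[y]projK -proj_mul => /imP/Qp[h|h]; [left|right]; apply/imP.
Qed.

Lemma image_ideal_proper (Q Q' : set A) : is_ideal Q -> is_ideal Q' ->
  (P : set A) `<=` Q -> Q `<=` Q' -> (exists2 x, Q' x & ~ Q x) ->
  image_ideal Q `<` image_ideal Q'.
Proof.
move=> hQ hQ' hPQ hQQ [x hx hx']; split=> [y|h]; first exact: hQQ.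
have hPQ' : (P : set A) `<=` Q' by apply: subset_trans hQQ.
by apply: hx'; apply/(image_idealP x hQ hPQ)/h/(image_idealP x hQ' hPQ').
Qed.

End QuotientPrimes.

Section CurveEquation.
Variables (K : closedFieldType) (i j k l : 'I_4).
Hypothesis Hc : is_chart i j k l.
Variable Z : curve K.
Hypothesis Hplane : curve_ideal Z (plane_form K i j k l).
Local Notation P := (val Z).
Local Notation cmono := (cmono K i j k l).
Local Notation xy_poly := (@xy_poly K i j k l).

Let HP : is_prime P := specP P.
Let PI : is_ideal P. Proof. by case: HP. Qed.

Lemma krull_curve : krull_dim_eq (quotient (spec_ideal P)) 1.
Proof. by case: (Z) => Q h; exact/asboolP. Qed.

Variables (F : fieldType) (tofr1 : {rmorphism {poly K} -> F}).
Hypothesis tofr1_inj : injective tofr1.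

Let tofr1_neq0 q : q != 0 -> tofr1 q != 0.
Proof. by move=> h; rewrite -(rmorph0 tofr1) (inj_eq tofr1_inj). Qed.

(* The points (1, T, -2 - T), for T generic, and (1, -1, -1) of the plane. *)
Definition generic_pt : laurent0 K -> F :=
  ceval i j l (tofr1 \o polyC) 1 (tofr1 'X) (tofr1 (- (1 + 1 + 'X))).
HB.instance Definition _ := GRing.RMorphism.copy generic_pt
  (ceval i j l (tofr1 \o polyC) 1 (tofr1 'X) (tofr1 (- (1 + 1 + 'X)))).
Definition special_pt : laurent0 K -> K := ceval i j l idfun 1 (- 1) (- 1).
HB.instance Definition _ := GRing.RMorphism.copy special_pt
  (ceval i j l idfun 1 (- 1) (- 1)).

Lemma generic_neq0 : [/\ (1 : F) != 0, tofr1 'X != 0 & tofr1 (- (1 + 1 + 'X)) != 0].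
Proof.
rewrite oner_eq0; split=> //; apply: tofr1_neq0; first by rewrite polyX_eq0.
rewrite oppr_eq0; apply/eqP => /(congr1 (fun q : {poly K} => q`_1)).
by rewrite !coefD !coef1 coefX coef0 !add0r => /eqP; rewrite oner_eq0.
Qed.

Lemma special_neq0 : (1 : K) != 0 /\ (- 1 : K) != 0.
Proof. by rewrite oppr_eq0 oner_eq0. Qed.

Lemma generic_mono a b c : generic_pt (cmono a b c) =
  tofr1 'X ^ b * tofr1 (- (1 + 1 + 'X)) ^ c.
Proof.
have [h1 h2 h3] := generic_neq0.
by rewrite [LHS](ceval_mono Hc) !nzE // exp1rz mul1r.
Qed.

Lemma special_mono a b c : special_pt (cmono a b c) = (- 1) ^ b * (- 1) ^ c.
Proof.
have [h1 h2] := special_neq0.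
by rewrite [LHS](ceval_mono Hc) !nzE // exp1rz mul1r.
Qed.

Lemma generic_poly q : generic_pt (xy_poly q) = tofr1 (specialize 1 q).
Proof.
apply: (@bipoly_rmorph_ext _ _ (generic_pt \o xy_poly) (tofr1 \o specialize 1)) => [c||] /=.
- by rewrite /xy_poly bievalC poly_evalC [LHS]ceval_const specialize_outer hornerC.
- rewrite /xy_poly bievalC poly_evalX generic_mono !expr0z mulr1.
  by rewrite specialize_outer hornerX rmorph1.
- by rewrite /xy_poly bievalX generic_mono expr0z mulr1 expr1z specialize_outX.
Qed.

Lemma special_poly q : special_pt (xy_poly q) = (specialize 1 q).[- 1].
Proof.
apply: (@bipoly_rmorph_ext _ _ (special_pt \o xy_poly) (horner_eval (- 1) \o specialize 1)) => [c||] /=;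
  rewrite /horner_eval.
- by rewrite /xy_poly bievalC poly_evalC [LHS]ceval_const specialize_outer !hornerC.
- rewrite /xy_poly bievalC poly_evalX special_mono !expr0z mulr1.
  by rewrite specialize_outer hornerX hornerC.
- by rewrite /xy_poly bievalX special_mono expr0z mulr1 expr1z specialize_outX hornerX.
Qed.

Lemma generic_plane : generic_pt (plane_form K i j k l) = 0.
Proof.
rewrite /plane_form !rmorphD rmorph1 /= !generic_mono !expr0z !expr1z !mulr1 mul1r.
by rewrite rmorphN !rmorphD !rmorph1 subrr.
Qed.

Lemma special_plane : special_pt (plane_form K i j k l) = 0.
Proof.
rewrite /plane_form !rmorphD rmorph1 /= !special_mono !expr0z !expr1z !mulr1 mul1r.
by rewrite addrK subrr.
Qed.

(** Otherwise P lies in the ideal of the curve X = 1 of the plane, the kernel of [generic_pt]. With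
    the point [special_pt] on it this gives a chain of three primes, against dimension 1. *)
Lemma curve_poly_neq0 : exists2 q, spec_set P (xy_poly q) & q != 0.
Proof.
apply: contrapT => hno.
have hP0 q : spec_set P (xy_poly q) -> q = 0.
  by move=> h; apply: contrapT => /eqP h'; apply: hno; exists q.
have [_] := krull_curve; apply.
have sub1 : (P : set _) `<=` kernel generic_pt.
  move=> g hg; have hJ := is_idealI PI (kernel_ideal generic_pt).
  have [|a [b [c [q [h1 h2]]]]] := @xy_reduce K i j k l Hc _ g hJ.
    by split; [exact: Hplane|exact: generic_plane].
  have q0 : q = 0.
    apply: hP0; apply: (cong_mem PI (cong_sym PI h1)).
    by case: PI => _ _; apply.
  move: h2; rewrite q0 rmorph0 subr0 /kernel /= rmorphM /= => /eqP.
  rewrite mulf_eq0 generic_mono mulf_eq0 !expfz_eq0.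
  by have [_ /negbTE -> /negbTE ->] := generic_neq0; rewrite !andbF => /eqP.
have sub2 : kernel generic_pt `<=` kernel special_pt.
  move=> g hg; have hJ := is_idealI (kernel_ideal generic_pt) (kernel_ideal special_pt).
  have [|a [b [c [q [h1 h2]]]]] := @xy_reduce K i j k l Hc _ g hJ.
    by split; [exact: generic_plane|exact: special_plane].
  move/eqP: h1; rewrite rmorphB rmorphM /= hg mulr0 sub0r oppr_eq0 generic_poly.
  rewrite -(rmorph0 tofr1) (inj_eq tofr1_inj) => /eqP q0.
  move: h2; rewrite /kernel /= rmorphB rmorphM /= special_poly q0 horner0 subr0 => /eqP.
  rewrite mulf_eq0 special_mono mulf_eq0 !expfz_eq0 oppr_eq0 oner_eq0 !andbF.
  by move/eqP.
pose Q1 := kernel generic_pt; pose Q2 := kernel special_pt.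
exists (fun n : 'I_3 => @image_ideal _ P (nth (P : set _) [:: (P : set _); Q1; Q2] n)).
have prime1 : is_prime Q1 by exact: kernel_prime.
have prime2 : is_prime Q2 by exact: kernel_prime.
have lt1 : @image_ideal _ P P `<` @image_ideal _ P Q1.
  apply: image_ideal_proper => //; first exact: kernel_ideal.
  exists (xy_poly (inX K - 1)).
    by rewrite /Q1 /kernel /= generic_poly rmorphB rmorph1 /= specialize_inX subrr rmorph0.
  move/hP0/eqP; rewrite subr_eq0 => /eqP/(congr1 (@specialize K 0)).
  by rewrite specialize_inX rmorph1 => /eqP; rewrite eq_sym oner_eq0.
have lt2 : @image_ideal _ P Q1 `<` @image_ideal _ P Q2.
  apply: image_ideal_proper => //; [exact: kernel_ideal|exact: kernel_ideal|].
  exists (xy_poly (outX K + 1)).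
    rewrite /Q2 /kernel /= special_poly rmorphD rmorph1 /= specialize_outX.
    by rewrite hornerD hornerX hornerC addNr.
  rewrite /Q1 /kernel /= generic_poly rmorphD rmorph1 /= specialize_outX.
  apply/eqP; apply: tofr1_neq0; apply/eqP => /(congr1 (fun q : {poly K} => q`_1)).
  by rewrite coefD coef1 coefX coef0 addr0 => /eqP; rewrite oner_eq0.
split.
  move=> [[|[|[|//]]] hn] /=; apply: image_ideal_prime => //.
  exact: subset_trans sub2.
move=> [[|[|[|//]]] hn] [[|[|[|//]]] hn'] //= _.
case: lt1 lt2 => [h1 h2] [h3 h4]; split; first exact: subset_trans h3.
by move=> h5; apply: h2; exact: subset_trans h3 h5.
Qed.

(** Otherwise everything is congruent to a constant modulo P: polynomials by evaluation, and
    monomials to nonzero constants since they are units. The quotient would be a field, which has no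
    chain of two primes. *)
Lemma curve_not_point al be :
  ~ (spec_set P (xy_poly (outer ('X - al%:P))) /\
     spec_set P (xy_poly (outX K - bconst be))).
Proof.
move=> [h1 h2].
have [_ PD PM] := PI.
have xyD q1 q2 : xy_poly (q1 + q2) = xy_poly q1 + xy_poly q2 by exact: rmorphD.
have xyM q1 q2 : xy_poly (q1 * q2) = xy_poly q1 * xy_poly q2 by exact: rmorphM.
have xyC c : xy_poly (bconst c) = const0 c.
  by rewrite /xy_poly /bconst bievalC poly_evalC.
have polyP q : exists c, cong P (xy_poly q) (const0 c).
  have [q' hq'] : exists q', q - vpoly (specialize al q) = outer ('X - al%:P) * q'.
    by apply: specialize_eq0; rewrite rmorphB /= specialize_vpoly subrr.
  set b := specialize al q in hq'.
  have /factor_theorem[b' hb'] : root (b - b.[be]%:P) be.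
    by rewrite rootE !hornerE subrr.
  exists b.[be]; have -> : xy_poly q = xy_poly (outer ('X - al%:P)) * xy_poly q' +
      (xy_poly (vpoly b') * xy_poly (outX K - bconst be) + const0 b.[be]).
    have vX : vpoly ('X - be%:P) = outX K - bconst be.
      by rewrite rmorphB /= /vpoly poly_evalX poly_evalC.
    have -> : q = outer ('X - al%:P) * q' + vpoly b by rewrite -hq' subrK.
    have -> : vpoly b = vpoly b' * (outX K - bconst be) + bconst b.[be].
      rewrite -vX -rmorphM -hb' rmorphB /= {3}/vpoly poly_evalC subrK //.
    by rewrite (xyD (outer _ * _)) (xyD (vpoly b' * _)) (xyM (outer _)) (xyM (vpoly b')) xyC.
  rewrite /cong addrA addrK; apply: PD; last exact: PM.
  by rewrite mulrC; exact: PM.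
have monoP (a b c : nat) : exists2 m, m != 0 & cong P (cmono a b c) (const0 m).
  have [m hm] := polyP (inX K ^+ a * outX K ^+ b * (- (1 + inX K + outX K)) ^+ c).
  have hM : cong P (cmono a b c) (const0 m).
    apply: cong_trans hm => //.
    have -> : cmono a b c = cmono 1 0 0 ^+ a * cmono 0 1 0 ^+ b * cmono 0 0 1 ^+ c.
      by rewrite !cmonoX -!cmonoD; apply: cmono_eq; lia.
    rewrite !rmorphM !rmorphXn rmorphN !rmorphD rmorph1 /= /xy_poly bievalC poly_evalX bievalX.
    apply: congM => //; first exact: cong_refl.
    apply: congX => //; rewrite /cong opprK addrC; exact: Hplane.
  exists m => //; apply/eqP => m0; case: HP => _ + _; apply.
  have -> : 1 = cmono (- a%:Z) (- b%:Z) (- c%:Z) * cmono a b c.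
    by rewrite -cmonoD !addNr cmono0.
  by apply: PM; move: hM; rewrite m0 rmorph0 /cong subr0.
have constP g : exists c, cong P g (const0 c).
  have [a [b [c [q h]]]] := @xy_reduce K i j k l Hc P g PI Hplane.
  have [m m0 hm] := monoP a b c; have [x hx] := polyP q.
  exists (m^-1 * x).
  have h3 : cong P (const0 m * g) (const0 x).
    apply: (cong_trans PI) hx; apply: (cong_trans PI) h.
    by apply: congM => //; [exact: cong_sym|exact: cong_refl].
  have -> : g = const0 m^-1 * (const0 m * g).
    by rewrite mulrA -rmorphM mulVf // rmorph1 mul1r.
  by rewrite rmorphM; apply: congM => //; exact: cong_refl.
have [[c [hc hlt]] _] := krull_curve.
have [hsub hne] := hlt (@Ordinal 2 0 isT) (@Ordinal 2 1 isT) isT.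
apply: hne => x hx; have [a ha] := constP (repr x).
have xE : x = proj (spec_ideal P) (const0 a) by rewrite -[x]projK; apply/projP.
have [[c00 _ _] _ _] := hc (@Ordinal 2 0 isT).
have [[_ _ c1M] c11 _] := hc (@Ordinal 2 1 isT).
have [a0|a0] := eqVneq a 0.
  suff -> : x = 0 by [].
  by rewrite xE a0 rmorph0; apply/proj_eq0; case: PI.
case: c11; have := c1M (proj (spec_ideal P) (const0 a^-1)) _ hx.
by rewrite xE -proj_mul -rmorphM mulVf // rmorph1.
Qed.

Lemma curve_equation : exists f, chart_equation i j k l (curve_ideal Z) f.
Proof.
pose pp : set (bipoly K) := [set q | spec_set P (xy_poly q)].
have [_ P1 PM] := HP; have [P0 PD PMl] := PI.
have ppP : is_prime pp.
  split; first split.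
  - by rewrite /pp /= rmorph0.
  - by move=> x y hx hy; rewrite /pp /= rmorphD; apply: PD.
  - by move=> a x hx; rewrite /pp /= rmorphM; apply: PMl.
  - by rewrite /pp /= rmorph1.
  - by move=> x y; rewrite /pp /= rmorphM => /PM.
have [f [f0 hf hdvd]] := plane_prime_principal ppP curve_poly_neq0 curve_not_point.
by exists f; split.
Qed.

End CurveEquation.

(** * Newton polygons *)

(* The face of the Newton polygon of the support [S] on which p x + r y is
   minimal is an edge of lattice length [m] (a vertex if m = 0). *)
Definition newton_edge (S : rel nat) (p r : int) (m : nat) : Prop :=
  exists x0 y0 x1 y1 : nat,
    [/\ S x0 y0, S x1 y1,
        x1%:Z = x0%:Z - r * m%:Z /\ y1%:Z = y0%:Z + p * m%:Z,
        forall x y : nat, S x y -> p * x0%:Z + r * y0%:Z <= p * x%:Z + r * y%:Z &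
        forall x y : nat, S x y -> p * x%:Z + r * y%:Z = p * x0%:Z + r * y0%:Z ->
          exists n : nat, [/\ (n <= m)%N, x%:Z = x0%:Z - r * n%:Z & y%:Z = y0%:Z + p * n%:Z]].

Definition support2 (K : fieldType) (f : bipoly K) : rel nat :=
  fun x y => coef2 f x y != 0.

Section LowEdge.
Variables (K : fieldType) (i j k l : 'I_4).
Hypothesis Hc : is_chart i j k l.
Variables (p r u v om : int).
Hypothesis Hb : p * u + r * v = 1.
Hypotheses (Hom0 : om <= 0) (Homp : om <= p) (Homr : om <= r).
Variables (f : bipoly K) (W : int).
Hypothesis HW : forall x y : nat, coef2 f x y != 0 -> W <= p * x%:Z + r * y%:Z.
Local Notation h := (low (edge_bipoly p r u v f W)).

Lemma unimodular_solve (a b m : int) :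
  p * a + r * b = 0 -> - v * a + u * b = m -> a = - (r * m) /\ b = p * m.
Proof.
move=> h1 h2; split.
  transitivity ((p * u + r * v) * a); first by rewrite Hb mul1r.
  transitivity (u * (p * a + r * b) - r * (- v * a + u * b)); first ring.
  by rewrite h1 h2 mulr0 sub0r.
transitivity ((p * u + r * v) * b); first by rewrite Hb mul1r.
transitivity (v * (p * a + r * b) + p * (- v * a + u * b)); first ring.
by rewrite h1 h2 mulr0 add0r.
Qed.

(** Coefficients of the edge polynomial are indexed by the exponent of T. Raising it by 1 moves a
    point of the face line by (-r, p), so degree minus order is the lattice length. *)
Lemma low_newton_edge (n0 n1 : nat) : (n0 <= n1)%N -> h`_n0 != 0 -> h`_n1 != 0 ->
  (forall n, h`_n != 0 -> (n0 <= n <= n1)%N) -> newton_edge (support2 f) p r (n1 - n0).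
Proof.
move=> h01 h0 h1 hn.
have [x0 [y0 [c0 w0 t0]]] := low_edge_coefP Hc Hb Hom0 Homp Homr h0.
have [x1 [y1 [c1 w1 t1]]] := low_edge_coefP Hc Hb Hom0 Homp Homr h1.
have sol (x y n : nat) : (n0 <= n)%N -> p * x%:Z + r * y%:Z = W ->
    (shift_exp u v f)%:Z + (- v * x%:Z + u * y%:Z) = n%:Z ->
    x%:Z = x0%:Z - r * (n - n0)%N%:Z /\ y%:Z = y0%:Z + p * (n - n0)%N%:Z.
  move=> hn0 hw ht.
  have [||e1 e2] := @unimodular_solve (x%:Z - x0%:Z) (y%:Z - y0%:Z) (n - n0)%N%:Z.
  - by rewrite !mulrBr addrACA hw -opprD w0 subrr.
  - by rewrite -subzn // -ht -t0; ring.
  - by split; [rewrite -[x%:Z](subrK x0%:Z) e1 addrC|rewrite -[y%:Z](subrK y0%:Z) e2 addrC].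
exists x0, y0, x1, y1; split=> //.
- exact: sol.
- by move=> x y /HW; rewrite w0.
- move=> x y cxy hw; have hw' : p * x%:Z + r * y%:Z = W by rewrite hw.
  have hs := shift_exp_ge Hc Hb Hom0 Homp Homr cxy.
  have hN := esym (gez0_abs hs).
  have := low_edge_coef_neq0 Hc Hb Hom0 Homp Homr cxy hw' hN.
  set n := absz _ in hN * => hcoef.
  have /hn/andP[h2 h3] : h`_n != 0 by rewrite hcoef.
  exists (n - n0)%N; split; first exact: leq_sub2r.
    by have [] := sol x y n h2 hw' hN.
  by have [] := sol x y n h2 hw' hN.
Qed.

End LowEdge.

Section TropEdge.
Variables (K : closedFieldType) (R : realType) (i j k l : 'I_4).
Hypothesis Hc : is_chart i j k l.
Variables (p r u v om : int).
Hypothesis Hb : p * u + r * v = 1.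
Hypotheses (Hom0 : om <= 0) (Homp : om <= p) (Homr : om <= r).
Variables (Z : curve K) (s : ray).
Hypotheses (Hp : val s 0 i - val s 0 k = p) (Hr : val s 0 j - val s 0 k = r)
  (Hom : val s 0 l - val s 0 k = om).
Hypothesis Hplane : curve_ideal Z (plane_form K i j k l).
Variable f : bipoly K.
Hypothesis Hf : chart_equation i j k l (curve_ideal Z) f.

Lemma low_lam : low (lam_poly K p r u v om) =
  - ((if om == 0 then 'X^(lam_exp u v) else 0) +
     (if p == om then 'X^(absz ((lam_exp u v)%:Z - v)) else 0) +
     (if r == om then 'X^(absz ((lam_exp u v)%:Z + u)) else 0)).
Proof. by rewrite /lam_poly rmorphN !rmorphD /= !low_tz_mono !subr_eq0 oppr_eq0. Qed.

(** If exactly one of x_i, x_j, x_k attains the minimal weight together with x_l, then l1 is a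
    monomial up to sign and no nonzero root is lost. *)
Lemma trop_mult_edge :
  ((om == 0%R) + (p == om) + (r == om) = 1)%N -> newton_edge (support2 f) p r (trop_mult R Z s).
Proof.
move=> hone.
have [n hn] : exists n : nat, low (lam_poly K p r u v om) = - 'X^n.
  rewrite low_lam; move: hone; case: eqP => _; case: eqP => _; case: eqP => _ //= _;
    by eexists; rewrite ?addr0 ?add0r.
have l0 : low (lam_poly K p r u v om) != 0.
  by rewrite hn oppr_eq0 monic_neq0 // monicXn.
have [W [h [rs [hW eh h0 hrs ->]]]] := trop_multE R Hc Hb Hom0 Homp Homr Hp Hr Hom Hplane Hf l0.
have [n0 [n1 [h1 h2 h3 h4 h5]]] := nonzero_roots_count h0 hrs.
have -> : count (good (low (lam_poly K p r u v om))) rs = (n1 - n0)%N.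
  rewrite -h5; apply: eq_count => c; rewrite /good /= hn hornerN hornerXn oppr_eq0.
  by rewrite expf_eq0; case: (c == 0); rewrite ?andbF.
move: h2 h3 h4; rewrite eh => h2 h3 h4.
exact: (low_newton_edge Hc Hb Hom0 Homp Homr hW h1 h2 h3 h4).
Qed.

End TropEdge.

Lemma specialize_coef (K : fieldType) (c : K) (q : bipoly K) (y : nat) :
  (specialize c q)`_y = (q`_y).[c].
Proof.
elim/bipoly_ind: q y => [|q p IH] y; first by rewrite rmorph0 !coef0 horner0.
rewrite rmorphD rmorphM /= specialize_outX specialize_outer coefD coefMX coefC.
have -> : (q * outX K + outer p)`_y = (if y == 0 then 0 else q`_y.-1) + (if y == 0 then p else 0).
  by apply: etrans (coefD _ _ _) _; congr (_ + _); [exact: coefMX|exact: coefC].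
by case: y => [|y] /=; rewrite ?add0r ?addr0 // IH.
Qed.

Lemma coef2_0 (K : fieldType) (f : bipoly K) (y : nat) :
  coef2 f 0 y = (specialize 0 f)`_y.
Proof. by rewrite specialize_coef horner_coef0. Qed.

(* On the plane this exchanges the coordinates x_j / x_k and x_l / x_k. *)
Definition flip_poly (K : fieldType) : bipoly K -> bipoly K :=
  bieval (@bconst K) (inX K) (- (1 + inX K + outX K)).
HB.instance Definition _ (K : fieldType) := GRing.RMorphism.copy (@flip_poly K)
  (bieval (@bconst K) (inX K) (- (1 + inX K + outX K))).

Lemma specialize_flip (K : fieldType) (f : bipoly K) :
  specialize 0 (flip_poly f) = specialize 0 f \Po (- 1 - 'X).
Proof.
apply: (@bipoly_rmorph_ext _ _ (specialize 0 \o @flip_poly K)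
  (comp_poly (- 1 - 'X) \o specialize 0)) => [c||] /=.
- by rewrite /flip_poly bievalC poly_evalC !specialize_outer !hornerC comp_polyC.
- rewrite /flip_poly bievalC poly_evalX specialize_inX.
  by rewrite comp_polyC.
- rewrite /flip_poly bievalX rmorphN !rmorphD rmorph1 /= specialize_inX specialize_outX.
  by rewrite comp_polyX polyC0 addr0 opprD.
Qed.

Section CenterRay.
Variables (K : closedFieldType) (R : realType) (i j k l : 'I_4).
Hypothesis Hc : is_chart i j k l.
Variables (Z : curve K) (s : ray).
Hypotheses (Hp : val s 0 i - val s 0 k = 1) (Hr : val s 0 j - val s 0 k = 0)
  (Hom : val s 0 l - val s 0 k = 0).
Hypothesis Hplane : curve_ideal Z (plane_form K i j k l).
Variable f : bipoly K.
Hypothesis Hf : chart_equation i j k l (curve_ideal Z) f.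
Hypothesis Hf0 : specialize 0 f != 0.

Let Hb : (1 : int) * 1 + 0 * 0 = 1. Proof. by []. Qed.
Let H00 : (0 : int) <= 0. Proof. by []. Qed.
Let H01 : (0 : int) <= 1. Proof. by []. Qed.

(** Here T = Y and l1 = -T (1 + T), the third coordinate being -(1 + T) on the degenerate plane. The
    c roots T = -1 are lost; in the flipped coordinate -1 - Y they become an order of vanishing at 0
    on the line X = 0. *)
Lemma trop_mult_center : exists m c : nat,
  [/\ newton_edge (support2 f) 1 0 m, (trop_mult R Z s + c = m)%N, coef2 (flip_poly f) 0 c != 0 &
    forall y, (y < c)%N -> coef2 (flip_poly f) 0 y = 0].
Proof.
have hl : low (lam_poly K 1 0 1 0 0) = - ('X + 'X^2).
  by rewrite low_lam /= addr0.
have l0 : low (lam_poly K 1 0 1 0 0) != 0.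
  rewrite hl oppr_eq0; apply/eqP => /(congr1 (fun q : {poly K} => q`_1)).
  by rewrite coefD coefX coefXn coef0 /= addr0 => /eqP; rewrite oner_eq0.
have [W [h [rs [hW eh h0 hrs ->]]]] :=
  trop_multE R Hc Hb H00 H01 H00 Hp Hr Hom Hplane Hf l0.
have [n0 [n1 [h1 h2 h3 h4 h5]]] := nonzero_roots_count h0 hrs.
exists (n1 - n0)%N, (count_mem (- 1) rs).
have edge : newton_edge (support2 f) 1 0 (n1 - n0).
  move: h2 h3 h4; rewrite eh => h2 h3 h4.
  exact: (low_newton_edge Hc Hb H00 H01 H00 hW h1 h2 h3 h4).
(* By [Hf0] some term of f is free of X, so the minimal weight is 0 and the face lies in the column
   x = 0. *)
have W0 : W = 0.
  have [y hy] : exists y, coef2 f 0 y != 0.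
    exists (size (specialize 0 f)).-1.
    by rewrite coef2_0 -lead_coefE lead_coef_eq0.
  have := hW _ _ hy; move: h2; rewrite eh.
  by move=> /(low_edge_coefP Hc Hb H00 H01 H00)[x0 [y0 [_ e1 _]]]; lia.
subst W.
have hX : h = 'X^(shift_exp 1 0 f) * specialize 0 f.
  apply/polyP => n; rewrite coefXnM -coef2_0 eh.
  have none : (forall y : nat, coef2 f 0 y != 0 -> (shift_exp 1 0 f + y)%N <> n) ->
      (low (edge_bipoly 1 0 1 0 f 0))`_n = 0.
    move=> hn; apply: contrapT => /eqP/(low_edge_coefP Hc Hb H00 H01 H00)[x [y [c1 e1 e2]]].
    have x0 : x = 0%N by lia.
    apply: (hn y); first by move: c1; rewrite x0.
    have e3 : (shift_exp 1 0 f)%:Z + y%:Z = n%:Z by rewrite -e2; ring.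
    by move: e3; rewrite -PoszD => -[].
  case: ltnP => hn.
    by apply: none => y _ e; move: hn; rewrite -e ltnNge leq_addr.
  have [e0|e0] := eqVneq (coef2 f 0 (n - shift_exp 1 0 f)) 0.
    rewrite e0; apply: none => y hy en; move: hy.
    by rewrite -en addKn in e0; rewrite e0 eqxx.
  apply: (low_edge_coef_neq0 Hc Hb H00 H01 H00 e0); first by rewrite mulr0 mul0r.
  by rewrite oppr0 mul0r add0r mul1r -PoszD subnKC.
pose h' := lead_coef h *: \prod_(z <- rs | z != - 1) ('X - z%:P).
have hh' : h = ('X + 1) ^+ count_mem (- 1) rs * h'.
  by rewrite {1}hrs (prod_XsubC_count (- 1)) polyCN opprK polyC1 /h' -scalerAr.
have h'1 : h'.[- 1] != 0.
  rewrite hornerZ mulf_neq0 ?lead_coef_eq0 // horner_prod prodf_seq_neq0.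
  by apply/allP => z _; rewrite hornerXsubC subr_eq0 eq_sym; apply/implyP.
set c := count_mem (- 1) rs in hh' *; set A := shift_exp 1 0 f in hX.
(* Replacing T by -1 - T turns (T + 1)^c into (-T)^c. The factor (-1 - T)^A, left over from the
   shift of exponents, is prime to T. *)
have hcomp : (- 1 - 'X) ^+ A * specialize 0 (flip_poly f) =
    'X^c * ((-1) ^+ c * (h' \Po (- 1 - 'X))).
  have := congr1 (comp_poly (- 1 - 'X)) (etrans (esym hX) hh').
  rewrite !rmorphM !rmorphXn rmorphD rmorph1 /= comp_polyX -specialize_flip => ->.
  have -> : - 1 - 'X + 1 = (- 1) * 'X :> {poly K} by ring.
  by rewrite exprMn mulrA ['X^c * _]mulrC.
have copX : coprimep ('X^c) ((- 1 - 'X) ^+ A : {poly K}).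
  apply/coprimep_expl/coprimep_expr.
  have := coprimep_XsubC (- 1 - 'X : {poly K}) 0; rewrite polyC0 subr0 coprimep_sym => ->.
  by rewrite rootE hornerD !hornerN hornerX hornerC subr0 oppr_eq0 oner_eq0.
have [q hq] : exists q, specialize 0 (flip_poly f) = 'X^c * q.
  have : 'X^c %| specialize 0 (flip_poly f).
    by rewrite -(Gauss_dvdpr _ copX) hcomp dvdp_mulr.
  by move=> /dvdpP[q ->]; exists q; rewrite mulrC.
have q0 : q.[0] != 0.
  have X0 : 'X^c != 0 :> {poly K} by rewrite monic_neq0 // monicXn.
  move: hcomp; rewrite hq mulrCA => /(mulfI X0)/(congr1 (horner_eval 0)).
  rewrite !rmorphM !rmorphXn rmorphN rmorph1 /= /horner_eval horner_comp.
  rewrite !hornerD !hornerN hornerX hornerC subr0 => e1.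
  apply/eqP => e2; move/eqP: e1; rewrite e2 mulr0 eq_sym mulf_eq0 (negbTE h'1) orbF.
  by rewrite expf_eq0 oppr_eq0 oner_eq0 andbF.
split=> //.
- rewrite -h5 /c; set a := count _ rs; set b := count_mem _ rs.
  have -> : a = count (predI (predC1 0) (predC1 (- 1))) rs.
    apply: eq_count => z /=; rewrite /good hl hornerN hornerD hornerX hornerXn oppr_eq0.
    have -> : z + z ^+ 2 = z * (z + 1) by ring.
    by rewrite mulf_eq0 addr_eq0 negb_or; case: (z == 0).
  have -> : b = count (predI (predC1 0) (pred1 (- 1))) rs.
    by apply: eq_count => z /=; case: eqP => [->|_]; rewrite ?andbF // oppr_eq0 oner_eq0.
  have := count_predC (pred1 (- 1 : K)) (filter (predC1 0) rs).
  rewrite !count_filter size_filter addnC => <-.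
  by congr addn; apply: eq_count => z /=; exact: andbC.
- by rewrite coef2_0 hq coefXnM ltnn subnn -horner_coef0.
- by move=> y hy; rewrite coef2_0 hq coefXnM hy.
Qed.

End CenterRay.

(** * Counting the rows crossed by edges *)

Section NewtonRows.
Variable S : rel nat.

Definition face_min (p r : int) (x y : nat) : Prop :=
  S x y /\ forall x' y' : nat, S x' y' -> p * x%:Z + r * y%:Z <= p * x'%:Z + r * y'%:Z.

(* The edge with inner normal (p, r) crosses the row between j and j + 1. *)
Definition covers (p r : int) (j : nat) : bool :=
  `[< exists x y x' y' : nat, [/\ face_min p r x y, face_min p r x' y' & (y <= j < y')%N] >].

Lemma newton_edge_rows p r m : newton_edge S p r m -> 0 < p ->
  exists lo hi : nat, [/\ hi%:Z = lo%:Z + p * m%:Z, exists x, face_min p r x hi &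
    forall j, covers p r j = (lo <= j < hi)%N].
Proof.
move=> [x0 [y0 [x1 [y1 [s0 s1 [ex ey] hmin hface]]]]] p0.
have m0 : face_min p r x0 y0 by [].
have w1 : p * x1%:Z + r * y1%:Z = p * x0%:Z + r * y0%:Z by rewrite ex ey; ring.
have m1 : face_min p r x1 y1 by split=> // x' y' /hmin; rewrite w1.
exists y0, y1; split=> //; first by exists x1.
move=> j; apply/asboolP/idP => [[x [y [x' [y' [[h1 h2] [h1' h2'] /andP[hj hj']]]]]]|hj].
  have e1 : p * x%:Z + r * y%:Z = p * x0%:Z + r * y0%:Z.
    by apply/eqP; rewrite eq_le h2 // hmin.
  have e2 : p * x'%:Z + r * y'%:Z = p * x0%:Z + r * y0%:Z.
    by apply/eqP; rewrite eq_le h2' // hmin.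
  have [n [_ _ hy]] := hface _ _ h1 e1; have [n' [hn' _ hy']] := hface _ _ h1' e2.
  have i1 : 0 <= p * n%:Z by rewrite mulr_ge0 // ltW.
  have i2 : p * n'%:Z <= p * m%:Z by rewrite ler_pM2l.
  lia.
by exists x0, y0, x1, y1.
Qed.

(** The two minimality inequalities, scaled by p' and p so that the abscissas cancel, add up to the
    claim. *)
Lemma face_min_mono p r p' r' x y x' y' : 0 <= p -> 0 <= p' ->
  face_min p r x y -> face_min p' r' x' y' ->
  0 <= (p * r' - p' * r) * (y%:Z - y'%:Z).
Proof.
move=> p0 p0' [s1 /(_ _ _) h1] [s2 h2].
have i1 := ler_wpM2l p0' (h1 _ _ s2); have i2 := ler_wpM2l p0 (h2 _ _ s1).
rewrite -subr_ge0 in i1; rewrite -subr_ge0 in i2.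
have -> : (p * r' - p' * r) * (y%:Z - y'%:Z) =
  (p' * (p * x'%:Z + r * y'%:Z) - p' * (p * x%:Z + r * y%:Z)) +
  (p * (p' * x%:Z + r' * y%:Z) - p * (p' * x'%:Z + r' * y'%:Z)) by ring.
exact: addr_ge0.
Qed.

(** Comparing the lower end of one edge with the upper end of the other, in both ways, gives the
    determinant p r' - p' r both signs. *)
Lemma covers_unique p r p' r' j : 0 < p -> 0 < p' ->
  covers p r j -> covers p' r' j -> p * r' = p' * r.
Proof.
move=> /ltW p0 /ltW p0' /asboolP[x1 [y1 [x2 [y2 [h1 h2 /andP[j1 j2]]]]]].
move=> /asboolP[x3 [y3 [x4 [y4 [h3 h4 /andP[j3 j4]]]]]].
have i1 := face_min_mono p0 p0' h1 h4; have i2 := face_min_mono p0 p0' h2 h3.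
have c1 : y1%:Z - y4%:Z < 0 by lia.
have c2 : 0 < y2%:Z - y3%:Z by lia.
apply/eqP; rewrite -subr_eq0 eq_le.
by rewrite -(pmulr_lge0 _ c2) i2 -(nmulr_lge0 _ c1) i1.
Qed.

Lemma sum_interval (lo hi N : nat) :
  (\sum_(j < N) (lo <= j < hi) = minn hi N - minn lo N)%N.
Proof.
elim: N => [|N IH]; first by rewrite big_ord0 !minn0.
rewrite big_ord_recr /= IH; case: leqP => h1; case: ltnP => h2 /=; lia.
Qed.

Section Counting.
Variables (T : eqType) (ss : seq T) (p : T -> nat) (r : T -> int) (m : T -> nat).
Hypothesis Hss : forall s, s \in ss ->
  (0 < p s)%N /\ newton_edge S (p s) (r s) (m s).

(** Double counting of the incidences between edges and rows: every row has at least one, and an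
    edge has at most p m. *)
Lemma edges_cover N :
  (forall j, (j < N)%N -> exists2 s, s \in ss & covers (p s) (r s) j) ->
  (N <= \sum_(s <- ss) p s * m s)%N.
Proof.
move=> hcov; apply: (@leq_trans (\sum_(s <- ss) \sum_(j < N) covers (p s) (r s) j)).
  rewrite exchange_big /= -[X in (X <= _)%N]card_ord -sum1_card.
  apply: leq_sum => j _; have [s hs hc] := hcov j (ltn_ord j).
  by rewrite (big_rem s) //= hc.
rewrite !big_seq; apply: leq_sum => s /Hss[p0 he].
have [lo [hi [e1 _ e2]]] := newton_edge_rows he p0.
under eq_bigr do rewrite e2.
rewrite sum_interval; move: e1; rewrite -PoszM -PoszD => -[->]; lia.
Qed.

(** The reverse count: edges with non-proportional normals share no row, and the height bound
    ensures that all p m rows of an edge are among the first N. *)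
Lemma edges_disjoint N : uniq ss ->
  {in ss &, forall s s', (p s)%:Z * r s' = (p s')%:Z * r s -> s = s'} ->
  (forall s x y, s \in ss -> face_min (p s) (r s) x y -> (y <= N)%N) ->
  (\sum_(s <- ss) p s * m s <= N)%N.
Proof.
move=> us inj hN; apply: (@leq_trans (\sum_(s <- ss) \sum_(j < N) covers (p s) (r s) j)).
  rewrite !big_seq; apply: leq_sum => s hs; have [p0 he] := Hss hs.
  have [lo [hi [e1 [x hx] e2]]] := newton_edge_rows he p0.
  under eq_bigr do rewrite e2.
  have := hN _ _ _ hs hx.
  by rewrite sum_interval; move: e1; rewrite -PoszM -PoszD => -[->]; lia.
rewrite exchange_big /= -[X in (_ <= X)%N]card_ord -[X in (_ <= X)%N]sum1_card.
apply: leq_sum => j _.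
have [/hasP[s hs hc]|/hasPn hno] := boolP (has (fun s => covers (p s) (r s) j) ss).
  rewrite (big_rem s) //= hc big_seq big1 ?addn0 // => s' hs'.
  have hs'' : s' \in ss := mem_rem hs'.
  apply/eqP; rewrite eqb0; apply/negP => hc'.
  have [p0 _] := Hss hs; have [p0' _] := Hss hs''.
  have e1 : s = s' by apply: inj => //; exact: covers_unique hc hc'.
  by move: hs'; rewrite (mem_rem_uniq _ us) inE e1 eqxx.
by rewrite big_seq big1 // => s /hno /negbTE ->.
Qed.

End Counting.
End NewtonRows.

Section RowCrossing.
Variables (S : rel nat) (pts : seq (nat * nat)).
Hypothesis Hpts : forall x y, S x y = ((x, y) \in pts).

(* The edge crossing height j + 1/2 is spanned by the pair of points below and
   above this height whose segment crosses it furthest to the left. *)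
Lemma covers_exists (j : nat) :
  (exists x y, S x y /\ (y <= j)%N) -> (exists x y, S x y /\ (j < y)%N) ->
  exists p r u v : int, [/\ 0 < p, p * u + r * v = 1 & covers S p r j].
Proof.
move=> [xl [yl [sl hl]]] [xu [yu [su hu]]].
(* [c] is the height j + 1/2, and [X] the abscissa where the segment joining a pair crosses it. *)
pose c : rat := j%:R + 2%:R^-1.
pose X (a : (nat * nat) * (nat * nat)) : rat :=
  (a.1.1%:R * (a.2.2%:R - c) + a.2.1%:R * (c - a.1.2%:R)) / (a.2.2%:R - a.1.2%:R).
pose pairs := [seq a <- [seq (a, b) | a <- pts, b <- pts] | (a.1.2 <= j < a.2.2)%N].
have pairsP x y x' y' : ((x, y), (x', y')) \in pairs = [&& S x y, S x' y' & (y <= j < y')%N].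
  rewrite mem_filter /= !Hpts andbC [RHS]andbA; congr (_ && _).
  apply/allpairsP/andP => [[[a b] /= [h1 h2 [-> ->]]] //|[h1 h2]].
  by exists ((x, y), (x', y')).
have cle (y : nat) : (y <= j)%N -> (y%:R : rat) < c.
  by move=> h; apply: (@le_lt_trans _ _ j%:R); rewrite ?ler_nat // /c ltrDl invr_gt0 ltr0n.
have cge (y : nat) : (j < y)%N -> c < (y%:R : rat).
  move=> h; apply: (@lt_le_trans _ _ j.+1%:R); last by rewrite ler_nat.
  by rewrite /c -[j.+1]addn1 natrD ltrD2l invf_lt1 ?ltr0n // ltr1n.
have [|[[x y] [x' y']] hmin Xmin] := @seq_min _ _ _ X pairs.
  apply/eqP => e; have : ((xl, yl), (xu, yu)) \in pairs by rewrite pairsP sl su hl.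
  by rewrite e.
move: hmin; rewrite pairsP => /and3P[s1 s2 /andP[hy hy']].
pose p0 := y'%:Z - y%:Z; pose r0 := x%:Z - x'%:Z.
have p00 : 0 < p0 by rewrite /p0; lia.
have w12 : p0 * x'%:Z + r0 * y'%:Z = p0 * x%:Z + r0 * y%:Z by rewrite /p0 /r0; ring.
(* A support point beyond the line, paired with the end of the segment on the other side of the row,
   would cross further to the left. *)
have hface x2 y2 : S x2 y2 -> p0 * x%:Z + r0 * y%:Z <= p0 * x2%:Z + r0 * y2%:Z.
  move=> s3; rewrite leNgt; apply/negP => hlt.
  have hltQ : ((y'%:R - y%:R) * x2%:R + (x%:R - x'%:R) * y2%:R : rat) <
      (y'%:R - y%:R) * x%:R + (x%:R - x'%:R) * y%:R.
    by move: hlt; rewrite -(ltr_int rat) /p0 /r0 !(rmorphD, rmorphM, rmorphN) /= -!pmulrn.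
  have y_c := cle _ hy; have c_y' := cge _ hy'.
  have y_y' : (0 : rat) < y'%:R - y%:R by rewrite subr_gt0 (lt_trans y_c).
  case: (leqP y2 j) => h2.
    have y2_c := cle _ h2.
    have y2_y' : (0 : rat) < y'%:R - y2%:R by rewrite subr_gt0 (lt_trans y2_c).
    have /Xmin : ((x2, y2), (x', y')) \in pairs by rewrite pairsP s3 s2 h2 hy'.
    rewrite /X /= leNgt => /negP; apply.
    rewrite ltr_pdivrMr // mulrAC ltr_pdivlMr // -subr_gt0.
    move: hltQ; rewrite -subr_gt0 => hltQ.
    have c1 : 0 < y'%:R - c by rewrite subr_gt0.
    have := mulr_gt0 c1 hltQ; apply: etrans; congr (_ < _); ring.
  have c_y2 := cge _ h2.
  have y_y2 : (0 : rat) < y2%:R - y%:R by rewrite subr_gt0 (lt_trans y_c).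
  have /Xmin : ((x, y), (x2, y2)) \in pairs by rewrite pairsP s1 s3 hy h2.
  rewrite /X /= leNgt => /negP; apply.
  rewrite ltr_pdivrMr // mulrAC ltr_pdivlMr // -subr_gt0.
  move: hltQ; rewrite -subr_gt0 => hltQ.
  have c1 : 0 < c - y%:R by rewrite subr_gt0.
  have := mulr_gt0 c1 hltQ; apply: etrans; congr (_ < _); ring.
(* Dividing the normal by its gcd makes it primitive and turns this identity into the required
   one. *)
have [u [v huv]] := Bezoutz p0 r0.
set g := gcdz p0 r0 in huv.
have g0 : 0 < g by rewrite lt_def gcdz_eq0 negb_and gt_eqF //= gcdz_ge0.
have [p ep] := dvdzP (dvdz_gcdl p0 r0); have [r er] := dvdzP (dvdz_gcdr p0 r0).
rewrite -/g in ep er.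
have face_scale x2 y2 x3 y3 : p0 * x2%:Z + r0 * y2%:Z <= p0 * x3%:Z + r0 * y3%:Z ->
    p * x2%:Z + r * y2%:Z <= p * x3%:Z + r * y3%:Z.
  rewrite ep er; have e4 (a b : int) : p * g * a + r * g * b = g * (p * a + r * b) by ring.
  by rewrite !e4 ler_pM2l.
exists p, r, u, v; split.
- by move: p00; rewrite ep pmulr_lgt0.
- have gn0 : g != 0 by rewrite gt_eqF.
  apply: (mulIf gn0); rewrite mul1r -[RHS]huv ep er; ring.
apply/asboolP; exists x, y, x', y'; split; last by rewrite hy hy'.
- by split=> // x2 y2 /hface; exact: face_scale.
- by split=> // x2 y2 /hface h; apply: face_scale; rewrite w12.
Qed.

End RowCrossing.

(** * Changes of chart and rays *)

Local Notation o0 := (@Ordinal 4 0 isT).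
Local Notation o1 := (@Ordinal 4 1 isT).
Local Notation o2 := (@Ordinal 4 2 isT).
Local Notation o3 := (@Ordinal 4 3 isT).

Lemma plane_form_mem (K : fieldType) (i j k l : 'I_4) (Hc : is_chart i j k l) :
  plane_ideal0 (plane_form K i j k l).
Proof.
have e : val (plane_form K i j k l) = monom 1 (- delta_mx 0 k) * \sum_x lvar K x.
  have -> : val (plane_form K i j k l) = monom 1 0 + monom 1 (chart_exp i j k l 1 0 0) +
      monom 1 (chart_exp i j k l 0 1 0) + monom 1 (chart_exp i j k l 0 0 1) by [].
  have e (x : 'I_4) : monom 1 (- delta_mx 0 k) * lvar K x = monom 1 (delta_mx 0 x - delta_mx 0 k).
    by rewrite [LHS]ga_mulUU mulr1 addrC.
  have -> : monom 1 (- delta_mx 0 k) * \sum_x lvar K x =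
      \sum_x (monom 1 (delta_mx 0 x - delta_mx 0 k) : laurent K).
    by rewrite mulr_sumr; apply: eq_bigr => x _; exact: e.
  rewrite (sum_chart Hc).
  have -> : chart_exp i j k l 1 0 0 = delta_mx 0 i - delta_mx 0 k by apply/rowP => x; rewrite !mxE; ring.
  have -> : chart_exp i j k l 0 1 0 = delta_mx 0 j - delta_mx 0 k by apply/rowP => x; rewrite !mxE; ring.
  have -> : chart_exp i j k l 0 0 1 = delta_mx 0 l - delta_mx 0 k by apply/rowP => x; rewrite !mxE; ring.
  have -> : delta_mx 0 k - delta_mx 0 k = 0 :> 'rV[int]_4 by apply/rowP => x; rewrite !mxE; ring.
  have key (V : zmodType) (x y z t : V) : x + y + z + t = y + z + x + t
    by rewrite [x + y]addrC [y + x + z]addrAC.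
  exact: key.
suff : ideal_set (plane_ideal K) (val (plane_form K i j k l)) by [].
rewrite e.
move=> J [[_ _ hM] hJ]; apply: hM; exact: hJ.
Qed.

Lemma bipoly_cong (K : fieldType) (A : comNzRingType) (J : set A)
    (phi psi : {rmorphism bipoly K -> A}) : is_ideal J ->
  (forall c, cong J (phi (bconst c)) (psi (bconst c))) ->
  cong J (phi (inX K)) (psi (inX K)) -> cong J (phi (outX K)) (psi (outX K)) ->
  forall q, cong J (phi q) (psi q).
Proof.
move=> hJ hc hX hY; have ref := cong_refl hJ.
have hin (a : {poly K}) : cong J (phi (outer a)) (psi (outer a)).
  elim/poly_ind: a => [|a c IH]; first by rewrite !rmorph0; exact: ref.
  by rewrite !(rmorphD, rmorphM) /=; apply: congD => //; [apply: congM|exact: hc].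
elim/bipoly_ind => [|q a IH]; first by rewrite !rmorph0; exact: ref.
by rewrite !rmorphD !rmorphM; apply: congD => //; apply: congM.
Qed.

Section ChartTransfer.
Variables (K : fieldType) (i j k l i' j' k' l' : 'I_4) (P : set (laurent0 K)).
Hypothesis PI : is_ideal P.
Variables (a b a' b' : bipoly K).
Local Notation sg := (bieval (@bconst K) a b).
Local Notation ta := (bieval (@bconst K) a' b').
Hypotheses (Ha : sg a' = inX K) (Hb : sg b' = outX K).
Hypotheses (Ha' : ta a = inX K) (Hb' : ta b = outX K).
Hypotheses
  (HX : cong P (xy_poly i' j' k' l' a) (cmono K i j k l 1 0 0))
  (HY : cong P (xy_poly i' j' k' l' b) (cmono K i j k l 0 1 0)).

(** The substitutions are mutually inverse and agree with the change of coordinates modulo P, so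
    divisibility by f is tested after the inverse substitution. *)
Lemma chart_transfer f : chart_equation i j k l P f ->
  chart_equation i' j' k' l' P (sg f).
Proof.
have sgta q : sg (ta q) = q by rewrite bieval_comp Ha Hb bieval_id.
have tasg q : ta (sg q) = q by rewrite bieval_comp Ha' Hb' bieval_id.
have hcong q : cong P (xy_poly i' j' k' l' (sg q)) (xy_poly i j k l q).
  apply: (bipoly_cong (phi := xy_poly i' j' k' l' \o sg) (psi := xy_poly i j k l) PI) => /=.
  - move=> c; rewrite /xy_poly /bconst !(bievalC, poly_evalC); exact: cong_refl.
  - by rewrite /inX bievalC poly_evalX {2}/xy_poly bievalC poly_evalX.
  - by rewrite bievalX {2}/xy_poly bievalX.
move=> [f0 Pf hdvd]; split.
- by apply: contraNneq f0 => e; rewrite -(tasg f) e rmorph0.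
- exact: (cong_mem PI (hcong f)).
- move=> q hq; have [q' e] : exists q', ta q = f * q'.
    apply: hdvd; have := hcong (ta q); rewrite (sgta q) => hq1.
    exact: (cong_mem PI (cong_sym PI hq1)).
  by exists (sg q'); rewrite -rmorphM -e /= sgta.
Qed.

End ChartTransfer.

Section ChartFacts.
Variables (K : fieldType) (i j k l : 'I_4) (P : set (laurent0 K)).
Hypothesis HP : is_prime P.
Variable f : bipoly K.
Hypothesis Hf : chart_equation i j k l P f.

(** A monomial is a unit of the torus, so the cofactor g lies in P and f divides g; cancelling f
    makes q invertible among polynomials. Thus neither coordinate divides f. *)
Lemma chart_equation_unit q g (a b : int) : xy_poly i j k l q = cmono K i j k l a b 0 ->
  f = q * g -> exists g', 1 = q * g'.
Proof.
have [PI P1 PM] := HP; have [f0 Pf hdvd] := Hf => hq e.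
have : P (xy_poly i j k l g).
  have := Pf; rewrite e rmorphM /= hq => /PM[hm|//]; case: P1.
  have <- : cmono K i j k l (- a) (- b) 0 * cmono K i j k l a b 0 = 1.
    by rewrite -cmonoD !addNr addr0 cmono0.
  by case: PI => _ _; apply.
move=> /hdvd[g' eg]; exists g'; apply: (mulfI f0).
by rewrite mulr1 mulrCA -eg -e.
Qed.

Lemma chart_low_neq0 : low f != 0.
Proof.
apply/eqP => h; have [q] := bipoly_low f; rewrite h rmorph0 add0r => e.
have [|g' /(congr1 (@low K))] := chart_equation_unit (q := outX K) (a := 0) (b := 1) _ e.
  by rewrite /xy_poly bievalX.
by rewrite rmorph1 rmorphM /= low_outX mul0r => /eqP; rewrite oner_eq0.
Qed.

Lemma chart_specialize_neq0 : specialize 0 f != 0.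
Proof.
apply/eqP => /specialize_eq0[q]; rewrite subr0 => e.
have [|g' /(congr1 (specialize 0))] := chart_equation_unit (q := inX K) (a := 1) (b := 0) _ e.
  by rewrite /xy_poly /inX bievalC poly_evalX.
by rewrite rmorph1 rmorphM /= specialize_inX mul0r => /eqP; rewrite oner_eq0.
Qed.

Lemma chart_support_low : exists x, coef2 f x 0 != 0.
Proof.
exists (size (low f)).-1; rewrite /coef2 -lowE -lead_coefE lead_coef_eq0.
exact: chart_low_neq0.
Qed.

End ChartFacts.

Section PlaneCharts.
Variables (K : fieldType) (P : set (laurent0 K)).
Hypothesis HP : is_prime P.
Hypothesis Hplane : @plane_ideal0 K `<=` P.
Variable f : bipoly K.
Hypothesis Hf : chart_equation o2 o0 o3 o1 P f.

Let PI : is_ideal P. Proof. by case: HP. Qed.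

Lemma cmono_chart (i j k l i' j' k' l' : 'I_4) a b c a' b' c' :
  chart_exp i j k l a b c = chart_exp i' j' k' l' a' b' c' ->
  cmono K i j k l a b c = cmono K i' j' k' l' a' b' c'.
Proof. by move=> e; apply: val_inj; rewrite /= e. Qed.

Lemma plane_cong i j k l (Hc : is_chart i j k l) :
  cong P (- (1 + cmono K i j k l 1 0 0 + cmono K i j k l 0 1 0)) (cmono K i j k l 0 0 1).
Proof.
rewrite /cong -opprD; apply: (ideal_opp PI).
by apply: Hplane; exact: (plane_form_mem Hc).
Qed.

Lemma chart_equation_flip : chart_equation o2 o1 o3 o0 P (flip_poly f).
Proof.
have hfl : bieval (@bconst K) (inX K) (- (1 + inX K + outX K)) (- (1 + inX K + outX K)) = outX K.
  rewrite rmorphN !rmorphD rmorph1 /= bievalX [inX K in X in _ + X]/inX bievalC poly_evalX.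
  ring.
have hX : bieval (@bconst K) (inX K) (- (1 + inX K + outX K)) (inX K) = inX K.
  by rewrite {2}/inX bievalC poly_evalX.
apply: (chart_transfer PI hX hfl hX hfl _ _ Hf).
  rewrite /xy_poly {1}/inX bievalC poly_evalX.
  have -> : cmono K o2 o1 o3 o0 1 0 0 = cmono K o2 o0 o3 o1 1 0 0; last exact: cong_refl.
  by apply: cmono_chart; apply/rowP => x; rewrite !mxE; ring.
rewrite rmorphN !rmorphD rmorph1 /= /xy_poly bievalX /inX bievalC poly_evalX.
have -> : cmono K o2 o0 o3 o1 0 1 0 = cmono K o2 o1 o3 o0 0 0 1.
  by apply: cmono_chart; apply/rowP => x; rewrite !mxE; ring.
by apply: plane_cong.
Qed.

Definition corner_poly : bipoly K :=
  bieval (@bconst K) (- (1 + inX K + outX K)) (inX K) f.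

Lemma chart_equation_corner : chart_equation o0 o1 o3 o2 P corner_poly.
Proof.
have eX a b : bieval (@bconst K) a b (inX K) = a.
  by rewrite /inX bievalC poly_evalX.
have eY a b : bieval (@bconst K) a b (outX K) = b by rewrite bievalX.
have eL a b : bieval (@bconst K) a b (- (1 + inX K + outX K)) = - (1 + a + b).
  by rewrite rmorphN !rmorphD rmorph1 /= eX eY.
apply: (chart_transfer (a' := outX K) (b' := - (1 + inX K + outX K)) PI _ _ _ _ _ _ Hf).
- exact: eY.
- rewrite eL; ring.
- rewrite eL; ring.
- exact: eX.
- rewrite rmorphN !rmorphD rmorph1 /= /xy_poly bievalX /inX bievalC poly_evalX.
  have -> : cmono K o2 o0 o3 o1 1 0 0 = cmono K o0 o1 o3 o2 0 0 1.
    by apply: cmono_chart; apply/rowP => x; rewrite !mxE; ring.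
  by apply: plane_cong.
- rewrite /xy_poly /inX bievalC poly_evalX.
  have -> : cmono K o0 o1 o3 o2 1 0 0 = cmono K o2 o0 o3 o1 0 1 0; last exact: cong_refl.
  by apply: cmono_chart; apply/rowP => x; rewrite !mxE; ring.
Qed.

End PlaneCharts.

Lemma ray_ge0 (s : ray) i : 0 <= val s 0 i.
Proof. by have /and3P[/forallP h _ _] := valP s. Qed.

(** As [om] is 0, p or r, the gcd of p and r divides all coordinate differences of the ray, and
    primitivity forces it to be 1. *)
Lemma ray_unimodular (s : ray) (i j k l : 'I_4) (p r om : int) : is_chart i j k l ->
  val s 0 i - val s 0 k = p -> val s 0 j - val s 0 k = r -> val s 0 l - val s 0 k = om ->
  (om == 0) || (om == p) || (om == r) -> exists u v, p * u + r * v = 1.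
Proof.
move=> Hc Hp Hr Hom hom; have /and3P[_ _ /asboolP hprim] := valP s.
have [a ha] : exists a, p = a * gcdz p r by case/dvdzP: (dvdz_gcdl p r) => a; exists a.
have [b hb] : exists b, r = b * gcdz p r by case/dvdzP: (dvdz_gcdr p r) => b; exists b.
have hg (z : int) : z *+ absz (gcdz p r) = z * gcdz p r by rewrite -mulr_natr natz gez0_abs.
have [c hc] : exists c, om = c * gcdz p r.
  by case/orP: hom => [/orP[]|] /eqP ->; [exists 0; rewrite mul0r|exists a|exists b].
pose w : 'rV[int]_4 := a *: delta_mx 0 i + b *: delta_mx 0 j + c *: delta_mx 0 l.
have e1 : absz (gcdz p r) = 1%N.
  apply: (hprim _ w); exists (val s 0 k); apply/rowP => x; rewrite !mxE mulmxnE !mxE /=.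
  rewrite hg.
  case/or4P: (chartP Hc x) => /eqP ->; rewrite !(chart_neqE Hc, eqxx) /=
    ?mulr0 ?mulr1 ?addr0 ?add0r ?mul0r -?ha -?hb -?hc -?Hp -?Hr -?Hom ?subrK //.
have [u [v huv]] := Bezoutz p r.
by exists u, v; rewrite mulrC [r * v]mulrC huv -[LHS]gez0_abs ?e1.
Qed.

Lemma is_ray_unimodular (v : 'rV[int]_4) (i j k : 'I_4) (a b : int) :
  (forall x, 0 <= v 0 x) -> v 0 k = 0 -> v 0 i * a + v 0 j * b = 1 -> is_ray v.
Proof.
move=> v0 vk hab; apply/and3P; split.
- exact/forallP.
- by apply/existsP; exists k; rewrite vk.
- apply/asboolP => n w [c e].
  have hx x : v 0 x = n%:Z * (w 0 x - w 0 k).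
    have hn (z : int) : z *+ n = n%:Z * z by rewrite -mulr_natl natz.
    have := vk; rewrite e !mxE !mulmxnE !hn => hk.
    by rewrite mulrBr -[RHS]addr0 -hk addrA subrK.
  have /(congr1 absz) : n%:Z * ((w 0 i - w 0 k) * a + (w 0 j - w 0 k) * b) = 1.
    by rewrite -hab !hx; ring.
  by rewrite abszM => /eqP; rewrite muln_eq1 => /andP[/eqP].
Qed.

Lemma unimodular_proportional (p r u v p' r' u' v' : int) :
  0 < p -> 0 < p' -> p * u + r * v = 1 -> p' * u' + r' * v' = 1 ->
  p * r' = p' * r -> p = p' /\ r = r'.
Proof.
move=> p0 p0' h h' e.
have e1 : p' = p * (p' * u + r' * v) by rewrite mulrDr [p * (r' * v)]mulrA e -[LHS]mulr1 -h; ring.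
have e2 : p = p' * (p * u' + r * v') by rewrite mulrDr [p' * (r * v')]mulrA -e -[LHS]mulr1 -h'; ring.
have hdvd : (p %| p')%Z by apply/dvdzP; exists (p' * u + r' * v); rewrite mulrC.
have hdvd' : (p' %| p)%Z by apply/dvdzP; exists (p * u' + r * v'); rewrite mulrC.
have epp : p = p'.
  have : (absz p == absz p')%N by rewrite eqn_dvd -!dvdzE hdvd hdvd'.
  by move=> /eqP; lia.
by split=> //; apply/esym/(mulfI (lt0r_neq0 p0)); rewrite e epp.
Qed.

Section RayEdge.
Variables (K : closedFieldType) (R : realType) (i j k l : 'I_4).
Hypothesis Hc : is_chart i j k l.
Variables (Z : curve K) (s : ray) (p r om : int).
Hypothesis Hplane : @plane_ideal0 K `<=` curve_ideal Z.
Hypotheses (Hp : val s 0 i - val s 0 k = p) (Hr : val s 0 j - val s 0 k = r)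
  (Hom : val s 0 l - val s 0 k = om).
Variable f : bipoly K.
Hypothesis Hf : chart_equation i j k l (curve_ideal Z) f.

Lemma ray_edge : om <= 0 -> om <= p -> om <= r ->
  ((om == 0%R) + (p == om) + (r == om) = 1)%N ->
  newton_edge (support2 f) p r (trop_mult R Z s).
Proof.
move=> h0 hp hr h1.
have [u [v huv]] : exists u v, p * u + r * v = 1.
  apply: (ray_unimodular Hc Hp Hr Hom).
  by move: h1; rewrite ![_ == om]eq_sym; do 3!case: eqP.
exact: (trop_mult_edge R Hc huv h0 hp hr Hp Hr Hom (Hplane (plane_form_mem Hc)) Hf h1).
Qed.

End RayEdge.

Lemma in_open_coneE (i j k l : 'I_4) (v : 'rV[int]_4) : is_chart i j k l ->
  in_open_cone i j v = [&& 0 < v 0 i, 0 < v 0 j, v 0 k == 0 & v 0 l == 0].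
Proof.
move=> Hc; rewrite /in_open_cone; congr [&& _, _ & _].
apply/eqP/andP => [e|[/eqP ek /eqP el]].
  by rewrite e !mxE !(chart_neqE Hc) /= !mulr0 addr0.
apply/rowP => x; rewrite !mxE.
by case/or4P: (chartP Hc x) => /eqP ->; rewrite ?ek ?el !(chart_neqE Hc, eqxx) /=
  ?mulr0 ?mulr1 ?addr0 ?add0r.
Qed.

Lemma ray_row4 (a b c d : int) : is_ray (row4 a b c d) ->
  exists s : ray, [/\ val s 0 o0 = a, val s 0 o1 = b, val s 0 o2 = c & val s 0 o3 = d].
Proof. by move=> h; exists (exist (fun v => is_ray v) _ h); split; rewrite mxE. Qed.

Lemma ray_ext (s t : ray) :
  [/\ val s 0 o0 = val t 0 o0, val s 0 o1 = val t 0 o1, val s 0 o2 = val t 0 o2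
    & val s 0 o3 = val t 0 o3] -> s = t.
Proof.
case=> h0 h1 h2 h3; apply: val_inj; apply/rowP => x.
have /or4P[] := @chartP o0 o1 o2 o3 isT x; by move=> /eqP ->.
Qed.

Lemma covers_pos S p r m j : newton_edge S p r m -> 0 < p -> covers S p r j -> (0 < m)%N.
Proof.
move=> he p0; have [lo [hi [e1 _ ->]]] := newton_edge_rows he p0.
by case: m e1 {he} => // e1; lia.
Qed.

Lemma is_ray_0010 : is_ray (row4 0 0 1 0).
Proof.
apply: (@is_ray_unimodular _ o2 o2 o0 1 0); rewrite ?mxE //.
by move=> x; have /or4P[] := @chartP o0 o1 o2 o3 isT x; move=> /eqP ->; rewrite mxE.
Qed.

Definition ray0010 : ray := exist (fun v => is_ray v) _ is_ray_0010.

(** * The inequality for an irreducible curve *)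

Section CurveBounds.
Variables (K : closedFieldType) (R : realType) (Z : curve K).
Hypothesis Hplane : @plane_ideal0 K `<=` curve_ideal Z.
Variable f : bipoly K.
Hypothesis Hf : chart_equation o2 o0 o3 o1 (curve_ideal Z) f.
Variable S : seq ray.
Hypothesis HS : forall s, (0 < trop_mult R Z s)%N -> s \in S.
Local Notation mZ := (trop_mult R Z).
Local Notation HP := (specP (val Z)).

Let low_cone (s : ray) : bool :=
  in_open_cone o0 o2 (val s) || in_open_cone o2 o3 (val s) && (val s 0 o3 < val s 0 o2).

Lemma low_cone_coords s : low_cone s -> [/\ 0 < val s 0 o2 - val s 0 o3, val s 0 o1 = 0,
  ((0 < val s 0 o0) && (val s 0 o3 == 0)) || ((0 < val s 0 o3) && (val s 0 o0 == 0)) & s != ray0010].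
Proof.
rewrite /low_cone (@in_open_coneE o0 o2 o1 o3) // (@in_open_coneE o2 o3 o0 o1) //.
move=> h; have hne : s != ray0010.
  by apply/eqP => e; move: h; rewrite e /= !mxE.
by case/orP: h => [/and4P[h1 h2 /eqP h3 /eqP h4]|/andP[/and4P[h1 h2 /eqP h3 /eqP h4] h5]];
  split; rewrite ?h3 ?h4 ?eqxx ?andbT ?h1 ?h2 ?orbT //; lia.
Qed.

Lemma low_cone_edge s : low_cone s ->
  newton_edge (support2 f) (val s 0 o2 - val s 0 o3) (val s 0 o0 - val s 0 o3) (mZ s).
Proof.
move=> /low_cone_coords[h1 h2 h3 _].
apply: (@ray_edge _ R o2 o0 o3 o1 _ Z s _ _ _ Hplane erefl erefl erefl _ Hf) => //; rewrite h2; lia.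
Qed.

(** Every row below deg_Y f is crossed by an edge on the left, and its primitive normal comes from
    (0,0,1,0) or from a ray in [low_cone]. At (0,0,1,0) the lattice length [m0] is used, since the
    multiplicity may be smaller. *)
Lemma rows_covered m0 : newton_edge (support2 f) 1 0 m0 ->
  ((size f).-1 <= m0 + \sum_(s <- S | low_cone s) absz (val s 0 o2 - val s 0 o3)%R * mZ s)%N.
Proof.
move=> he2.
have hval : [/\ val ray0010 0 o0 = 0, val ray0010 0 o1 = 0, val ray0010 0 o2 = 1 & val ray0010 0 o3 = 0].
  by split; rewrite mxE.
have [v0 v1 v2 v3] := hval.
have Hss s : s \in ray0010 :: [seq s <- S | low_cone s] ->
    (0 < absz (val s 0 o2 - val s 0 o3)%R)%N /\
    newton_edge (support2 f) (absz (val s 0 o2 - val s 0 o3)%R) (val s 0 o0 - val s 0 o3)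
      (if s == ray0010 then m0 else mZ s).
  rewrite inE; case: eqVneq => [-> _|hne /=].
    by rewrite v0 v2 v3.
  rewrite mem_filter => /andP[hA _]; have [p0 _ _ _] := low_cone_coords hA.
  by split; [rewrite absz_gt0 lt0r_neq0|rewrite gtz0_abs //; exact: low_cone_edge].
have := edges_cover Hss (N := (size f).-1); rewrite big_cons eqxx v2 v3 mul1n big_filter.
have -> : (\sum_(s <- S | low_cone s) absz (val s 0 o2 - val s 0 o3)%R *
    (if s == ray0010 then m0 else mZ s) =
  \sum_(s <- S | low_cone s) absz (val s 0 o2 - val s 0 o3)%R * mZ s)%N.
  by apply: eq_bigr => s /low_cone_coords[_ _ _ /negbTE ->].
apply=> j hj; have [pts Hpts] := coef2_finite f.
have [f0 _ _] := Hf.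
have [xl hl] := chart_support_low HP Hf; have [xu hu] := coef2_lead f0.
have [||p [r [u [v [p0 huv hcov]]]]] := @covers_exists (support2 f) pts Hpts j.
- by exists xl, 0%N.
- by exists xu, (size f).-1.
have inS s : low_cone s -> p = val s 0 o2 - val s 0 o3 -> r = val s 0 o0 - val s 0 o3 ->
    exists2 s, s \in ray0010 :: [seq s <- S | low_cone s] &
      covers (support2 f) (absz (val s 0 o2 - val s 0 o3)%R) (val s 0 o0 - val s 0 o3) j.
  move=> hA ep er; exists s; last by rewrite -ep -er gtz0_abs.
  rewrite inE mem_filter hA HS ?orbT //.
  by have := low_cone_edge hA; rewrite -ep -er => /covers_pos -/(_ _ p0 hcov).
have hchart (x : 'I_4) := @chartP o0 o1 o2 o3 isT x.
(* The ray is (0, 0, p - r, -r) for r < 0 and (r, 0, p, 0) for r > 0; for r = 0 unimodularity gives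
   p = 1. *)
have [r0|r0|r0] := ltgtP r 0.
- have [|s [s0 s1 s2 s3]] := @ray_row4 0 0 (p - r) (- r).
    apply: (@is_ray_unimodular _ o2 o3 o0 u (- u - v)); rewrite ?mxE //=; last by rewrite -huv; ring.
    by move=> x; case/or4P: (hchart x) => /eqP ->; rewrite mxE /=; lia.
  by apply: (inS s); rewrite /low_cone ?(@in_open_coneE o2 o3 o0 o1) ?s0 ?s1 ?s2 ?s3 //; lia.
- have [|s [s0 s1 s2 s3]] := @ray_row4 r 0 p 0.
    apply: (@is_ray_unimodular _ o2 o0 o1 u v); rewrite ?mxE //=.
    by move=> x; case/or4P: (hchart x) => /eqP ->; rewrite mxE /=; lia.
  by apply: (inS s); rewrite /low_cone ?(@in_open_coneE o0 o2 o1 o3) ?s0 ?s1 ?s2 ?s3 //; lia.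
- exists ray0010; first by rewrite inE eqxx.
  have e1 : p = 1.
    move: huv; rewrite r0 mul0r addr0 => /(congr1 absz); rewrite abszM => /eqP.
    by rewrite muln_eq1 => /andP[/eqP]; lia.
  by move: hcov; rewrite e1 r0 v0 v2 v3.
Qed.

(** The column x = 0 of the flipped polygon starts at height c, so the left edges below this height
    slope towards it and have normals with two positive entries. Such normals belong to the open
    cone 12. *)
Lemma flip_rows_covered c : coef2 (flip_poly f) 0 c != 0 ->
  (forall y, (y < c)%N -> coef2 (flip_poly f) 0 y = 0) ->
  (c <= \sum_(s <- S | in_open_cone o1 o2 (val s)) absz (val s 0 o2)%R * mZ s)%N.
Proof.
move=> hc hlt; have Hg := chart_equation_flip HP Hplane Hf.
set g := flip_poly f in hc hlt Hg.
have Hss s : s \in [seq s <- S | in_open_cone o1 o2 (val s)] ->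
    (0 < absz (val s 0 o2)%R)%N /\
    newton_edge (support2 g) (absz (val s 0 o2)%R) (val s 0 o1) (mZ s).
  rewrite mem_filter (@in_open_coneE o1 o2 o0 o3) // => /andP[/and4P[h1 h2 /eqP h0 /eqP h3] _].
  split; first by rewrite absz_gt0 lt0r_neq0.
  rewrite gtz0_abs //.
  apply: (@ray_edge _ R o2 o1 o3 o0 _ Z s _ _ 0 Hplane _ _ _ _ Hg) => //;
    rewrite ?h3 ?h0 ?subr0 // ?ltW // ?eqxx (gt_eqF h2) (gt_eqF h1) //.
rewrite -big_filter; apply: (edges_cover Hss) => j hj; have [pts Hpts] := coef2_finite g.
have [xl hl] := chart_support_low HP Hg.
have [||p [r [u [v [p0 huv hcov]]]]] := @covers_exists (support2 g) pts Hpts j.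
- by exists xl, 0%N.
- by exists 0%N, c.
(* The lower end (x, y) has y < c, hence x > 0; comparing its weight with that of (0, c) gives 0 < p
   x <= r (c - y). *)
have r0 : 0 < r.
  have /asboolP[x [y [x' [y' [[hxy hmin] _ /andP[hy _]]]]]] := hcov.
  have := hmin _ _ hc; have hyc : (y < c)%N := leq_ltn_trans hy hj.
  have x0 : (0 < x)%N.
    by case: x hxy {hmin} => // /negP[]; apply/eqP/hlt.
  rewrite mulr0 add0r -lerBrDr -mulrBr => h.
  have h1 : 0 < p * x%:Z by rewrite pmulr_rgt0.
  have h2 := lt_le_trans h1 h.
  by rewrite -(pmulr_lgt0 _ (x := c%:Z - y%:Z)) //; lia.
have [|s [s0 s1 s2 s3]] := @ray_row4 0 r p 0.
  apply: (@is_ray_unimodular _ o2 o1 o0 u v); rewrite ?mxE //=.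
  by move=> x; case/or4P: (@chartP o0 o1 o2 o3 isT x) => /eqP ->; rewrite mxE /=; lia.
exists s; last by rewrite s1 s2 gtz0_abs.
have hA : in_open_cone o1 o2 (val s).
  by rewrite (@in_open_coneE o1 o2 o0 o3) ?s0 ?s1 ?s2 ?s3 ?eqxx ?p0 ?r0.
rewrite mem_filter hA HS //.
have he : newton_edge (support2 g) p r (mZ s).
  apply: (@ray_edge _ R o2 o1 o3 o0 _ Z s _ _ 0 Hplane _ _ _ _ Hg) => //;
    rewrite ?s0 ?s1 ?s2 ?s3 ?subr0 //; lia.
exact: covers_pos he p0 hcov.
Qed.

(* [C . D] is the sum over the rays s of C of
   C(s) (cone_defect s - corner_min s), the first term being
   s_2 - min(s_2, s_3) on the open cone 23 and s_2 elsewhere. *)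
Definition cone_defect (s : ray) : nat :=
  if in_open_cone o2 o3 (val s) then (absz (val s 0 o2)%R - absz (val s 0 o3)%R)%N
  else absz (val s 0 o2)%R.

(** The two conditions on the left exclude each other, and where one of them holds its summand
    equals the right-hand side. *)
Lemma defect_terms (a b c d : int) (m : nat) : 0 <= a -> 0 <= b -> 0 <= c -> 0 <= d ->
  ((if [&& 0 < b, 0 < c, a == 0 & d == 0]%R then absz c * m else 0) +
   (if [&& 0 < a, 0 < c, b == 0 & d == 0]%R || [&& 0 < c, 0 < d, a == 0 & b == 0]%R && (d < c)%R
    then absz (c - d)%R * m else 0) <=
   m * (if [&& 0 < c, 0 < d, a == 0 & b == 0]%R then absz c - absz d else absz c))%N.
Proof.
case: a => // a _; case: b => // b _; case: c => // c _; case: d => // d _.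
case: a => [|a]; case: b => [|b]; case: c => [|c]; case: d => [|d] //=;
  rewrite ?subr0 ?mul0n ?muln0 ?addn0 ?add0n //=; try by rewrite mulnC.
case: ifP => // hdc; rewrite mulnC leq_mul2l orbC subzn ?leqnn //; exact: ltnW hdc.
Qed.

(** [rows_covered] accounts for the cones 02 and 23 and for the lattice length at (0,0,1,0), which
    exceeds the multiplicity by c; this excess is paid for by the cone 12 through
    [flip_rows_covered]. *)
Lemma size_le_defect :
  ((size f).-1 <= \sum_(s <- S) mZ s * cone_defect s)%N.
Proof.
have [m0 [c [he2 hm0 hc hlt]]] : exists m c : nat,
    [/\ newton_edge (support2 f) 1 0 m, (mZ ray0010 + c = m)%N, coef2 (flip_poly f) 0 c != 0 &
      forall y, (y < c)%N -> coef2 (flip_poly f) 0 y = 0].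
  apply: (@trop_mult_center _ R o2 o0 o3 o1 _ Z ray0010 _ _ _ _ f Hf); rewrite ?mxE //.
  - exact: (Hplane (plane_form_mem (isT : is_chart o2 o0 o3 o1))).
  - exact: (chart_specialize_neq0 HP Hf).
apply: leq_trans (rows_covered he2) _; rewrite -hm0.
have h12 := flip_rows_covered hc hlt.
apply: leq_trans (leq_add (leq_add (leqnn _) h12) (leqnn _)) _.
have he : (mZ ray0010 <= \sum_(s <- S | s == ray0010) mZ s)%N.
  have [->//|m0'] := eqVneq (mZ ray0010) 0%N.
  have hs : ray0010 \in S by apply: HS; rewrite lt0n.
  by rewrite (big_rem _ hs) /= eqxx leq_addr.
apply: leq_trans (leq_add (leq_add he (leqnn _)) (leqnn _)) _.
rewrite (big_mkcond (fun s => s == ray0010)) (big_mkcond (fun s => in_open_cone o1 o2 (val s))).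
rewrite (big_mkcond low_cone) -!big_split /=; apply: leq_sum => s _.
have s2 := ray_ge0 s o2; have s3 := ray_ge0 s o3.
rewrite /cone_defect /low_cone (@in_open_coneE o0 o2 o1 o3) // (@in_open_coneE o1 o2 o0 o3) //
  (@in_open_coneE o2 o3 o0 o1) //.
have [->|_] := eqVneq s ray0010.
  by rewrite /= !mxE /= muln1 !addn0.
rewrite add0n; apply: defect_terms => //; exact: ray_ge0.
Qed.

End CurveBounds.

Lemma newton_edge_swap (S : rel nat) p r m :
  newton_edge S p r m -> newton_edge (fun x y => S y x) r p m.
Proof.
move=> [x0 [y0 [x1 [y1 [s0 s1 [ex ey] hmin hface]]]]].
exists y1, x1, y0, x0; split=> //.
- by rewrite ex ey; split; ring.
- move=> x y /hmin h; rewrite [leRHS]addrC.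
  have -> // : r * y1%:Z + p * x1%:Z = p * x0%:Z + r * y0%:Z.
  by rewrite ex ey; ring.
- move=> x y hS; rewrite [LHS]addrC => e.
  have [|n [hn hx hy]] := hface y x hS.
    by rewrite e ex ey; ring.
  exists (m - n)%N; rewrite -subzn // hx hy ex ey leq_subr; split=> //; ring.
Qed.

(** Two weights differ by p times the difference of the degrees plus (r - p) times that of the
    heights. For y > y1 neither term is negative, so on a face both vanish; then p = r and the
    degrees agree, against [y' <= y1]. *)
Lemma corner_face_bound (S : rel nat) (x1 y1 : nat) (p r : int) (x y : nat) :
  0 < p -> p <= r -> S x1 y1 -> (forall x' y', S x' y' -> (x1 + y1 <= x' + y')%N) ->
  (p = r -> forall x' y', S x' y' -> (x' + y' = x1 + y1)%N -> (y' <= y1)%N) ->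
  face_min S p r x y -> (y <= y1)%N.
Proof.
move=> p0 pr h1 hdeg hmax [hS /(_ _ _ h1) hmin]; rewrite leqNgt; apply/negP => hy.
have e : (p * x%:Z + r * y%:Z) - (p * x1%:Z + r * y1%:Z) =
  p * ((x + y)%N%:Z - (x1 + y1)%N%:Z) + (r - p) * (y%:Z - y1%:Z) by rewrite !PoszD; ring.
have i1 : 0 <= p * ((x + y)%N%:Z - (x1 + y1)%N%:Z).
  by apply: mulr_ge0; [exact: ltW|rewrite subr_ge0; exact: hdeg].
have i2 : 0 <= (r - p) * (y%:Z - y1%:Z).
  by apply: mulr_ge0; rewrite subr_ge0 //; exact: ltW.
have i3 : p * ((x + y)%N%:Z - (x1 + y1)%N%:Z) + (r - p) * (y%:Z - y1%:Z) <= 0.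
  by rewrite -e subr_le0.
have e1 : p * ((x + y)%N%:Z - (x1 + y1)%N%:Z) = 0 by lia.
have e2 : (r - p) * (y%:Z - y1%:Z) = 0 by lia.
have epr : p = r.
  move/eqP: e2; rewrite mulf_eq0 => /orP[|]; rewrite subr_eq0; first by move/eqP.
  by move=> /eqP[] e2; rewrite e2 ltnn in hy.
have exy : (x + y = x1 + y1)%N.
  by move/eqP: e1; rewrite mulf_eq0 gt_eqF //= subr_eq0 => /eqP[].
by have := hmax epr _ _ hS exy; rewrite leqNgt hy.
Qed.

(** * The cone 01 and the least degree of the corner equation *)

Section CornerBound.
Variables (K : closedFieldType) (R : realType) (Z : curve K).
Hypothesis Hplane : @plane_ideal0 K `<=` curve_ideal Z.
Variable f : bipoly K.
Hypothesis Hf : chart_equation o2 o0 o3 o1 (curve_ideal Z) f.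
Local Notation mZ := (trop_mult R Z).
Local Notation HP := (specP (val Z)).
Local Notation g := (corner_poly f).

Lemma corner_edge (s : ray) : in_open_cone o0 o1 (val s) ->
  newton_edge (support2 g) (val s 0 o0) (val s 0 o1) (mZ s).
Proof.
rewrite (@in_open_coneE o0 o1 o2 o3) // => /and4P[h0 h1 /eqP h2 /eqP h3].
have Hg := chart_equation_corner HP Hplane Hf.
apply: (@ray_edge _ R o0 o1 o3 o2 _ Z s _ _ 0 Hplane _ _ _ _ Hg) => //;
  rewrite ?h2 ?h3 ?subr0 // ?ltW // ?eqxx ?(gt_eqF h0) ?(gt_eqF h1) //.
Qed.

Lemma corner_proportional (s t : ray) : in_open_cone o0 o1 (val s) -> in_open_cone o0 o1 (val t) ->
  val s 0 o0 * val t 0 o1 = val t 0 o0 * val s 0 o1 -> s = t.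
Proof.
rewrite !(@in_open_coneE o0 o1 o2 o3) // => /and4P[h0 h1 /eqP h2 /eqP h3].
move=> /and4P[h0' h1' /eqP h2' /eqP h3'] e.
have uni (w : ray) : val w 0 o2 = 0 -> val w 0 o3 = 0 ->
    exists u v, val w 0 o0 * u + val w 0 o1 * v = 1.
  by move=> e2 e3; apply: (@ray_unimodular w o0 o1 o3 o2 _ _ 0); rewrite ?e2 ?e3 ?subr0.
have [u [v huv]] := uni s h2 h3; have [u' [v' huv']] := uni t h2' h3'.
have [e0 e1] := unimodular_proportional h0 h0' huv huv' e.
by apply: ray_ext; rewrite h2 h3 h2' h3'.
Qed.

(** (x1, y1) is a term of least degree and, among these, of least x, hence of greatest y. Rays with
    s_0 <= s_1 have their edges in the rows below y1, where they cross s_0 rows per unit of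
    multiplicity; rays with s_1 < s_0 have theirs in the columns left of x1. The choice of x1
    settles the diagonal normal (1, 1), counted with the rows. *)
Lemma corner_bound (S : seq ray) : uniq S -> exists x1 y1 : nat,
  [/\ coef2 g x1 y1 != 0, forall x y, coef2 g x y != 0 -> (x1 + y1 <= x + y)%N &
  (\sum_(s <- S | in_open_cone o0 o1 (val s))
     minn (absz (val s 0 o0)%R) (absz (val s 0 o1)%R) * mZ s <= x1 + y1)%N].
Proof.
move=> uS; have [g0 _ _] := chart_equation_corner HP Hplane Hf.
have [pts hpts] := coef2_finite g; have [xn hn] := coef2_lead g0.
have pts0 : pts != [::] by apply/eqP => e; move: hn; rewrite hpts e.
have [[xa ya] ha hmina] := seq_min (fun a : nat * nat => (a.1 + a.2)%N) pts0.
have pts1 : [seq a <- pts | (a.1 + a.2 == xa + ya)%N] != [::].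
  by rewrite -has_filter; apply/hasP; exists (xa, ya).
have [[x1 y1]] := seq_min (fun a : nat * nat => a.1) pts1.
rewrite mem_filter => /andP[/eqP e1 h1] hminx.
have hdeg x y : coef2 g x y != 0 -> (x1 + y1 <= x + y)%N.
  by rewrite hpts [(x1 + y1)%N]e1 => /hmina.
have c1 : coef2 g x1 y1 != 0 by rewrite hpts.
clear h1.
exists x1, y1; split=> //.
have hmax x y : coef2 g x y != 0 -> (x + y = x1 + y1)%N -> (y <= y1)%N.
  rewrite hpts => hxy e; have := hminx (x, y).
  by rewrite mem_filter hxy /= e e1 eqxx => /(_ isT) h; move: e h; rewrite /= leEnat; lia.
rewrite (bigID (fun s : ray => val s 0 o0 <= val s 0 o1)) /= addnC.
apply: leq_add.
  set B := fun s : ray => in_open_cone o0 o1 (val s) && ~~ (val s 0 o0 <= val s 0 o1).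
  have hB s : s \in [seq s <- S | B s] -> [/\ in_open_cone o0 o1 (val s), 0 < val s 0 o0, 0 < val s 0 o1
      & val s 0 o1 < val s 0 o0].
    rewrite mem_filter /B -ltNge => /andP[/andP[h ->] _]; split=> //; by case/and3P: h.
  have -> : (\sum_(s <- S | B s) minn (absz (val s 0 o0)%R) (absz (val s 0 o1)%R) * mZ s =
     \sum_(s <- [seq s <- S | B s]) absz (val s 0 o1)%R * mZ s)%N.
    rewrite big_filter big_seq_cond [RHS]big_seq_cond; apply: eq_bigr => s /andP[hs hb].
    have [|_ h0 h1 h] := hB s; first by rewrite mem_filter hb hs.
    by congr (_ * _)%N; apply/minn_idPr; rewrite -lez_nat !gtz0_abs // ltW.
  apply: (@edges_disjoint (fun x y => support2 g y x) _ _ (fun s : ray => absz (val s 0 o1)%R)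
    (fun s : ray => val s 0 o0)).
  - move=> s /hB[h h0 h1 _]; rewrite absz_gt0 gt_eqF // gtz0_abs //.
    by split=> //; apply: newton_edge_swap; exact: corner_edge.
  - exact: filter_uniq.
  - move=> s t /hB[h h0 h1 _] /hB[h' h0' h1' _]; rewrite !gtz0_abs // => e.
    by apply: corner_proportional; rewrite // mulrC -e mulrC.
  - move=> s x y /hB[_ h0 h1 h]; rewrite gtz0_abs //.
    apply: (@corner_face_bound _ y1 x1) => //; first exact: ltW.
      by move=> x' y' /hdeg; rewrite addnC [(y' + x')%N]addnC.
    by move=> e; rewrite e ltxx in h.
set B := fun s : ray => in_open_cone o0 o1 (val s) && (val s 0 o0 <= val s 0 o1).
have hB s : s \in [seq s <- S | B s] -> [/\ in_open_cone o0 o1 (val s), 0 < val s 0 o0, 0 < val s 0 o1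
    & val s 0 o0 <= val s 0 o1].
  rewrite mem_filter /B => /andP[/andP[h ->] _]; split=> //; by case/and3P: h.
have -> : (\sum_(s <- S | B s) minn (absz (val s 0 o0)%R) (absz (val s 0 o1)%R) * mZ s =
   \sum_(s <- [seq s <- S | B s]) absz (val s 0 o0)%R * mZ s)%N.
  rewrite big_filter big_seq_cond [RHS]big_seq_cond; apply: eq_bigr => s /andP[hs hb].
  have [|_ h0 h1 h] := hB s; first by rewrite mem_filter hb hs.
  by congr (_ * _)%N; apply/minn_idPl; rewrite -lez_nat !gtz0_abs.
apply: (@edges_disjoint (support2 g) _ _ (fun s : ray => absz (val s 0 o0)%R)
  (fun s : ray => val s 0 o1)).
- move=> s /hB[h h0 h1 _]; rewrite absz_gt0 gt_eqF // gtz0_abs //.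
  by split=> //; exact: corner_edge.
- exact: filter_uniq.
- move=> s t /hB[h h0 h1 _] /hB[h' h0' h1' _]; rewrite !gtz0_abs // => e.
  exact: corner_proportional.
- move=> s x y /hB[_ h0 h1 h]; rewrite gtz0_abs //.
  by apply: (@corner_face_bound _ x1 y1).
Qed.

Lemma corner_degree (mu : nat) : specialize (-1) f != 0 ->
  (forall x y, coef2 g x y != 0 -> (mu <= x + y)%N) -> (mu <= (size f).-1)%N.
Proof.
move=> hf hmu.
(* As g(X, Y) = f(-1 - X - Y, X), setting Y = -X gives f(-1, X). Its order is at least [mu] and its
   degree at most deg_Y f. *)
have e : bieval polyC 'X (- 'X) g = specialize (-1) f.
  rewrite /corner_poly bieval_comp rmorphN !rmorphD rmorph1 /= bievalX /inX bievalC poly_evalX.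
  by have -> : - (1 + 'X - 'X) = (-1)%:P :> {poly K} by rewrite addrK polyCN.
have hX (y : nat) : ((size f) <= y)%N -> (specialize (-1) f)`_y = 0.
  by move=> h; rewrite specialize_coef nth_default // horner0.
have hlow (y : nat) : (y < mu)%N -> (specialize (-1) f)`_y = 0.
  move=> hy; rewrite -e bievalE coef_sum big1 // => b _; rewrite coef_sum big1 // => a _.
  have -> : polyC (g`_b)`_a * 'X ^+ a * (- 'X) ^+ b = ((-1) ^+ b * (g`_b)`_a) *: 'X^(a + b) :> {poly K}.
    rewrite [(- 'X) ^+ b]exprNn exprD -mul_polyC polyCM polyC_exp polyCN polyC1; ring.
  rewrite coefZ coefXn; case: eqP => [ey|_]; last by rewrite mulr0.
  have [e0|/hmu h] := eqVneq (coef2 g a b) 0.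
    by rewrite [_`_a]e0 mulr0 mul0r.
  by move: hy; rewrite ey ltnNge h.
rewrite leqNgt; apply: contra hf => h; apply/eqP/polyP => y; rewrite coef0.
have [|h'] := ltnP y mu; first exact: hlow.
apply: hX; apply: leq_trans h'; exact: leq_trans (leqSpred _) h.
Qed.

End CornerBound.

Lemma newton_edge_gt0 (S : rel nat) p r m x y x' y' : newton_edge S p r m ->
  face_min S p r x y -> face_min S p r x' y' -> (x, y) != (x', y') -> (0 < m)%N.
Proof.
move=> [x0 [y0 [x1 [y1 [s0 s1 [ex ey] hmin hface]]]]] [h1 h2] [h1' h2'] hne.
rewrite lt0n; apply: contra hne => /eqP m0; rewrite m0 in hface.
have [|n [+ hx hy]] := hface x y h1; first by apply/eqP; rewrite eq_le h2 // hmin.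
rewrite leqn0 => /eqP n0.
have [|n' [+ hx' hy']] := hface x' y' h1'; first by apply/eqP; rewrite eq_le h2' // hmin.
rewrite leqn0 => /eqP n0'; rewrite n0 n0' !mulr0 ?subr0 ?addr0 in hx hy hx' hy'.
by case: hx hy hx' hy' => -> [->] [->] [->].
Qed.

Section CurveInequality.
Variables (K : closedFieldType) (R : realType) (Z : curve K).
Hypothesis Hplane : @plane_ideal0 K `<=` curve_ideal Z.
Local Notation mZ := (trop_mult R Z).
Local Notation HP := (specP (val Z)).

Definition line_poly : bipoly K := outer ('X - (- 1)%:P).

(** Here f is X + 1 times q. If q were in the prime, f would divide q and X + 1 would be invertible,
    which fails at X = -1. *)
Lemma chart_equation_line f : chart_equation o2 o0 o3 o1 (curve_ideal Z) f ->
  specialize (-1) f = 0 -> chart_equation o2 o0 o3 o1 (curve_ideal Z) line_poly.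
Proof.
have [PI P1 PM] := HP; move=> [f0 Pf hdvd] /specialize_eq0[q e].
have l0 : line_poly != 0.
  by apply: contraNneq f0 => l0; rewrite e [outer _]l0 mul0r.
have [Pl|Pq] : curve_ideal Z (xy_poly o2 o0 o3 o1 line_poly) \/ curve_ideal Z (xy_poly o2 o0 o3 o1 q).
  by apply: PM; rewrite -rmorphM -e.
- split=> // q' /hdvd[q'' ->]; exists (q * q''); by rewrite mulrA -e.
- have [q' eq'] := hdvd _ Pq; case/eqP: f0.
  have hq : q = q * (line_poly * q') by rewrite mulrCA mulrA -[line_poly * q]e.
  suff q0 : q = 0 by rewrite e q0 mulr0.
  apply: contrapT => /eqP q0; have /(mulfI q0) : q * 1 = q * (line_poly * q') by rewrite mulr1.
  move=> /(congr1 (specialize (-1))); rewrite rmorph1 rmorphM /= specialize_outer.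
  by rewrite hornerXsubC subrr mul0r => /eqP; rewrite oner_eq0.
Qed.

Lemma corner_line : corner_poly line_poly = (- ('X%:P + 'X) : {poly {poly K}}).
Proof.
rewrite /corner_poly /line_poly bievalC rmorphB /= poly_evalX poly_evalC.
rewrite rmorphN rmorph1 /inX /outX /outer; ring.
Qed.

Hypothesis Hl : chart_equation o2 o0 o3 o1 (curve_ideal Z) line_poly.

(** The corner equation of the line is -(X + Y), whose Newton polygon is a segment with normal (1,
    1). *)
Lemma line_mult1100 : (0 < mZ ray1100)%N.
Proof.
have := corner_edge R Hplane Hl (s := ray1100).
rewrite (@in_open_coneE o0 o1 o2 o3) // !mxE /= => /(_ isT) he.
have hS x y : support2 (corner_poly line_poly) x y = ((x + y)%N == 1%N).
  rewrite /support2 /coef2 corner_line coefN coefD coefC coefX.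
  case: y => [|[|y]] /=; rewrite ?addr0 ?add0r coefN ?coefX ?coefC ?coef0 oppr_eq0.
  - by rewrite addn0; case: (x == 1%N); rewrite /= ?oner_eq0 ?eqxx.
  - by rewrite addn1; case: x => [|x] /=; rewrite ?oner_eq0 ?eqxx.
  - by rewrite if_same eqxx !addnS.
apply: (newton_edge_gt0 (x := 1%N) (y := 0%N) (x' := 0%N) (y' := 1%N) he) => //;
  by split=> [|x' y']; rewrite hS // => /eqP h; lia.
Qed.

(** The Newton polygon of X + 1 is the segment from (0, 0) to (1, 0), all of which is minimal for
    the normal (0, -1) of this ray. *)
Lemma line_mult0011 : (0 < mZ ray0011)%N.
Proof.
have he : newton_edge (support2 line_poly) 0 (-1) (mZ ray0011).
  by apply: (@ray_edge _ R o2 o0 o3 o1 _ Z ray0011 _ _ (-1) Hplane _ _ _ _ Hl); rewrite ?mxE.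
have hS x y : support2 line_poly x y = (y == 0%N) && (x <= 1)%N.
  rewrite /support2 /coef2 [_`_y]coefC; case: (y == 0%N) => /=; last first.
    by apply/negbTE; rewrite negbK; apply/eqP; exact: coef0.
  rewrite coefB coefX coefC.
  by case: x => [|[|x]] /=; rewrite ?opprK ?add0r ?subr0 ?oner_eq0 ?eqxx // oppr0 eqxx.
apply: (newton_edge_gt0 (x := 1%N) (y := 0%N) (x' := 0%N) (y' := 0%N) he) => //;
  by split=> [|x' y']; rewrite hS // => /andP[/eqP -> _]; lia.
Qed.

End CurveInequality.

Definition corner_min (s : ray) : nat :=
  if in_open_cone o0 o1 (val s) then minn (absz (val s 0 o0)%R) (absz (val s 0 o1)%R) else 0.

Lemma curve_inequality (K : closedFieldType) (R : realType) (Z : curve K) (S : seq ray) :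
  @plane_ideal0 K `<=` curve_ideal Z -> uniq S ->
  (forall s, (0 < trop_mult R Z s)%N -> s \in S) ->
  (\sum_(s <- S) trop_mult R Z s * corner_min s <=
   \sum_(s <- S) trop_mult R Z s * cone_defect s +
   minn (trop_mult R Z ray1100) (trop_mult R Z ray0011))%N.
Proof.
move=> Hplane uS HS.
have Hc : is_chart o2 o0 o3 o1 by [].
have frac_inj : injective (@tofrac {poly K}).
  by move=> q1 q2 /eqP; rewrite tofrac_eq => /eqP.
have [f Hf] := curve_equation Hc (Hplane _ (plane_form_mem Hc)) frac_inj.
have hsum f' (Hf' : chart_equation o2 o0 o3 o1 (curve_ideal Z) f') : exists x1 y1 : nat,
    [/\ coef2 (corner_poly f') x1 y1 != 0,
     forall x y, coef2 (corner_poly f') x y != 0 -> (x1 + y1 <= x + y)%N &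
     (\sum_(s <- S) trop_mult R Z s * corner_min s <= x1 + y1)%N].
  have [x1 [y1 [h1 h2 h3]]] := corner_bound R Hplane Hf' uS; exists x1, y1; split=> //.
  apply: leq_trans h3; rewrite [X in (_ <= X)%N]big_mkcond /=; apply: leq_sum => s _.
  by rewrite /corner_min; case: ifP; rewrite ?muln0 // mulnC.
have [h|h] := eqVneq (specialize (-1) f) 0.
  have Hl := chart_equation_line Hf h.
  have hm : (1 <= minn (trop_mult R Z ray1100) (trop_mult R Z ray0011))%N.
    by rewrite leq_min line_mult1100 // line_mult0011.
  (* The term -Y of the corner equation bounds the sum by 1, which [hm] absorbs. *)
  have [x1 [y1 [_ hmin hs]]] := hsum _ Hl.
  apply: leq_trans hs _; apply: leq_trans (leq_trans hm (leq_addl _ _)); apply: (hmin 0%N 1%N).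
  by rewrite /coef2 corner_line coefN coefD coefC coefX /= add0r coefN coefC /= oppr_eq0 oner_eq0.
have [x1 [y1 [_ hmin hs]]] := hsum _ Hf.
apply: leq_trans hs (leq_trans _ (leq_addr _ _)).
apply: leq_trans (size_le_defect Hplane Hf HS).
exact: (corner_degree h hmin).
Qed.

(** * Intersection with the line D *)

Lemma int_mulrn (z : int) (n : nat) : z *+ n = n%:Z * z.
Proof. by rewrite -mulr_natl natz. Qed.

Lemma minz_absz (a b : int) : 0 <= a -> 0 <= b ->
  Num.min a b = (minn (absz a) (absz b))%:Z.
Proof. by case: a b => // a [] // b _ _ /=; rewrite minEle lez_nat /minn; case: ltngtP => // ->. Qed.

Lemma subz_min (a b : int) : 0 <= a -> 0 <= b ->
  a - Num.min a b = (absz a - absz b)%N%:Z.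
Proof.
case: a b => // a [] // b _ _; rewrite minz_absz //= minnE subzn ?leq_subr // subKn //.
exact: leq_subr.
Qed.

Lemma lineD_inner (R : realType) (i j k l : 'I_4) (v : 'rV[int]_4) : is_chart i j k l ->
  \sum_(w <- tropP (lineD R) | in_open_cone i j w) Num.min (v 0 i * w 0 j) (v 0 j * w 0 i) =
  \sum_(w <- [:: row4 1 1 0 0; row4 0 0 1 1] | [&& 0 < w 0 i, 0 < w 0 j, w 0 k == 0 & w 0 l == 0])
    Num.min (v 0 i * w 0 j) (v 0 j * w 0 i).
Proof.
move=> Hc; rewrite (perm_big _ (tropP_lineD R)) /=; apply: eq_bigl => w; exact: in_open_coneE.
Qed.

Lemma degree_lineD (R : realType) : degree (lineD R) = 1.
Proof. by rewrite /degree (perm_big _ (tropP_lineD R)) big_cons big_seq1 !mxE. Qed.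

Lemma degree_coord (R : realType) (C : tropical_curve R) (i : 'I_4) :
  degree C = \sum_(s <- finsupp C) (C s)%:Z * val s 0 i.
Proof.
have := congr1 (fun M : 'rV_4 => M 0 i) (degreeP C); rewrite mxE => <-.
rewrite summxE /tropP big_map; apply: eq_bigr => s _.
by rewrite mulmxnE int_mulrn.
Qed.

(** The vectors of D have entries 1, 1 in the open cones 01 and 23, so the corrections are minima of
    two coordinates of a ray. The degree of C may be read off at any coordinate; coordinate 2 makes
    the correction of the cone 23 combine with it to [cone_defect]. *)
Lemma intersection_lineD (R : realType) (C : tropical_curve R) :
  intersection C (lineD R) = \sum_(s <- finsupp C) (C s)%:Z * (cone_defect s)%:Z -
    \sum_(s <- finsupp C) (C s)%:Z * (corner_min s)%:Z.
Proof.
have open_scale (i j k l : 'I_4) (v : 'rV[int]_4) (n : nat) : (0 < n)%N -> is_chart i j k l ->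
    in_open_cone i j (v *+ n) = in_open_cone i j v.
  move=> n0 Hc; rewrite !(in_open_coneE _ Hc) !mulmxnE !pmulrn_lgt0 //.
  by rewrite !mulrn_eq0 (gtn_eqF n0).
rewrite /intersection degree_lineD mulr1 (degree_coord C o2).
have hc : is_chart o0 o1 o2 o3 by [].
have inner (i j k l : 'I_4) : is_chart i j k l ->
  \sum_(v <- tropP C | in_open_cone i j v) \sum_(w <- tropP (lineD R) | in_open_cone i j w)
    Num.min (v 0 i * w 0 j) (v 0 j * w 0 i) =
  \sum_(s <- finsupp C | in_open_cone i j (val s)) (C s)%:Z *
    \sum_(w <- [:: row4 1 1 0 0; row4 0 0 1 1] | [&& 0 < w 0 i, 0 < w 0 j, w 0 k == 0 & w 0 l == 0])
      Num.min (val s 0 i * w 0 j) (val s 0 j * w 0 i).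
  move=> Hc; rewrite /tropP big_map big_seq_cond [RHS]big_seq_cond.
  rewrite (eq_bigl (fun s => (s \in finsupp C) && in_open_cone i j (val s))); last first.
    move=> s; case: (boolP (s \in finsupp C)) => //=; rewrite mem_finsupp -lt0n => h.
    exact: open_scale h Hc.
  apply: eq_bigr => s _; rewrite (lineD_inner _ _ Hc) mulr_sumr; apply: eq_bigr => w _.
  by rewrite !mulmxnE !int_mulrn minr_pMr // !mulrA.
have inner0 (i j k l : 'I_4) : is_chart i j k l ->
    ~~ [&& 0 < (row4 1 1 0 0 : 'rV[int]_4) 0 i, 0 < (row4 1 1 0 0 : 'rV[int]_4) 0 j,
      (row4 1 1 0 0 : 'rV[int]_4) 0 k == 0 & (row4 1 1 0 0 : 'rV[int]_4) 0 l == 0] ->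
    ~~ [&& 0 < (row4 0 0 1 1 : 'rV[int]_4) 0 i, 0 < (row4 0 0 1 1 : 'rV[int]_4) 0 j,
      (row4 0 0 1 1 : 'rV[int]_4) 0 k == 0 & (row4 0 0 1 1 : 'rV[int]_4) 0 l == 0] ->
    \sum_(v <- tropP C | in_open_cone i j v) \sum_(w <- tropP (lineD R) | in_open_cone i j w)
      Num.min (v 0 i * w 0 j) (v 0 j * w 0 i) = 0.
  move=> Hc /negbTE h1 /negbTE h2; rewrite (inner _ _ _ _ Hc) big1 // => s _.
  by rewrite 2!big_cons big_nil h1 h2 mulr0.
rewrite (sum_chart hc); do 4!rewrite [\sum_(j < 4 | _) _]big_mkcond (sum_chart hc) /=.
rewrite !addr0 !add0r.
rewrite (inner0 o0 o2 o1 o3) // ?mxE // (inner0 o0 o3 o1 o2) ?mxE //.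
rewrite (inner0 o1 o2 o0 o3) // ?mxE // (inner0 o1 o3 o0 o2) ?mxE //.
rewrite (inner o0 o1 o2 o3) // (inner o2 o3 o0 o1) // !addr0 ?add0r.
rewrite opprD addrA addrAC; congr (_ - _).
  rewrite [X in _ - X]big_mkcond -sumrB; apply: eq_bigr => s _.
  rewrite 2!big_cons big_nil !mxE /= addr0 !mulr1 /cone_defect.
  have s2 := ray_ge0 s o2; have s3 := ray_ge0 s o3.
  case: ifP => _; rewrite ?subr0; last by rewrite gez0_abs.
  rewrite -mulrBr; congr (_ * _).
  exact: subz_min.
rewrite big_mkcond; apply: eq_bigr => s _.
rewrite 2!big_cons big_nil !mxE /= addr0 !mulr1 /corner_min.
have s0 := ray_ge0 s o0; have s1 := ray_ge0 s o1.
case: ifP => _; rewrite ?mulr0 //; congr (_ * _).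
exact: minz_absz.
Qed.

Theorem proposition5p10 (K : closedFieldType) (R : realType)
    (C : tropical_curve R) (k1 k2 k : nat)
    (hk1 : k1 = C ray1100) (hk2 : k2 = C ray0011) (hk : k = minn k1 k2)
    (hCD : intersection C (lineD R) < - (k%:Z)) :
  ~ realizable K C.
Proof.
move=> [Y [hplane [_ hY]]]; move: hCD; apply/negP; rewrite -leNgt intersection_lineD.
have swap (F : ray -> nat) : (\sum_(s <- finsupp C) C s * F s =
    \sum_(Z <- finsupp Y) Y Z * \sum_(s <- finsupp C) trop_mult R Z s * F s)%N.
  under eq_bigr => s _ do rewrite -hY /Trop_mult big_distrl /=.
  rewrite exchange_big /=; apply: eq_bigr => Z _; rewrite big_distrr /=.
  by apply: eq_bigr => s _; rewrite mulnA.
have hsum (F : ray -> nat) : \sum_(s <- finsupp C) (C s)%:Z * (F s)%:Z =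
    (\sum_(s <- finsupp C) C s * F s)%N%:Z.
  by rewrite [RHS](big_morph Posz PoszD (erefl 0%:Z)); apply: eq_bigr => s _; rewrite PoszM.
rewrite !hsum lerBrDr addrC lerBlDr -PoszD lez_nat !swap.
(* A sum of minima is at most the minimum of the sums, so the errors of all components together stay
   within k. *)
have hk' : (\sum_(Z <- finsupp Y) Y Z * minn (trop_mult R Z ray1100) (trop_mult R Z ray0011) <= k)%N.
  rewrite hk hk1 hk2 -!hY leq_min; apply/andP; split; apply: leq_sum => Z _;
    by rewrite leq_mul2l ?geq_minl ?geq_minr orbT.
apply: leq_trans (leq_add (leqnn _) hk').
rewrite -big_split /= !big_seq; apply: leq_sum => Z hZ; rewrite -mulnDr leq_mul2l.
apply/orP; right; apply: curve_inequality; [exact: hplane|exact: fset_uniq|].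
(* No cancellation occurs in the cycle: Z has a positive coefficient, so a ray of positive
   multiplicity in its tropicalization is a ray of C. *)
move=> s hs; rewrite mem_finsupp -hY /Trop_mult -lt0n (big_rem Z) //=.
by apply: leq_trans (leq_addr _ _); rewrite muln_gt0 hs andbT lt0n -mem_finsupp.
Qed.
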